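(* Let $Z\ne0$ be a reduced effective divisor on the smooth complex variety $X$, let $\alpha\in(0,1]$ be a rational number and let $p\ge0$ be an integer. Then the pair $(X,\alpha Z)$ is $p$-log canonical if and only if $$p\le\widetilde{\alpha}_Z-\alpha.$$ Similarly, for $x\in Z$, the pair $(X,\alpha Z)$ is $p$-log canonical in some neighborhood of $x$ if and only if $p\le\widetilde{\alpha}_{Z,x}-\alpha$.
   Context: Hodge ideals. Let $D=\alpha Z$, $\beta=1-\alpha$. The ideals $I_p(D)$, $p\ge0$, are defined locally, so let $f$ be an equation of $Z$ on $X$ (the result does not depend on $f$). Let $\mathcal{O}_X( *Z)=\bigcup_{m\ge0}\mathcal{O}_X(mZ)$ and let $\mathcal{M}(f^\beta)=\mathcal{O}_X( *Z)f^\beta$ be the free rank one $\mathcal{O}_X( *Z)$-module on the symbol $f^\beta$, with $\mathcal{D}_X$-action given by $\xi(wf^\beta)=\big(\xi(w)+w\frac{\beta\,\xi(f)}{f}\big)f^\beta$ for derivations $\xi$. Let $U=X\smallsetminus Z$, $j\colon U\hookrightarrow X$ the inclusion, $\ell\ge2$ an integer with $\ell\beta\in\mathbf{Z}$, and $\pi\colon W=\mathrm{Spec}\,\mathcal{O}_U[y]/(y^\ell-f^{\ell\beta})\to U$, a finite étale cover. Then $\pi_+\mathcal{O}_W=\bigoplus_{i=0}^{\ell-1}\mathcal{O}_Uy^i$ as $\mathcal{D}_U$-modules and $\mathcal{O}_Uy\simeq\mathcal{M}(f^\beta)|_U$ via $y\leftrightarrow f^\beta$, so $\mathcal{M}(f^\beta)$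 is a direct summand of $j_+\pi_+\mathcal{O}_W$. The latter underlies the mixed Hodge module $j_*\pi_*\mathbf{Q}^H_W[\dim X]$ and so has a Hodge filtration (normalized by $F_k\mathcal{O}_W=\mathcal{O}_W$ for $k\ge0$ and $F_k\mathcal{O}_W=0$ for $k<0$); $F_k\mathcal{M}(f^\beta)$ denotes the induced filtration on this filtered direct summand (independent of $\ell$). It is known that $F_p\mathcal{M}(f^\beta)=I_p(D)\cdot\mathcal{O}_X\big((p+1)Z\big)f^\beta$ for a coherent ideal sheaf $I_p(D)\subseteq\mathcal{O}_X$, the $p$-th Hodge ideal of $D$; equivalently, $g\in I_p(D)$ iff $\frac{g}{f^{p+1}}f^\beta\in F_p\mathcal{M}(f^\beta)$. The pair $(X,D)$ is $p$-log canonical if $I_0(D)=\cdots=I_p(D)=\mathcal{O}_X$. Minimal exponent. For a nonzero $f\in\mathcal{O}_X(X)$, the Bernstein-Sato polynomial $b_f(s)\in\mathbf{C}[s]$ is the nonzero monic polynomial of minimal degree with $b_f(s)f^s\in\mathcal{D}_X[s]\cdot f^{s+1}$. For a nonzero effective divisor $E$ with equations $f_i$ on the members of a finite open cover $X=\bigcup_iU_i$, $b_E(s)$ is the least common multiple of the $b_{f_i}(s)$. For $x\in E$ there is an open neighborhood $U$ of $x$ such that $b_{E|_U}(s)$ divides $b_{E|_{U'}}(s)$ for every open neighborhood $U'$ of $x$; put $b_{E,x}(s):=b_{E|_U}(s)$. Both $b_E$ and $b_{E,x}$ are divisible by $s+1$, with quotients $\widetilde{b}_E$ and $\widetilde{b}_{E,x}$;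 all roots are negative rational numbers. The minimal exponents $\widetilde{\alpha}_E$ and $\widetilde{\alpha}_{E,x}$ are the negatives of the largest roots of $\widetilde{b}_E(s)$ and $\widetilde{b}_{E,x}(s)$, respectively, with value $\infty$ if the polynomial is constant. *)

(* Defs.v *)
From mathcomp Require Import all_boot all_order all_algebra.
From mathcomp Require Import all_classical all_reals ereal topology.
From mathcomp Require Import complex.
From mathcomp Require mpoly.

Set Implicit Arguments.
Unset Strict Implicit.
Unset Printing Implicit Defensive.

Import Order.TTheory GRing.Theory Num.Theory.

#[global] Open Scope ring_scope.
#[global] Open Scope classical_set_scope.

(** * Complex varieties as spaces with functions

    A reduced complex variety is given by the topological space of its closed
    points (Zariski topology) and its regular functions with values in
    [R[i]].  The structure sheaf is encoded by [reg x g], which says that the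
    function [g] is regular on some neighbourhood of [x].  Values of [g] far
    from [x] are irrelevant. *)

Definition coords {R : realType} {X : Type} {n : nat}
  (phi : 'I_n -> X -> R[i]) (x : X) : 'I_n -> R[i] := fun i => phi i x.

(* [phi] identifies [U] with a Zariski closed subset of [R[i]^n], with the
   induced topology and the induced regular functions.  The fourth clause
   says that the image contains its Zariski closure; the last one makes [U]
   itself open. *)
Record affine_chart {R : realType} {X : topologicalType}
    (reg : X -> (X -> R[i]) -> Prop) (U : set X) (n : nat)
    (phi : 'I_n -> X -> R[i]) : Prop := AffineChart {
  chart_inj : forall x y, U x -> U y -> coords phi x = coords phi y -> x = y;
  chart_closed : forall v : 'I_n -> R[i],
    (forall P : mpoly.mpoly n R[i],
        (forall x, U x -> mpoly.meval (coords phi x) P = 0) ->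
        mpoly.meval v P = 0) ->
    exists2 x, U x & coords phi x = v;
  chart_regular : forall x (g : X -> R[i]), U x ->
    (reg x g <->
     exists P Q : mpoly.mpoly n R[i],
       mpoly.meval (coords phi x) Q != 0 /\
       forall y, U y -> mpoly.meval (coords phi y) Q != 0 ->
         g y = mpoly.meval (coords phi y) P / mpoly.meval (coords phi y) Q);
  chart_open : forall A : set X, A `<=` U ->
    (open A <->
     forall x, A x -> exists P : mpoly.mpoly n R[i],
       mpoly.meval (coords phi x) P != 0 /\
       forall y, U y -> mpoly.meval (coords phi y) P != 0 -> A y)
}.

Definition affine_open {R : realType} {X : topologicalType}
    (reg : X -> (X -> R[i]) -> Prop) (U : set X) : Prop :=
  exists n (phi : 'I_n -> X -> R[i]), affine_chart reg U phi.

(* Integral separated scheme of finite type.  [variety_separated] says that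
   for affine opens [U], [V] the diagonal of [U `&` V] is Zariski closed in
   [U * V]. *)
Record variety (R : realType) := Variety {
  points :> topologicalType;
  regular_at : points -> (points -> R[i]) -> Prop;
  variety_cover : exists n (U : 'I_n -> set points),
    (forall i, affine_open regular_at (U i)) /\
    (forall x, exists i, U i x);
  variety_irreducible : [set: points] !=set0 /\
    forall U V : set points,
      open U -> open V -> U !=set0 -> V !=set0 -> (U `&` V) !=set0;
  variety_separated : forall (U V : set points) x y,
    affine_open regular_at U -> affine_open regular_at V ->
    U x -> V y -> x <> y ->
    exists m (a b : 'I_m -> points -> R[i]),
      [/\ forall i z, U z -> regular_at z (a i),
          forall i z, V z -> regular_at z (b i),
          forall z, U z -> V z -> \sum_(i < m) a i z * b i z = 0 &
          \sum_(i < m) a i x * b i y != 0]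
}.

Definition affine {R : realType} {X : variety R} (U : set X) : Prop :=
  affine_open (@regular_at R X) U.

Definition regular_on {R : realType} {X : variety R} (U : set X)
    (g : X -> R[i]) : Prop :=
  forall x, U x -> regular_at x g.

(* Jacobian criterion: near each point, some affine chart is the zero locus
   of finitely many polynomials with independent differentials there. *)
Definition smooth {R : realType} (X : variety R) : Prop :=
  forall x : X, exists (U : set X) (n : nat) (phi : 'I_n -> X -> R[i])
      (c : nat) (P : 'I_c -> mpoly.mpoly n R[i]),
    [/\ U x /\ affine_chart (@regular_at R X) U phi,
        forall i y, U y -> mpoly.meval (coords phi y) (P i) = 0,
        exists Q : mpoly.mpoly n R[i],
          mpoly.meval (coords phi x) Q != 0 /\
          forall v, mpoly.meval v Q != 0 ->
            (forall i, mpoly.meval v (P i) = 0) ->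
            exists2 y, U y & coords phi y = v &
        row_free (\matrix_(i < c, j < n)
          mpoly.meval (coords phi x) (mpoly.mderiv j (P i)))].

(* A section over [U] of the sheaf of [R[i]]-linear derivations of the
   structure sheaf, acting on germs of regular functions at all points of
   [U]. *)
Record derivation_on {R : realType} {X : variety R} (U : set X)
    (theta : (X -> R[i]) -> (X -> R[i])) : Prop := DerivationOn {
  derivation_regular : forall x g, U x -> regular_at x g ->
    regular_at x (theta g);
  derivation_germ : forall x g h, U x -> regular_at x g ->
    (\forall y \near x, g y = h y) -> theta g x = theta h x;
  derivation_linear : forall x (a : R[i]) g h, U x ->
    regular_at x g -> regular_at x h ->
    theta (a *: g + h) x = a * theta g x + theta h x;
  derivation_leibniz : forall x g h, U x ->
    regular_at x g -> regular_at x h ->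
    theta (g * h) x = theta g x * h x + g x * theta h x
}.

(** * Reduced divisors *)

(* [f] is an equation over [U] of the reduced divisor with support [Z]: at
   each point of [U] it generates the ideal of germs vanishing on [Z]. *)
Definition equation {R : realType} {X : variety R} (Z U : set X)
    (f : X -> R[i]) : Prop :=
  [/\ regular_on U f,
      forall x, U x -> (Z x <-> f x = 0) &
      forall x g, U x -> regular_at x g ->
        (\forall y \near x, Z y -> g y = 0) ->
        exists2 h, regular_at x h & \forall y \near x, g y = f y * h y].

(* A reduced effective Cartier divisor is determined by its support.  The
   condition [Z != X] makes the local equations nonzero. *)
Definition nonzero_reduced_divisor {R : realType} {X : variety R}
    (Z : set X) : Prop :=
  [/\ Z !=set0, Z != [set: X] &
      forall x, exists (U : set X) (f : X -> R[i]),
        [/\ open U, U x & equation Z U f]].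

(** * Bernstein-Sato polynomials and minimal exponents *)

Definition off_zeros {R : realType} {X : variety R} (U : set X)
    (f : X -> R[i]) : set X :=
  [set x | U x /\ f x != 0].

Definition extend0 {R : realType} {X : variety R} (A : set X)
    (g : X -> R[i]) : X -> R[i] := patch (fun=> 0) A g.

(* An element of O_X( *Z)[s] f^s over [U] is encoded by the sequence [u] of
   its coefficients, for [\sum_j u j s^j f^s], each extended by zero outside
   [off_zeros U f].  For [U] affine this is the condition of being a
   D_X(U)[s]-submodule: D_X is generated by functions and derivations, and
   [theta (w s^j f^s) =
      theta w s^j f^s + w (theta f / f) s^(j+1) f^s]. *)
Definition Ds_submodule {R : realType} {X : variety R} (U : set X)
    (f : X -> R[i]) (S : set (nat -> X -> R[i])) : Prop :=
  [/\ S 0 /\ (forall (a : R[i]) u v, S u -> S v -> S (a *: u + v)),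
      forall g u, regular_on U g -> S u -> S (fun j => g * u j),
      forall theta u, derivation_on U theta -> S u ->
        S (fun j => extend0 (off_zeros U f) (theta (u j)) +
             if j is j'.+1 then (fun x => theta f x / f x * u j' x) else 0) &
      forall u, S u -> S (fun j => if j is j'.+1 then u j' else 0)].

(* b(s) f^s belongs to D_X[s] f^(s+1), over the affine open [U]. *)
Definition functional_equation {R : realType} {X : variety R} (U : set X)
    (f : X -> R[i]) (b : {poly R[i]}) : Prop :=
  forall S, Ds_submodule U f S ->
    S (fun j => if j is 0%N then extend0 (off_zeros U f) f else 0) ->
    S (fun j => extend0 (off_zeros U f) (fun=> b`_j)).

(* On an arbitrary open [U], membership in a subsheaf is a local condition. *)
Definition bernstein_sato_equation {R : realType} {X : variety R} (U : set X)
    (f : X -> R[i]) (b : {poly R[i]}) : Prop :=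
  forall x, U x -> exists W : set X,
    [/\ affine W, W x, W `<=` U & functional_equation W f b].

Definition bernstein_sato_function {R : realType} {X : variety R} (U : set X)
    (f : X -> R[i]) (b : {poly R[i]}) : Prop :=
  [/\ b \is monic, bernstein_sato_equation U f b &
      forall c : {poly R[i]}, c != 0 -> bernstein_sato_equation U f c ->
        (size b <= size c)%N].

(* [b] is b_E, for E the restriction to the open set [Y] of the reduced
   divisor with support [Z]. *)
Definition bernstein_sato {R : realType} {X : variety R} (Z Y : set X)
    (b : {poly R[i]}) : Prop :=
  exists n (U : 'I_n -> set X) (f : 'I_n -> X -> R[i])
      (bs : 'I_n -> {poly R[i]}),
    [/\ forall i, open (U i) /\ equation Z (U i) (f i),
        forall x, Y x <-> exists i, U i x,
        forall i, bernstein_sato_function (U i) (f i) (bs i),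
        b \is monic &
        forall c : {poly R[i]}, (b %| c) = [forall i, bs i %| c]].

Definition bernstein_sato_at {R : realType} {X : variety R} (Z : set X) (x : X)
    (b : {poly R[i]}) : Prop :=
  exists U : set X,
    [/\ open U, U x, bernstein_sato Z U b &
        forall (U' : set X) b', open U' -> U' x -> bernstein_sato Z U' b' ->
          b %| b'].

(* [z <= r%:C] in [R[i]] says that [z] is real and at most [r]. *)
Definition negated_largest_root {R : realType} (q : {poly R[i]})
    (a : \bar R) : Prop :=
  ((size q <= 1)%N /\ a = +oo%E) \/
  exists r : R, [/\ root q r%:C%C, forall z, root q z -> z <= r%:C%C &
                    a = (- r)%:E].

(* [a] is the minimal exponent of the divisor with support [Z]. *)
Definition minimal_exponent {R : realType} {X : variety R} (Z : set X)
    (a : \bar R) : Prop :=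
  exists2 q : {poly R[i]}, bernstein_sato Z [set: X] (q * ('X + 1)) &
    negated_largest_root q a.

Definition minimal_exponent_at {R : realType} {X : variety R} (Z : set X)
    (x : X) (a : \bar R) : Prop :=
  exists2 q : {poly R[i]}, bernstein_sato_at Z x (q * ('X + 1)) &
    negated_largest_root q a.

(** * The Hodge filtration

    Let [U] be affine and [f] an equation of Z on [U].  The D-module
    N = j_+ pi_+ O_W is the direct sum of the O_X( *Z) y^i, for [i < l].  Since
    y^l = f^(l beta), a derivation acts by
    [theta (w y^i) = (theta w + i beta (theta f / f) w) y^i].  An element of N
    is a function ['I_l -> X -> R[i]], with components regular on
    [off_zeros U f] and extended by zero.

    Let [iota] be the graph embedding of [f].  An element of
    B = iota_+ N = N[d_t] delta is the sequence [u] of its coefficients, for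
    [\sum_j (u j) d_t^j delta]. *)

Definition graph_module {R : realType} {X : variety R} (l : nat) (U : set X)
    (f : X -> R[i]) : set (nat -> 'I_l -> X -> R[i]) :=
  [set u | (forall j i, regular_on (off_zeros U f) (u j i) /\
                        forall x, ~ off_zeros U f x -> u j i x = 0) /\
           exists m, forall j, (m <= j)%N -> u j = 0].

(* theta (w d_t^j delta) = theta(w) d_t^j delta - theta(f) w d_t^(j+1) delta *)
Definition theta_act {R : realType} {X : variety R} {l : nat} (U : set X)
    (f : X -> R[i]) (beta : R[i]) (theta : (X -> R[i]) -> (X -> R[i]))
    (u : nat -> 'I_l -> X -> R[i]) : nat -> 'I_l -> X -> R[i] :=
  fun j i x =>
    extend0 (off_zeros U f) (theta (u j i)) x
    + i%:R * beta * (theta f x / f x) * u j i x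
    - (if j is j'.+1 then theta f x * u j' i x else 0).

Definition dt_act {R : realType} {X : variety R} {l : nat}
    (u : nat -> 'I_l -> X -> R[i]) : nat -> 'I_l -> X -> R[i] :=
  fun j => if j is j'.+1 then u j' else 0.

(* t (w d_t^j delta) = f w d_t^j delta - j w d_t^(j-1) delta *)
Definition t_act {R : realType} {X : variety R} {l : nat} (f : X -> R[i])
    (u : nat -> 'I_l -> X -> R[i]) : nat -> 'I_l -> X -> R[i] :=
  fun j i x => f x * u j i x - j.+1%:R * u j.+1 i x.

(* Submodules over V^0 D = D_X[t, d_t t]. *)
Definition V0D_submodule {R : realType} {X : variety R} {l : nat} (U : set X)
    (f : X -> R[i]) (beta : R[i]) (S : set (nat -> 'I_l -> X -> R[i])) : Prop :=
  [/\ S 0 /\ (forall (a : R[i]) u v, S u -> S v -> S (a *: u + v)),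
      forall g u, regular_on U g -> S u -> S (fun j i => g * u j i),
      forall theta u, derivation_on U theta -> S u ->
        S (theta_act U f beta theta u),
      forall u, S u -> S (t_act f u) &
      forall u, S u -> S (dt_act (t_act f u))].

Definition V_gt {R : realType} {T : Type} (V : R -> set T) (c : R) : set T :=
  [set u | exists2 c', c < c' & V c' u].

(* The Kashiwara-Malgrange V-filtration along t = 0 of the graph module, as
   global sections over the affine open [U]; it is unique. *)
Record V_filtration {R : realType} {X : variety R} {l : nat} (U : set X)
    (f : X -> R[i]) (beta : R[i])
    (V : R -> set (nat -> 'I_l -> X -> R[i])) : Prop := VFiltration {
  V_submodule : forall c, V0D_submodule U f beta (V c);
  V_fingen : forall c, exists n (e : 'I_n -> nat -> 'I_l -> X -> R[i]),
    (forall k, V c (e k)) /\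
    forall S, V0D_submodule U f beta S -> (forall k, S (e k)) -> V c `<=` S;
  V_decreasing : forall c c', c <= c' -> V c' `<=` V c;
  V_exhaustive : \bigcup_(c in [set: R]) V c = graph_module U f;
  V_discrete : forall c, exists2 e : R, 0 < e &
    (forall c', c - e < c' <= c -> V c' = V c) /\
    (forall c', c < c' < c + e -> V c' = V_gt V c);
  V_t : forall c, t_act f @` V c `<=` V (c + 1);
  V_t_eq : forall c, 0 < c -> t_act f @` V c = V (c + 1);
  V_dt : forall c, dt_act @` V c `<=` V (c - 1);
  V_nilpotent : forall c, exists m, forall u, V c u ->
    V_gt V c (iter m (fun w => dt_act (t_act f w) - c%:C%C *: w) u)
}.

(* Over the complement of Z, pi_+ O_W has the filtration F_k = everything for
   [0 <= k] and F_k = 0 for [k < 0], so that F_q of its graph direct image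
   consists of the elements of order at most [q] in d_t.  The Hodge filtration
   of the open direct image j_* is Saito's: it is generated by V^0, i.e.
   [F_k B = \sum_(i <= k) d_t^i (V^0 B `&` j_* F_(k-i))]. *)
Definition hodge_graph {R : realType} {X : variety R} {l : nat}
    (V : R -> set (nat -> 'I_l -> X -> R[i])) (k : nat) :
    set (nat -> 'I_l -> X -> R[i]) :=
  [set u | exists v : nat -> nat -> 'I_l -> X -> R[i],
     (forall i, (i <= k)%N ->
        V 0 (v i) /\ forall j, (k - i < j)%N -> v i j = 0) /\
     u = \sum_(i < k.+1) iter i dt_act (v i)].

(* F_k N is recovered from F_k B = \bigoplus_j F_(k-j) N d_t^j delta. *)
Definition hodge_filtration {R : realType} {X : variety R} (l : nat)
    (U : set X) (f : X -> R[i]) (beta : R[i]) (k : nat) :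
    set ('I_l -> X -> R[i]) :=
  [set w | exists2 V, V_filtration U f beta V &
     hodge_graph V k (fun j => if j is 0%N then w else 0)].

(* M(f^beta) is the summand O_X( *Z) y^1 of N, with the induced filtration. *)
Definition hodge_filtration_M {R : realType} {X : variety R} (l : nat)
    (U : set X) (f : X -> R[i]) (beta : R[i]) (k : nat) : set (X -> R[i]) :=
  [set w | hodge_filtration U f beta k
             (fun i : 'I_l => if i == 1%N :> nat then w else 0)].

(** * Hodge ideals *)

(* Sections over the affine open [U] of the [k]-th Hodge ideal of [alpha] times
   the divisor with equation [f]. *)
Definition hodge_ideal {R : realType} {X : variety R} (l : nat) (alpha : rat)
    (U : set X) (f : X -> R[i]) (k : nat) : set (X -> R[i]) :=
  [set g | regular_on U g /\
     hodge_filtration_M l U f (ratr (1 - alpha)) k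
       (extend0 (off_zeros U f) (fun x => g x / f x ^+ k.+1))].

(* The pair formed by the open subset [Y] and the restriction of [alpha Z] is
   [p]-log canonical. *)
Definition log_canonical {R : realType} {X : variety R} (l : nat) (Z : set X)
    (alpha : rat) (p : nat) (Y : set X) : Prop :=
  forall (U : set X) (f : X -> R[i]), affine U -> U `<=` Y -> equation Z U f ->
  forall k, (k <= p)%N ->
    hodge_ideal l alpha U f k = [set g | regular_on U g].

(* Main.v *)
(* Let delta generate the summand f^beta of the graph module B, let N be its
   span under O, derivations and E = d_t t, and put dc = d_t - beta t^-1.  An
   element u lies in V^c if and only if, for every m, some polynomial in E whose
   roots are all >= c maps u into t^m N.  Everything goes through the condition

     (V_p)   dc^k delta belongs to V^1 for all k <= p.

   Hodge ideals.  The elements dc^j delta form an O-basis of the lattice of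
   elements of B without poles along Z.  The identity
     (alpha)_k t^(-k-1) delta
       = sum_i (-1)^i binom(k, i) d_t^i t^-1 dc^(k-i) delta
   places O f^(-k-1) f^beta in the Hodge filtration as soon as (V_k) holds.
   Conversely, if f^(-k-1) f^beta = sum_i d_t^i v_i with v_i in V^0, then t v_0
   lies in V^1, hence in the lattice, and its coefficient on dc^k delta is
   invertible modulo f and V^1; induction on k gives (V_k).

   Bernstein-Sato polynomials.  On the lattice put s = beta - E, and let J be the
   module over derivations and s generated by f delta and all theta(f) delta;
   then q(s) delta is in J if and only if (s+1) q(s) f^s is in D[s] f^(s+1).
   Since theta delta = - theta(f) dc delta and dc t delta = - s delta, one has
   dc J in N, and, for p > 0, N is contained in
   sum_(j < p) O dc^j delta + dc^p J.  As E dc = dc (E - 1), a functional equation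
   (s+1) q with all roots of q at most -p-alpha gives (V_p), and conversely.

   Functional equations glue over affine opens because derivations extend after
   multiplication by a bump function, that is, a regular function nonzero at a
   given point and vanishing outside a given neighbourhood. *)

From HB Require Import structures.
Require Import Defs.
From mathcomp Require Import all_boot all_order all_algebra.
From mathcomp Require Import all_classical all_reals ereal topology.
From mathcomp Require Import complex.
From mathcomp Require mpoly lebesgue_measure.
From mathcomp Require Import ring lra zify.
Import (canonicals, coercions) mpoly.
Import Order.TTheory GRing.Theory Num.Theory.

Set Implicit Arguments.
Unset Strict Implicit.
Unset Printing Implicit Defensive.

Local Open Scope ring_scope.
Local Open Scope classical_set_scope.

(** * Modules with operators t and d_t *)

(** On the graph module t is bijective because f is invertible there, so d_t and its twists are
    polynomials in E = d_t t times powers of t, and commutation amounts to shifting the variable of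
    a polynomial by an integer. Membership is then decided by Bezout's identity: if two coprime
    polynomials in E send an element into a submodule stable under E, the element itself lies in it.
    The Hodge filtration is defined through some V-filtration, so uniqueness is needed to recognise
    a given one and existence to exhibit one. Both rest on a lattice; existence also asks for a
    functional equation with real roots. Varieties are given by their points and regularity is a
    pointwise condition. The passage from local quotients to global polynomials goes through a
    Nullstellensatz over R[i], proved by a cardinality argument since R is uncountable.
    Bernstein-Sato polynomials come with functional equations on small affine sets, whereas Hodge
    ideals are tested on all affine sets; this gap is what the gluing has to close. *)

Definition op_poly {K : comNzRingType} {M : lmodType K} (E : M -> M)
    (p : {poly K}) (u : M) : M :=
  \sum_(i < size p) p`_i *: iter i E u.

Section OpPoly.
Variables (K : comNzRingType) (M : lmodType K) (E : {linear M -> M}).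
Local Notation pe := (op_poly E).
Implicit Types (p q : {poly K}) (u v : M).

Lemma op_polyE n p u : (size p <= n)%N ->
  pe p u = \sum_(i < n) p`_i *: iter i E u.
Proof.
move=> le_pn; rewrite /op_poly -(subnKC le_pn) big_split_ord /=.
rewrite [X in _ + X]big1 ?addr0 // => i _.
by rewrite nth_default ?scale0r // leq_addr.
Qed.

Lemma iter_linear_sub i : linear (iter i E).
Proof. by elim: i => [|i IHi] a u v //=; rewrite IHi linearP. Qed.

Lemma op_poly_is_linear p : linear (pe p).
Proof.
move=> a u v; rewrite /op_poly scaler_sumr -big_split /=.
by apply: eq_bigr => i _; rewrite iter_linear_sub scalerDr !scalerA mulrC.
Qed.
HB.instance Definition _ p :=
  GRing.isLinear.Build K M M *:%R (pe p) (op_poly_is_linear p).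

Lemma op_polyD p q u : pe (p + q) u = pe p u + pe q u.
Proof.
rewrite (op_polyE _ (leq_maxl (size p) (size q))).
rewrite (op_polyE _ (leq_maxr (size p) (size q))) -big_split /=.
rewrite (op_polyE _ (size_polyD p q)).
by apply: eq_bigr => i _; rewrite coefD scalerDl.
Qed.

Lemma op_polyZ a p u : pe (a *: p) u = a *: pe p u.
Proof.
rewrite (op_polyE _ (size_scale_leq a p)) /op_poly scaler_sumr.
by apply: eq_bigr => i _; rewrite coefZ scalerA.
Qed.

Lemma op_polyC c u : pe c%:P u = c *: u.
Proof.
by rewrite (op_polyE (n := 1)) ?size_polyC_leq1 // big_ord1 coefC.
Qed.

Lemma op_poly0 u : pe 0 u = 0.
Proof. by rewrite -polyC0 op_polyC scale0r. Qed.

Lemma op_poly1 u : pe 1 u = u.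
Proof. by rewrite -polyC1 op_polyC scale1r. Qed.

Lemma op_polyN p u : pe (- p) u = - pe p u.
Proof. by rewrite -(scaleN1r p) op_polyZ scaleN1r. Qed.

Lemma op_poly_sum (I : Type) (r : seq I) (P : pred I) (F : I -> {poly K}) u :
  pe (\sum_(i <- r | P i) F i) u = \sum_(i <- r | P i) pe (F i) u.
Proof.
elim/big_rec2: _ => [|i y1 y2 _ <-]; first exact: op_poly0.
by rewrite op_polyD.
Qed.

Lemma op_polyMX p u : pe (p * 'X) u = pe p (E u).
Proof.
rewrite (op_polyE (n := (size p).+1)); last first.
  by rewrite (leq_trans (size_polyMleq _ _)) // size_polyX addnC.
rewrite big_ord_recl coefMX /= scale0r add0r.
by apply: eq_bigr => i _; rewrite coefMX /= -iterSr.
Qed.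

Lemma op_polyX u : pe 'X u = E u.
Proof. by rewrite -[X in pe X]mul1r op_polyMX op_poly1. Qed.

(** The rule by which t, its inverse and the twisted derivative are moved past polynomials in E;
    each of them shifts E by 1 or -1. *)
Lemma op_poly_shift (F : {linear M -> M}) c p u :
  (forall u, F (E u) = E (F u) + c *: F u) ->
  F (pe p u) = pe (p \Po ('X + c%:P)) (F u).
Proof.
move=> FE; elim/poly_ind: p u => [|p a IHp] u.
  by rewrite comp_poly0 !op_poly0 linear0.
rewrite comp_polyD comp_polyM comp_polyX comp_polyC !op_polyD !op_polyC.
rewrite linearD linearZ /= op_polyMX IHp FE; congr (_ + _).
rewrite mulrDr op_polyD op_polyMX linearD /=; congr (_ + _).
by rewrite mulrC mul_polyC op_polyZ linearZ.
Qed.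

Lemma op_poly_comm (F : {linear M -> M}) p u :
  (forall u, F (E u) = E (F u)) -> F (pe p u) = pe p (F u).
Proof.
move=> FE; rewrite (@op_poly_shift _ 0) ?addr0 ?comp_polyXr // => v.
by rewrite scale0r addr0.
Qed.

Lemma op_polyM p q u : pe (p * q) u = pe p (pe q u).
Proof.
elim/poly_ind: p u => [|p a IHp] u; first by rewrite mul0r !op_poly0.
rewrite mulrDl !op_polyD mul_polyC op_polyZ op_polyC; congr (_ + _).
rewrite mulrAC !op_polyMX. rewrite IHp; congr (pe p _).
by rewrite op_poly_comm.
Qed.

Lemma op_polyMC p q u : pe (p * q) u = pe q (pe p u).
Proof. by rewrite mulrC op_polyM. Qed.

End OpPoly.

(** * Polynomials sorted by the position of their roots *)

Section RootSplitting.
Variable R : realType.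
Implicit Types (P Q : {poly R[i]}) (a : pred R[i]).

Definition roots_in a P := forall z, root P z -> a z.

(** Every number is a root of 0, so a root condition that fails somewhere already excludes the zero
    polynomial, and no separate hypothesis has to be carried along. *)
Lemma roots_in_neq0 a P z : ~~ a z -> roots_in a P -> P != 0.
Proof. by move=> az rP; apply/eqP => P0; move: az; rewrite rP // P0 root0. Qed.

Lemma roots_inM a P Q : roots_in a P -> roots_in a Q -> roots_in a (P * Q).
Proof. by move=> rP rQ z; rewrite rootM => /orP[/rP|/rQ]. Qed.

Lemma roots_in1 a : roots_in a 1.
Proof. by move=> z; rewrite rootC oner_eq0. Qed.

Lemma roots_in_prod a (I : Type) (r : seq I) (F : I -> {poly R[i]}) :
  (forall i, roots_in a (F i)) -> roots_in a (\prod_(i <- r) F i).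
Proof.
move=> rF; elim/big_rec: _ => [|i P _ rP]; first exact: roots_in1.
exact: roots_inM.
Qed.

Lemma sub_roots_in a a' P : (forall z, a z -> a' z) -> roots_in a P ->
  roots_in a' P.
Proof. by move=> aa' rP z /rP /aa'. Qed.

Lemma roots_in_dvd a P Q : Q %| P -> roots_in a P -> roots_in a Q.
Proof. by move=> /dvdpP[q ->] rP z rz; apply: rP; rewrite rootM rz orbT. Qed.

Lemma root_comp_shift P c z : root (P \Po ('X + c%:P)) z = root P (z + c).
Proof. by rewrite rootE horner_comp !hornerE -rootE. Qed.

Lemma roots_split a P : P != 0 -> exists P1 P2 : {poly R[i]},
  [/\ P = P1 * P2, roots_in a P1 & roots_in (predC a) P2].
Proof.
move=> P0; have [r defP] := closed_field_poly_normal P.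
exists (\prod_(z <- r | a z) ('X - z%:P)),
  (lead_coef P *: \prod_(z <- r | ~~ a z) ('X - z%:P)).
have rootsF (b : pred R[i]) z :
    root (\prod_(z <- r | b z) ('X - z%:P)) z -> b z.
  rewrite -big_filter root_prod_XsubC mem_filter.
  by case/andP.
split; last 2 first.
- exact: rootsF.
- by move=> z; rewrite rootZ ?lead_coef_eq0 // => /rootsF.
- by rewrite -scalerAr {1}defP (bigID a).
Qed.

Lemma roots_in_coprime a P Q : P != 0 ->
  roots_in a P -> roots_in (predC a) Q -> coprimep P Q.
Proof.
move=> P0 rP rQ; apply/Pdiv.ClosedField.coprimepP => z /rP az.
by apply/negP => /rQ /=; rewrite az.
Qed.

Lemma coprime_bezout P Q : coprimep P Q ->
  exists A B : {poly R[i]}, A * P + B * Q = 1.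
Proof.
case/Bezout_eq1_coprimepP => -[A B] /= e; by exists A, B.
Qed.

End RootSplitting.

(** An abstract model of the graph module. Invertibility of t reflects the localization along the
    divisor; [tm_ops] collects the operators commuting with t and d_t, namely functions and
    derivations. The inverse is a bare map, as its linearity follows. *)
Record tmodule (R : realType) := TModule {
  tm_space :> lmodType R[i];
  tm_t : {linear tm_space -> tm_space};
  tm_d : {linear tm_space -> tm_space};
  tm_ti : tm_space -> tm_space;
  tm_tK : cancel tm_t tm_ti;
  tm_tiK : cancel tm_ti tm_t;
  tm_td : forall u, tm_t (tm_d u) = tm_d (tm_t u) - u;
  tm_ops : set {linear tm_space -> tm_space};
  tm_opst : forall F u, tm_ops F -> F (tm_t u) = tm_t (F u);
  tm_opsd : forall F u, tm_ops F -> F (tm_d u) = tm_d (F u)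
}.

Section TModule.
Variables (R : realType) (M : tmodule R).
Local Notation T := (@tm_t R M).
Local Notation D := (@tm_d R M).
Local Notation Ti := (@tm_ti R M).
Implicit Types (S G : set M) (u v : M) (p : {poly R[i]}).

Definition tm_e u := D (T u).
Local Notation E := tm_e.
Local Notation pe := (op_poly E).

Lemma tm_e_is_linear : linear E.
Proof. by move=> a u v; rewrite /tm_e !linearP. Qed.
HB.instance Definition _ := GRing.isLinear.Build _ M M *:%R E tm_e_is_linear.

Lemma tm_ti_is_linear : linear Ti.
Proof.
move=> a u v; apply: (can_inj (@tm_tK R M)).
by rewrite linearP /= !tm_tiK.
Qed.
HB.instance Definition _ := GRing.isLinear.Build _ M M *:%R Ti tm_ti_is_linear.

Lemma tm_te u : T (E u) = E (T u) - T u.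
Proof. by rewrite /tm_e tm_td. Qed.

Lemma tm_tie u : Ti (E u) = E (Ti u) + Ti u.
Proof.
apply: (can_inj (@tm_tK R M)); rewrite linearD /= tm_te !tm_tiK.
by rewrite subrK.
Qed.

Lemma tm_dE u : D u = E (Ti u).
Proof. by rewrite /tm_e tm_tiK. Qed.

Lemma tm_opse F u : tm_ops F -> F (E u) = E (F u).
Proof. by move=> hF; rewrite /tm_e tm_opsd // tm_opst. Qed.

Lemma tm_t_poly p u : T (pe p u) = pe (p \Po ('X + (-1)%:P)) (T u).
Proof. by apply: op_poly_shift => v /=; rewrite tm_te scaleN1r. Qed.

Lemma tm_ti_poly p u : Ti (pe p u) = pe (p \Po ('X + 1%:P)) (Ti u).
Proof. by apply: op_poly_shift => v /=; rewrite tm_tie scale1r. Qed.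

Lemma comp_poly_shift p (a b : R[i]) :
  (p \Po ('X + a%:P)) \Po ('X + b%:P) = p \Po ('X + (a + b)%:P).
Proof.
rewrite -comp_polyA; congr (p \Po _).
by rewrite comp_polyD comp_polyX comp_polyC polyCD addrAC addrA.
Qed.

Lemma iter_tm_t_poly k p u :
  iter k T (pe p u) = pe (p \Po ('X + (- k%:R)%:P)) (iter k T u).
Proof.
elim: k => [|k IHk] /=; first by rewrite oppr0 addr0 comp_polyXr.
by rewrite IHk tm_t_poly comp_poly_shift mulrSr opprD.
Qed.

Lemma iter_tm_ti_poly k p u :
  iter k Ti (pe p u) = pe (p \Po ('X + (k%:R)%:P)) (iter k Ti u).
Proof.
elim: k => [|k IHk] /=; first by rewrite addr0 comp_polyXr.
by rewrite IHk tm_ti_poly comp_poly_shift mulrSr.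
Qed.

Lemma iter_tm_tK k u : iter k Ti (iter k T u) = u.
Proof. by elim: k u => //= k IHk u; rewrite -iterS iterSr tm_tK. Qed.

Lemma iter_tm_tiK k u : iter k T (iter k Ti u) = u.
Proof. by elim: k u => //= k IHk u; rewrite -iterS iterSr tm_tiK. Qed.

Lemma iter_ops_t F k u : tm_ops F -> F (iter k T u) = iter k T (F u).
Proof. by move=> hF; elim: k => //= k <-; rewrite tm_opst. Qed.

Lemma ops_ti F u : tm_ops F -> F (Ti u) = Ti (F u).
Proof.
move=> hF; apply: (can_inj (@tm_tK R M)).
by rewrite -tm_opst // !tm_tiK.
Qed.

Lemma iter_ops_ti F k u : tm_ops F -> F (iter k Ti u) = iter k Ti (F u).
Proof. by move=> hF; elim: k => //= k <-; rewrite ops_ti. Qed.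

(** Stability under t is left out: preimages under powers of t, of its inverse and under polynomials
    in E keep this weaker property, so inclusions can be checked on generators. *)
Record e_submodule S : Prop := ESubmodule {
  es0 : S 0;
  esP : forall (a : R[i]) u v, S u -> S v -> S (a *: u + v);
  es_ops : forall F u, tm_ops F -> S u -> S (F u);
  es_e : forall u, S u -> S (E u)
}.

Record v0_submodule S : Prop := V0Submodule {
  vs_es :> e_submodule S;
  vs_t : forall u, S u -> S (T u)
}.

Section ESubmodule.
Variables (S : set M) (hS : e_submodule S).

Lemma esD u v : S u -> S v -> S (u + v).
Proof. by rewrite -{2}(scale1r u); apply: (esP hS). Qed.

Lemma esZ a u : S u -> S (a *: u).
Proof. by move=> Su; rewrite -[_ *: _]addr0; apply/(esP hS) => //; apply: es0. Qed.

Lemma es_sum (I : Type) (r : seq I) (P : pred I) (F : I -> M) :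
  (forall i, P i -> S (F i)) -> S (\sum_(i <- r | P i) F i).
Proof.
move=> SF; elim/big_rec: _ => [|i u Pi Su]; first exact: es0.
by apply: esD => //; apply: SF.
Qed.

Lemma es_iter k u : S u -> S (iter k E u).
Proof. by elim: k => //= k IHk /IHk; apply: es_e. Qed.

Lemma es_poly p u : S u -> S (pe p u).
Proof. by move=> Su; apply: es_sum => i _; apply/esZ/es_iter. Qed.

(** Bezout: u = a(E) p(E) u + b(E) q(E) u. Unwanted roots are discarded through this lemma. *)
Lemma es_coprime p q u : coprimep p q -> S (pe p u) -> S (pe q u) -> S u.
Proof.
case/coprime_bezout => a [b e] Sp Sq.
rewrite -(op_poly1 E u) -e op_polyD !op_polyM.
by apply: esD; apply: es_poly.
Qed.

Lemma e_submodule_t k : e_submodule [set u | S (iter k T u)].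
Proof.
split=> /=; first by rewrite iter_fix ?linear0 //; apply: es0.
- by move=> a u v Su Sv; rewrite iter_linear_sub; apply: (esP hS).
- by move=> F u hF Su; rewrite -iter_ops_t //; apply: (es_ops hS).
- move=> u Su; rewrite -op_polyX iter_tm_t_poly; exact: es_poly.
Qed.

Lemma e_submodule_ti k : e_submodule [set u | S (iter k Ti u)].
Proof.
split=> /=; first by rewrite iter_fix ?linear0 //; apply: es0.
- by move=> a u v Su Sv; rewrite iter_linear_sub; apply: (esP hS).
- by move=> F u hF Su; rewrite -iter_ops_ti //; apply: (es_ops hS).
- move=> u Su; rewrite -op_polyX iter_tm_ti_poly; exact: es_poly.
Qed.

Lemma e_submodule_poly p : e_submodule [set u | S (pe p u)].
Proof.
split=> /=; first by rewrite linear0; apply: (es0 hS).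
- by move=> a u v Su Sv; rewrite linearP; apply: (esP hS).
- move=> F u hF Su; rewrite -op_poly_comm; last by move=> v; apply: tm_opse.
  exact: (es_ops hS).
- by move=> u Su; rewrite -op_poly_comm //; apply: (es_e hS).
Qed.

End ESubmodule.

Lemma v0_iter S k u : v0_submodule S -> S u -> S (iter k T u).
Proof. by move=> hS; elim: k => //= k IHk /IHk; apply: vs_t. Qed.

Lemma v0_submodule_t S k : v0_submodule S ->
  v0_submodule [set u | S (iter k T u)].
Proof.
move=> hS; split; first exact: (e_submodule_t (vs_es hS)).
by move=> u /= Su; rewrite -iterSr iterS; apply: vs_t.
Qed.

Definition e_span G : set M :=
  fun u => forall S, e_submodule S -> G `<=` S -> S u.

Lemma e_span_sub G S : e_submodule S -> G `<=` S -> e_span G `<=` S.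
Proof. by move=> hS GS u; apply. Qed.

Lemma sub_e_span G : G `<=` e_span G.
Proof. by move=> u Gu S _; apply. Qed.

Lemma e_submodule_span G : e_submodule (e_span G).
Proof.
split.
- by move=> S hS _; apply: es0.
- by move=> a u v hu hv S hS GS; apply: (esP hS); [apply: hu|apply: hv].
- by move=> F u hF hu S hS GS; apply: (es_ops hS) => //; apply: hu.
- by move=> u hu S hS GS; apply: (es_e hS) => //; apply: hu.
Qed.

Lemma v0_submodule_span G : (forall u, G u -> e_span G (T u)) ->
  v0_submodule (e_span G).
Proof.
move=> GT; split; first exact: e_submodule_span.
have h := @e_submodule_t _ (e_submodule_span G) 1.
by apply: e_span_sub.
Qed.

Definition ge_re (c : R) : pred R[i] := fun z => c%:C%C <= z.

Lemma ge_re_le c c' z : c <= c' -> ge_re c' z -> ge_re c z.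
Proof. by move=> le_cc'; apply: le_trans; rewrite lecR. Qed.

(** The axioms of [V_filtration] on an abstract module. Since t is bijective, t V^c = V^(c+1) for c
    > 0 splits into [av_t] and [av_ti]. *)
Record v_filtration (V : R -> set M) : Prop := AVFiltration {
  av_sub : forall c, v0_submodule (V c);
  av_fingen : forall c, exists n (e : 'I_n -> M), (forall k, V c (e k)) /\
    forall S, v0_submodule S -> (forall k, S (e k)) -> V c `<=` S;
  av_dec : forall c c', c <= c' -> V c' `<=` V c;
  av_exh : forall u, exists c, V c u;
  av_disc : forall c, exists2 e : R, 0 < e &
    (forall c', c - e < c' <= c -> V c' = V c) /\
    (forall c', c < c' < c + e -> V c' = V_gt V c);
  av_t : forall c u, V c u -> V (c + 1) (T u);
  av_ti : forall c u, 0 < c -> V (c + 1) u -> V c (Ti u);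
  av_d : forall c u, V c u -> V (c - 1) (D u);
  av_nil : forall c, exists m, forall u, V c u ->
    V_gt V c (pe (('X - (c%:C%C)%:P) ^+ m) u)
}.

Definition v_can (N : set M) (c : R) : set M :=
  fun u => forall m, exists2 q, roots_in (ge_re c) q & N (iter m Ti (pe q u)).

(** * Uniqueness of the V-filtration *)

Section Uniqueness.
Variables (V : R -> set M) (hV : v_filtration V).

(** Jumps are only locally discrete, so one climbs from d to c by a supremum: at each level s some
    power of E - s leads into the next piece, and the roots used lie in [d, c). *)
Lemma av_reach d c u : d <= c -> V d u ->
  exists2 p, roots_in (fun z => ge_re d z && ~~ ge_re c z) p & V c (pe p u).
Proof.
move=> le_dc Vdu.
pose G := [set x | d <= x <= c /\
  exists2 p, roots_in (fun z => ge_re d z && ~~ ge_re x z) p & V x (pe p u)].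
have Gd : G d.
  split; first by rewrite lexx.
  by exists 1; [exact: roots_in1 | rewrite op_poly1].
have hG : has_sup G by split; [exists d | exists c => x [/andP[]]].
pose s := sup G.
have ds : d <= s by apply: ub_le_sup => //; case: hG.
have sc : s <= c by apply: sup_le_ub; [exists d | move=> x [/andP[]]].
(* V is constant on (s - e, s], so the supremum is attained. *)
have [e e0 [eL eR]] := av_disc hV s.
have Gs : G s.
  have [x Gx xs] := sup_adherent e0 hG.
  have [/andP[dx xc] [p hp Vp]] := Gx.
  have xs' : x <= s by apply: ub_le_sup => //; case: hG.
  split; first by rewrite ds.
  exists p; last by rewrite -(eL x) // xs.
  apply: sub_roots_in hp => z /andP[-> /=]; apply: contra; exact: ge_re_le.
have [sc' | cs] := ltP s c; last first.
  have -> : c = s by apply/le_anti; rewrite sc cs.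
  by case: Gs.
have [_ [p hp Vp]] := Gs.
have [m hm] := av_nil hV s.
(* A level beyond s, within reach of the discreteness at s and at most c; attaining it contradicts
   the supremum. *)
pose s' := Num.min c (s + e / 2).
have ss' : s < s' by rewrite lt_min sc' ltrDl divr_gt0.
have s'e : s' < s + e.
  rewrite (le_lt_trans (_ : _ <= s + e / 2)) ?ge_min ?lexx ?orbT //.
  by rewrite ltrD2l ltr_pdivrMr // ltr_pMr // ltr1n.
have Gs' : G s'.
  split; first by rewrite (le_trans ds (ltW ss')) ge_min lexx.
  exists (('X - (s%:C%C)%:P) ^+ m * p); last first.
    by rewrite op_polyM eR ?ss' //; apply: hm.
  apply: roots_inM; last first.
    apply: sub_roots_in hp => z /andP[-> /=].
    by apply: contra; apply: ge_re_le; apply: ltW.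
  case: m {hm} => [|m z]; first exact: roots_in1.
  rewrite root_exp_XsubC => /eqP ->.
  by rewrite /ge_re !lecR ds -ltNge.
have : s' <= s by apply: ub_le_sup => //; case: hG.
by rewrite leNgt ss'.
Qed.

Lemma av_iter_t c k u : V c u -> V (c + k%:R) (iter k T u).
Proof.
move=> Vu; elim: k => [|k IHk] /=; first by rewrite addr0.
by rewrite mulrSr addrA; apply: (av_t hV).
Qed.

Lemma av_iter_ti k u : V (1 + k%:R) u -> V 1 (iter k Ti u).
Proof.
elim: k u => [|k IHk] u; first by rewrite addr0.
rewrite mulrSr addrA => Vu; rewrite iterSr; apply: IHk.
by apply: (av_ti hV) => //; rewrite ltr_wpDr.
Qed.

Variables (N : set M) (n : nat) (e : 'I_n -> M).
Hypothesis N_v0 : v0_submodule N.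
Hypothesis N_gen : forall S, e_submodule S -> (forall k, S (e k)) -> N `<=` S.
Hypothesis N_exh : forall u, exists k, N (iter k T u).

Lemma av_bound (m : nat) (g : 'I_m -> M) : exists c, forall k, V c (g k).
Proof.
have [c hc] := choice (fun k => av_exh hV (g k)).
exists (- \sum_k `|c k|) => k; apply: (av_dec hV) (hc k).
rewrite lerNl; apply: le_trans (ler_norm _) _; rewrite normrN.
by rewrite (bigD1 k) //= lerDl sumr_ge0.
Qed.

Lemma shift_bound (m : nat) (g : 'I_m -> M) :
  exists a, forall k, N (iter a T (g k)).
Proof.
have [a ha] := choice (fun k => N_exh (g k)).
exists (\sum_k a k)%N => k.
by rewrite (bigD1 k) //= addnC iterD; apply: v0_iter.
Qed.

(** If u is in V^c, it is pushed up to a level from which t^(-1) can be applied often enough to end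
    in V^1, whose generators enter N after a power of t. Conversely, q(E) u has arbitrarily high
    level for suitable q with roots at least c, while p(E) u is in V^c for some p with roots below
    c; p and q are coprime. *)
Lemma v_filtration_unique c u : V c u <-> v_can N c u.
Proof.
split=> [Vu m | hu].
- have [n1 [g [Vg genV]]] := av_fingen hV 1.
  have [a ha] := shift_bound g.
  (* From level 1 + a + m, a + m divisions by t end in V^1; multiplication by t^a then enters N and
     leaves t^(-m). *)
  pose c' := Num.max c (1 + (a + m)%:R).
  have cc' : c <= c' by rewrite le_max lexx.
  have [p hp Vp] := av_reach cc' Vu.
  exists p; first by apply: sub_roots_in hp => z /andP[].
  have /av_iter_ti V1 : V (1 + (a + m)%:R) (pe p u).
    by apply: (av_dec hV) Vp; rewrite le_max lexx orbT.
  have := genV _ (v0_submodule_t a N_v0) ha _ V1.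
  by rewrite /= iterD iter_tm_tiK.
- have [c0 Vc0] := av_bound e.
  have NV : N `<=` V c0 by apply: N_gen => //; apply: av_sub.
  have [d Vd] := av_exh hV u.
  have [le_cd|lt_dc] := leP c d; first exact: (av_dec hV) Vd.
  have [p hp Vp] := av_reach (ltW lt_dc) Vd.
  (* t^m N lies in V^(c0 + m), and c0 + m is at least c. *)
  pose m := Num.bound `|c - c0|.
  have [q hq /NV/(av_iter_t m)] := hu m; rewrite iter_tm_tiK => Vq.
  apply: (es_coprime (av_sub hV c) (q := q) _ Vp); last first.
    apply: (av_dec hV) Vq; rewrite addrC -lerBlDr.
    by apply: le_trans (ler_norm _) (ltW (archi_boundP (normr_ge0 _))).
  rewrite coprimep_sym; apply: (roots_in_coprime _ hq).
    apply: (roots_in_neq0 (z := real_complex R (c - 1)) _ hq).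
    by rewrite /ge_re lecR -ltNge ltrBlDr ltrDl.
  by apply: sub_roots_in hp => z /andP[].
Qed.

End Uniqueness.
End TModule.

(** * Existence of the V-filtration from a b-function *)

Section Existence.
Variables (R : realType) (M : tmodule R).
Local Notation T := (@tm_t R M).
Local Notation D := (@tm_d R M).
Local Notation Ti := (@tm_ti R M).
Local Notation E := (@tm_e R M).
Local Notation pe := (op_poly E).
Implicit Types (S : set M) (u v : M) (p : {poly R[i]}).

Lemma roots_in_shift (a a' : pred R[i]) (c : R[i]) p :
  (forall z, a (z + c) -> a' z) -> roots_in a p ->
  roots_in a' (p \Po ('X + c%:P)).
Proof. by move=> aa' hp z; rewrite root_comp_shift => /hp/aa'. Qed.

Lemma ge_re_nat (c : R) (k : nat) z :
  ge_re (c + k%:R) z = ge_re c (z - k%:R).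
Proof. by rewrite /ge_re lerBrDr rmorphD /= rmorph_nat. Qed.

Section VCan.
Variable N : set M.
Hypothesis N_v0 : v0_submodule N.

Lemma v_can_prod c p u : roots_in (ge_re c) p -> v_can N c (pe p u) ->
  v_can N c u.
Proof.
move=> hp hu m; have [q hq Nq] := hu m.
by exists (q * p); [exact: roots_inM | rewrite op_polyM].
Qed.

Lemma v_can_dec c c' : c <= c' -> v_can N c' `<=` v_can N c.
Proof.
move=> cc' u hu m; have [q hq Nq] := hu m; exists q => //.
by apply: sub_roots_in hq => z; apply: ge_re_le.
Qed.

Lemma iter_N_ti m m' u : (m <= m')%N -> N (iter m' Ti u) -> N (iter m Ti u).
Proof.
move=> /subnK <- /(v0_iter (m' - m) N_v0).
by rewrite iterD iter_tm_tiK.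
Qed.

Lemma v_can_t c u : v_can N c u -> v_can N (c + 1) (T u).
Proof.
move=> hu m; have [q hq Nq] := hu m.
exists (q \Po ('X + (-1)%:P)).
  apply: roots_in_shift hq => z; rewrite -[c + 1]/(c + 1%:R) ge_re_nat.
  by rewrite mulr1n.
rewrite -tm_t_poly; case: m Nq => [/(vs_t N_v0)|m Nq] //.
rewrite iterSr tm_tK; apply: iter_N_ti Nq; exact: leqnSn.
Qed.

Lemma v_can_ti c u : v_can N (c + 1) u -> v_can N c (Ti u).
Proof.
move=> hu m; have [q hq Nq] := hu m.+1.
exists (q \Po ('X + 1%:P)).
  apply: roots_in_shift hq => z; rewrite -[c + 1]/(c + 1%:R) ge_re_nat.
  by rewrite mulr1n addrK.
by rewrite -tm_ti_poly -iterSr.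
Qed.

Lemma v_can_submodule c : v0_submodule (v_can N c).
Proof.
have es_N m := e_submodule_ti (vs_es N_v0) m.
split; last first.
  move=> u /v_can_t; apply: v_can_dec; by rewrite lerDl.
split.
- move=> m; exists 1; first exact: roots_in1.
  by rewrite op_poly1; apply: (es0 (es_N m)).
- move=> a u v hu hv m; have [p hp Np] := hu m; have [q hq Nq] := hv m.
  exists (p * q); first exact: roots_inM.
  rewrite linearP /=; apply: (esP (es_N m)) => /=; last first.
    by rewrite op_polyM; apply: (es_poly (es_N m)).
  by rewrite op_polyMC; apply: (es_poly (es_N m)).
- move=> F u hF hu m; have [p hp Np] := hu m; exists p => //.
  rewrite -op_poly_comm; last by move=> v; apply: tm_opse.
  exact: (es_ops (es_N m)).
- move=> u hu m; have [p hp Np] := hu m; exists p => //.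
  rewrite -op_poly_comm //; exact: (es_e (es_N m)).
Qed.

Lemma v_can_d c u : v_can N c u -> v_can N (c - 1) (D u).
Proof.
move=> hu; rewrite tm_dE; apply: (es_e (v_can_submodule _)).
by apply: v_can_ti; rewrite subrK.
Qed.

Variables (n : nat) (e : 'I_n -> M).
Hypothesis Ne : forall k, N (e k).
Hypothesis N_gen : forall S, e_submodule S -> (forall k, S (e k)) -> N `<=` S.
Hypothesis N_exh : forall u, exists k, N (iter k T u).
Variables (b : {poly R[i]}) (c0 c1 : R).
Hypothesis b_ge : roots_in (ge_re c0) b.
Hypothesis b_le : roots_in (fun z => z <= c1%:C%C) b.
Hypothesis Nb : forall u, N u -> N (Ti (pe b u)).

Lemma b_neq0 : b != 0.
Proof.
apply: (roots_in_neq0 (z := real_complex R (c0 - 1)) _ b_ge).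
by rewrite /ge_re lecR -ltNge ltrBlDr ltrDl.
Qed.

(** [Nb] says that b(E) maps N into t N. Hence b(E) b(E - 1) ... b(E - m + 1) maps N into t^m N, and
    the shifts move the roots to the right only. *)
Lemma N_up m : exists2 p, roots_in (ge_re c0) p &
  forall u, N u -> N (iter m Ti (pe p u)).
Proof.
elim: m => [|m [p hp Np]].
  by exists 1; [exact: roots_in1 | move=> u Nu; rewrite op_poly1].
exists ((b \Po ('X + (- m%:R)%:P)) * p).
  apply: roots_inM => //; apply: roots_in_shift b_ge => z.
  by rewrite -ge_re_nat; apply: ge_re_le; rewrite lerDl ler0n.
move=> u /Np /Nb Nu; rewrite op_polyM /= iter_tm_ti_poly comp_poly_shift.
by rewrite addNr addr0 comp_polyXr.
Qed.

Lemma comp_shift_neq0 p (c : R[i]) : p != 0 -> p \Po ('X + c%:P) != 0.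
Proof.
apply: contra => /eqP p0; apply/eqP.
have := comp_poly_shift p c (- c).
by rewrite p0 comp_poly0 subrr addr0 comp_polyXr.
Qed.

(** The opposite shifts: the product of the b(E + j) for k0 < j <= k0 + k brings t^(-k0-k) N back
    into t^(-k0) N. Its roots move to the left as k0 grows, which separates them from the roots at
    least c. *)
Lemma N_down k0 k : exists2 p,
  p != 0 /\ roots_in (fun z => z <= (c1 - k0.+1%:R)%:C%C) p &
  forall u, N (iter (k0 + k) T u) -> N (iter k0 T (pe p u)).
Proof.
elim: k => [|k [p [p0 hp] Np]].
  exists 1; first by split; [exact: oner_neq0 | apply: roots_in1].
  by move=> u; rewrite addn0 op_poly1.
exists (p * (b \Po ('X + ((k0 + k).+1%:R)%:P))).
  split; first by rewrite mulf_neq0 // comp_shift_neq0 ?b_neq0.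
  apply: roots_inM => //; apply: roots_in_shift b_le => z; rewrite -lerBrDr.
  move=> /le_trans; apply.
  rewrite -(rmorph_nat (real_complex R)) -rmorphB lecR.
  by rewrite lerB // ler_nat ltnS leq_addr.
move=> u Nu; rewrite op_polyM; apply: Np.
move: Nu; rewrite addnS => /Nb.
suff -> : pe b (iter (k0 + k).+1 T u) =
    iter (k0 + k).+1 T (pe (b \Po ('X + (k0 + k).+1%:R%:P)) u).
  by rewrite iterS tm_tK.
by rewrite iter_tm_t_poly comp_poly_shift subrr addr0 comp_polyXr.
Qed.

Lemma archi_nat (x : R) : exists k : nat, x < k%:R.
Proof.
exists (Num.bound `|x|); apply: le_lt_trans (ler_norm _) _.
exact: archi_boundP.
Qed.

(** For k0 > c1 - c the polynomial from [N_down] has its roots below c and is coprime to the one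
    given by [v_can]. The choice of k0 is uniform in u. *)
Lemma v_can_lower c : exists k, forall u, v_can N c u -> N (iter k T u).
Proof.
have [k0 hk0] := archi_nat (c1 - c).
exists k0 => u hu; have [k Nk] := N_exh u.
have [p [p0 hp] Np] := N_down k0 k.
have [q hq Nq] := hu 0%N.
apply: (es_coprime (v0_submodule_t k0 N_v0) (p := q) (q := p)) => /=.
- rewrite coprimep_sym; apply: (roots_in_coprime p0 hp).
  apply: sub_roots_in hq => z cz; apply/negP => /(le_trans cz).
  by rewrite lecR lerBrDr -lerBrDl leNgt (lt_le_trans hk0) // ler_nat leqnSn.
- by apply: v0_iter.
- by apply: Np; rewrite iterD; apply: v0_iter.
Qed.

Lemma v_can_upper c : exists m, forall u, N (iter m Ti u) -> v_can N c u.
Proof.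
have [m hm] := archi_nat (c - c0); exists m => u Nu.
have Vm k v : v_can N c0 v -> v_can N (c0 + k%:R) (iter k T v).
  move=> hv; elim: k => [|k IHk] /=; first by rewrite addr0.
  by rewrite mulrSr addrA; apply: v_can_t.
apply: (@v_can_dec _ (c0 + m%:R)); first by rewrite -lerBlDl ltW.
rewrite -(iter_tm_tiK m u); apply: Vm => m'.
by have [p hp Np] := N_up m'; exists p => //; apply: Np.
Qed.

Lemma N_annihilator k m : exists2 p, p != 0 &
  forall u, N (iter k T u) -> N (iter m Ti (pe p u)).
Proof.
have [p [p0 _] Np] := N_down 0 k; have [q hq Nq] := N_up m.
exists (q * p); last by move=> u /Np /= /Nq; rewrite op_polyM.
rewrite mulf_neq0 //; apply: (roots_in_neq0 (z := real_complex R (c0 - 1)) _ hq).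
by rewrite /ge_re lecR -ltNge ltrBlDr ltrDl.
Qed.

(** Between t^(-k) N and t^m N, where p1 p2 acts as zero, [v_can] is the part on which the factor
    with roots at least c already acts as zero. This replaces infinitely many conditions by two. *)
Lemma v_can_charact c k m p1 p2 : (forall u, v_can N c u -> N (iter k T u)) ->
  (forall u, N (iter m Ti u) -> v_can N c u) ->
  roots_in (ge_re c) p1 -> p2 != 0 -> roots_in (predC (ge_re c)) p2 ->
  (forall u, N (iter k T u) -> N (iter m Ti (pe (p1 * p2) u))) ->
  forall u, v_can N c u <-> N (iter k T u) /\ N (iter m Ti (pe p1 u)).
Proof.
move=> Vk mV hp1 p20 hp2 Np u; split=> [hu|[_ /mV]]; last exact: v_can_prod.
split; first exact: Vk.
have [q hq Nq] := hu m; have es_m := e_submodule_ti (vs_es N_v0) m.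
apply: (es_coprime es_m (p := q) (q := p2) (u := pe p1 u)) => /=.
- rewrite coprimep_sym; apply: (roots_in_coprime p20 hp2).
  by apply: sub_roots_in hq => z /=; rewrite negbK.
- by rewrite -op_polyMC op_polyM; apply: (es_poly es_m).
- by rewrite -op_polyMC; apply: Np; apply: Vk.
Qed.

(** With a1 p1 + a2 p2 = 1, an element u equals a1(E) p1(E) u + a2(E) p2(E) u, where p1(E) u lies in
    t^m N and u in t^(-k) N. So the t^m e_j together with the p2(E) t^(-k) e_j generate. *)
Lemma v_can_fingen c : exists n (e : 'I_n -> M), (forall k, v_can N c (e k)) /\
  forall S, v0_submodule S -> (forall k, S (e k)) -> v_can N c `<=` S.
Proof.
have [k Vk] := v_can_lower c; have [m mV] := v_can_upper c.
have [p p0 Np] := N_annihilator k m.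
have [p1 [p2 [defp hp1 hp2]]] := roots_split (ge_re c) p0.
have p20 : p2 != 0 by apply: contraNneq p0 => p20; rewrite defp p20 mulr0.
rewrite defp in Np.
have charV := v_can_charact Vk mV hp1 p20 hp2 Np.
pose g (i : 'I_(n + n)) := match fintype.split i with
  | inl j => iter m T (e j) | inr j => pe p2 (iter k Ti (e j)) end.
exists (n + n)%N, g; split.
  move=> i; rewrite /g; case: fintype.split => j.
    by apply: mV; rewrite iter_tm_tK.
  apply: (@v_can_prod _ p1) => //; apply: mV; rewrite -op_polyM.
  by apply: Np; rewrite iter_tm_tiK.
move=> S hS Sg.
have S1 : N `<=` [set u | S (iter m T u)].
  apply: N_gen => [|j]; first exact: (e_submodule_t hS m).
  by have := Sg (lshift n j); rewrite /g (unsplitK (inl j)).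
have S2 : N `<=` [set u | S (pe p2 (iter k Ti u))].
  have : e_submodule [set u | S (pe p2 (iter k Ti u))].
    exact: (e_submodule_ti (e_submodule_poly hS p2) k).
  move=> /N_gen; apply => j.
  by have := Sg (rshift n j); rewrite /= /g (unsplitK (inr j)).
move=> u /[dup] Vu /charV [Nk Nm].
have cop : coprimep p1 p2.
  rewrite coprimep_sym; apply: (roots_in_coprime p20 hp2).
  by apply: sub_roots_in hp1 => z /=; rewrite negbK.
have [a1 [a2 e12]] := coprime_bezout cop.
rewrite -(op_poly1 E u) -e12 op_polyD; apply: (esD hS).
  rewrite op_polyM; apply: (es_poly hS).
  by rewrite -(iter_tm_tiK m (pe p1 u)); apply: S1.
rewrite op_polyM; apply: (es_poly hS).
by rewrite -(iter_tm_tK k u); apply: S2.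
Qed.

Lemma real_gap p (c : R) : p != 0 -> exists2 d, 0 < d & forall x : R,
  root p x%:C%C -> `|x - c| < d -> x = c.
Proof.
move=> p0; have [r defp] := closed_field_poly_normal p.
have rootr z : root p z -> z \in r.
  by rewrite defp rootZ ?lead_coef_eq0 // root_prod_XsubC.
suff [d d0 hd] : exists2 d : R, 0 < d & forall x : R,
    x%:C%C \in r -> `|x - c| < d -> x = c.
  by exists d => // x /rootr; apply: hd.
elim: r {p p0 defp rootr} => [|z r [d d0 hd]]; first by exists 1.
have [zc|zc] := eqVneq (complex.Re z) c.
  exists d => // x; rewrite inE => /orP[/eqP zx _|]; last exact: hd.
  by rewrite -zc -zx.
exists (Num.min d `|complex.Re z - c|).
  by rewrite lt_min d0 normr_gt0 subr_eq0.
move=> x; rewrite inE lt_min => /orP[/eqP zx|xr] /andP[h1 h2].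
  by move: h2; rewrite -zx /= ltxx.
exact: hd.
Qed.

(** One annihilating polynomial p serves all indices in [c - 1, c + 1]; jumps there occur only at
    its real roots, and these leave a gap around c. *)
Lemma v_can_disc c : exists2 d : R, 0 < d &
  (forall c', c - d < c' <= c -> v_can N c' = v_can N c) /\
  (forall c', c < c' < c + d -> v_can N c' = V_gt (v_can N) c).
Proof.
have [k Vk] := v_can_lower (c - 1); have [m mV] := v_can_upper (c + 1).
have [p p0 Np] := N_annihilator k m.
have [d d0 hd] := real_gap c p0.
(* There is no jump between two indices if no real root of p lies in [c1', c2'). *)
have gap c1' c2' : c - 1 <= c1' -> c1' <= c2' -> c2' <= c + 1 ->
    (forall x : R, root p x%:C%C -> c1' <= x -> c2' <= x) ->
    v_can N c1' `<=` v_can N c2'.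
  move=> le1 le12 le2 hroot u hu.
  have [p1 [p2 [defp hp1 hp2]]] := roots_split (ge_re c1') p0.
  have p20 : p2 != 0 by apply: contraNneq p0 => p20; rewrite defp p20 mulr0.
  have := v_can_charact (c := c1') (k := k) (m := m) _ _ hp1 p20 hp2.
  case/(_ _ _ _ u).
  - by move=> v hv; apply: Vk; apply: v_can_dec hv.
  - by move=> v /mV; apply: v_can_dec; apply: le_trans le2.
  - by rewrite -defp.
  move=> /(_ hu) [_ /mV V1] _.
  apply: (@v_can_prod _ p1); last by apply: v_can_dec V1.
  move=> z rz; have := hp1 _ rz; rewrite /ge_re => cz.
  (* In the order of R[i], a number comparable to a real one is real. *)
  have zr : z = (complex.Re z)%:C%C.
    by move: cz; rewrite lecE /=; case: z {rz} => x y /= /andP[/eqP-> _].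
  move: cz; rewrite zr !lecR => cz; apply: hroot => //; rewrite -zr defp rootM rz //.
exists (Num.min d 1); first by rewrite lt_min d0 ltr01.
split=> c' /andP[h1 h2]; apply/seteqP; split.
- have {h1} [h1 h1'] : c - d < c' /\ c - 1 <= c'.
    move: h1; rewrite ltrBlDr -ltrBlDl lt_min => /andP[a1 a2].
    by split; rewrite ?ltrBlDr -?ltrBlDl // lerBlDr -lerBlDl ltW.
  apply: gap => // [|x rx c'x]; first by rewrite lerDl.
  rewrite leNgt; apply/negP => xc.
  have := hd x rx; rewrite distrC gtr0_norm ?subr_gt0 // => hx.
  by move: xc; rewrite hx ?ltxx // ltrBlDr -ltrBlDl (lt_le_trans h1).
- exact: v_can_dec.
- by move=> u hu; exists c'.
- have {h2} [h2 h2'] : c' < c + d /\ c' <= c + 1.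
    move: h2; rewrite -ltrBlDl lt_min => /andP[a1 a2].
    by split; rewrite -?ltrBlDl // -lerBlDl ltW.
  move=> u [c'' cc'' hu].
  have [le|lt] := leP c' c''; first exact: v_can_dec hu.
  apply: gap hu => // [||x rx c''x]; rewrite ?(ltW lt) //.
    by rewrite (le_trans _ (ltW cc'')) // gerBl.
  rewrite leNgt; apply/negP => xc'.
  have cx := lt_le_trans cc'' c''x.
  have := hd x rx; rewrite gtr0_norm ?subr_gt0 // => hx.
  by move: cx; rewrite hx ?ltxx // ltrBlDl (lt_trans xc').
Qed.

(** The annihilator splits as p1 p2 and p1 further as q1 q2, with c the only possible root of q1 and
    all roots of q2 beyond c. A power of E - c is divisible by q1, and q2(E) times that power maps
    into t^m N; dividing out q2 lands in a level above c. *)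
Lemma v_can_nil c : exists m, forall u, v_can N c u ->
  V_gt (v_can N) c (pe (('X - (c%:C%C)%:P) ^+ m) u).
Proof.
have [d d0 [_ dV]] := v_can_disc c.
have [k Vk] := v_can_lower c; have [m mV] := v_can_upper (c + 1).
have mV' u : N (iter m Ti u) -> v_can N c u.
  by move/mV; apply: v_can_dec; rewrite lerDl.
have [p p0 Np] := N_annihilator k m.
have [e0 e0_gt0 he] := real_gap c p0.
have [p1 [p2 [defp hp1 hp2]]] := roots_split (ge_re c) p0.
have p20 : p2 != 0 by apply: contraNneq p0 => p20; rewrite defp p20 mulr0.
have p10 : p1 != 0 by apply: contraNneq p0 => p10; rewrite defp p10 mul0r.
have charV := v_can_charact Vk mV' hp1 p20 hp2.
rewrite -defp in charV; have {}charV := charV Np.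
have [q1 [q2 [defp1 hq1 hq2]]] := roots_split (pred1 c%:C%C) p10.
have [mu hmu] : exists mu, q1 %| ('X - (c%:C%C)%:P) ^+ mu.
  have [r defq1] := closed_field_poly_normal q1.
  have q10 : lead_coef q1 != 0.
    by rewrite lead_coef_eq0; apply: contraNneq p10 => q10; rewrite defp1 q10 mul0r.
  exists (size r); rewrite defq1 dvdpZl //.
  rewrite (eq_big_seq (fun=> 'X - (c%:C%C)%:P)).
    by rewrite big_const_seq count_predT iter_mulr_1.
  move=> z zr; rewrite (eqP (hq1 z _)) //.
  by rewrite defq1 rootZ // root_prod_XsubC.
exists mu => u /[dup] Vu /charV [_ Nm].
(* The step beyond c stays below the distance to the next root, and below 1 because t^m N is known
   to lie in [v_can N (c + 1)]. *)
pose c' := c + Num.min e0 1 / 2.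
have cc' : c < c' by rewrite ltrDl divr_gt0 // lt_min e0_gt0 ltr01.
have c'e : c' < c + Num.min e0 1.
  by rewrite ltrD2l ltr_pdivrMr // ltr_pMr ?ltr1n // lt_min e0_gt0 ltr01.
exists c' => //; apply: (@v_can_prod _ q2).
  move=> z rz; have /= zc := hq2 z rz.
  have rp1 : root p1 z by rewrite defp1 rootM rz orbT.
  have := hp1 z rp1; rewrite /ge_re => cz.
  have zr : z = (complex.Re z)%:C%C.
    by move: cz; rewrite lecE /=; case: z {rz zc rp1} => x y /= /andP[/eqP-> _].
  have rp : root p (complex.Re z)%:C%C by rewrite -zr defp rootM rp1.
  move: cz zc; rewrite zr !lecR => cx xc.
  rewrite leNgt; apply/negP => xc'; move: xc; rewrite (he _ rp) ?eqxx //.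
  rewrite ger0_norm ?subr_ge0 // ltrBlDl (lt_trans xc') // (lt_le_trans c'e) //.
  by rewrite lerD2l ge_min lexx.
case/dvdpP: hmu => q' ->; rewrite -!op_polyM mulrCA [q2 * q1]mulrC -defp1.
apply: (v_can_dec (c' := c + 1)).
  by rewrite (le_trans (ltW c'e)) // lerD2l ge_min lexx orbT.
rewrite op_polyM; apply: mV.
exact: (es_poly (e_submodule_ti (vs_es N_v0) m)).
Qed.

Lemma v_can_filtration : v_filtration (v_can N).
Proof.
split.
- exact: v_can_submodule.
- exact: v_can_fingen.
- exact: v_can_dec.
- move=> u; have [k Nk] := N_exh u; exists (c0 - k%:R).
  have : v_can N c0 (iter k T u).
    by move=> m; have [p hp Np] := N_up m; exists p => //; apply: Np.
  rewrite -{2}(iter_tm_tK k u); elim: {u Nk}k (iter k T u) => [|k IHk] v hv /=.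
    by rewrite subr0.
  by apply: v_can_ti; rewrite mulrSr opprD addrA subrK; apply: IHk.
- exact: v_can_disc.
- exact: v_can_t.
- by move=> c u _; apply: v_can_ti.
- exact: v_can_d.
- exact: v_can_nil.
Qed.

End VCan.
End Existence.

(** * The Nullstellensatz over R[i] *)

(** A countable set has Lebesgue measure 0. *)
Lemma uncountable_real (R : realType) : ~ countable [set: R].
Proof.
move=> cR; have := @lebesgue_measure.countable_lebesgue_measure0 R _ cR.
by rewrite -set_itvNyy lebesgue_measure.lebesgue_measure_itv.
Qed.

Lemma uncountable_pigeonhole (R : realType) (T : countType) (h : R -> T) :
  exists d, forall N : nat, exists2 c : 'I_N -> R,
    injective c & forall i, h (c i) = d.
Proof.
have [d infd] : exists d, infinite_set (h @^-1` [set d]).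
  apply: contrapT => /forallNP fin; apply: (@uncountable_real R).
  have -> : [set: R] = \bigcup_(d in [set: T]) (h @^-1` [set d]).
    by apply/seteqP; split=> // c _; exists (h c).
  apply: bigcup_countable => // d _; apply: finite_set_countable.
  exact: contrapT (fin d).
exists d => N; have [B Bd szB] := infinite_set_fset N infd.
pose s := finmap.enum_fset B.
exists (fun i : 'I_N => nth 0 s i) => [i j /eqP|i].
  rewrite nth_uniq ?(leq_trans (ltn_ord _) szB) ?finmap.fset_uniq //.
  by move/eqP/val_inj.
by apply: Bd; rewrite /= mem_nth // (leq_trans (ltn_ord _) szB).
Qed.

Section Nullstellensatz.
Variables (R : realType) (n : nat).
Local Notation K := R[i].
Local Notation P := (mpoly.mpoly n K).
Local Notation var i := (mpoly.mpolyX K (mpoly.mnm1 i)).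

Lemma mpoly_ring_ind (Q : P -> Prop) :
  (forall c, Q (mpoly.mpolyC n c)) -> (forall i, Q (var i)) ->
  (forall p q, Q p -> Q q -> Q (p + q)) ->
  (forall p q, Q p -> Q q -> Q (p * q)) -> forall p, Q p.
Proof.
move=> QC QX QD QM p; elim/mpoly.mpolyind: p => [|c m p _ _ Qp].
  by rewrite -mpoly.mpolyC0.
apply: (QD) => //; rewrite -mpoly.mul_mpolyC; apply: (QM) => //.
rewrite mpoly.mpolyXE_id; elim/big_rec: _ => [|i q _ Qq].
  by rewrite -mpoly.mpolyC1.
apply: (QM) => //; elim: (m i) => [|k Qk].
  by rewrite expr0 -mpoly.mpolyC1.
by rewrite exprS; apply: (QM).
Qed.

Record ideal (I : set P) : Prop := Ideal {
  ideal0 : I 0;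
  idealD : forall p q, I p -> I q -> I (p + q);
  idealM : forall r p, I p -> I (r * p)
}.

Lemma bounded_dependent k (h : 'I_(#|{: mpoly.bmultinom n k}|.+1) -> P) :
  (forall j, (mpoly.mmeasure (@mpoly.mdeg n) (h j) <= k)%N) ->
  exists2 a : 'rV[K]_(#|{: mpoly.bmultinom n k}|.+1),
    a != 0 & \sum_j a 0 j *: h j = 0.
Proof.
move=> hk.
pose A := \matrix_(j < #|{: mpoly.bmultinom n k}|.+1,
    m < #|{: mpoly.bmultinom n k}|)
  mpoly.mcoeff (mpoly.bmnm (enum_val m)) (h j).
have : kermx A != 0.
  by rewrite kermx_eq0 /row_free neq_ltn ltnS rank_leq_col.
case/rowV0Pn => v /sub_kermxP vA v0; exists v => //.
pose E m := \sum_j v 0 j * mpoly.mcoeff m (h j).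
rewrite (eq_bigr (fun j => \sum_(m : mpoly.bmultinom n k)
    (v 0 j * mpoly.mcoeff m (h j)) *: mpoly.mpolyX K m)); last first.
  move=> j _; rewrite {1}(mpoly.mpolywE (hk j)) scaler_sumr.
  by apply: eq_bigr => m _; rewrite scalerA.
rewrite exchange_big big1 //= => m _; rewrite -scaler_suml.
have := congr1 (fun B : 'rV_ _ => B 0 (enum_rank m)) vA.
rewrite !mxE => e; rewrite [X in X *: _](_ : _ = 0) ?scale0r // -[RHS]e.
by apply: eq_bigr => j _; rewrite mxE enum_rankK.
Qed.

Section MaximalAvoiding.
Variables (I : set P) (g : P).
Hypothesis (idI : ideal I) (gI : forall N, ~ I (g ^+ N)).

(** The last clause says that, modulo m, every h outside m divides a power of g: inverting g in the
    quotient gives a field. *)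
Lemma maximal_avoiding : exists m : set P, [/\ ideal m, I `<=` m,
  forall N, ~ m (g ^+ N) &
  forall h, ~ m h -> exists N r, m (g ^+ N - r * h)].
Proof.
(* The empty set counts as good, because [Zorn_bigcup] also takes the union of the empty chain. *)
pose good (A : set P) := [/\ forall p q, A p -> A q -> A (p + q),
  forall r p, A p -> A (r * p), forall N, ~ A (g ^+ N) &
  nonempty A -> I `<=` A].
have [|m [[mD mM mg mI] mmax]] := @Zorn_bigcup P good.
  move=> F Fgood Ftot; split.
  - move=> p q [A FA Ap] [B FB Bq].
    have [AB|BA] := Ftot _ _ FA FB.
      by exists B => //; case: (Fgood _ FB) => BD _ _ _; apply: BD => //; apply: AB.
    by exists A => //; case: (Fgood _ FA) => AD _ _ _; apply: AD => //; apply: BA.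
  - move=> r p [A FA Ap]; exists A => //.
    by case: (Fgood _ FA) => _ AM _ _; apply: AM.
  - by move=> N [A FA Ag]; case: (Fgood _ FA) => _ _ /(_ N).
  - case=> p [A FA Ap] q Iq; exists A => //.
    by case: (Fgood _ FA) => _ _ _; apply => //; exists p.
have m0 : nonempty m.
  apply/set0P/negP => /eqP m0; apply: (mmax I).
    rewrite m0; split=> // /(_ 0 (ideal0 idI)) //.
  split=> //.
  - by move=> p q; apply: (idealD idI).
  - by move=> r p; apply: (idealM idI).
  - by move=> _ p.
have m00 : m 0.
  by have [p mp] := m0; rewrite -(mul0r p); apply: mM.
exists m; split=> // [|h mh]; first exact: (mI m0).
apply: contrapT => hN.
pose B := [set p | exists r, m (p - r * h)].
have BN N : ~ B (g ^+ N) by move=> [r mr]; apply: hN; exists N, r.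
apply: (mmax B).
  split; last first.
    move=> /(_ h) Bm; apply: mh; apply: Bm;
    by exists 1; rewrite mul1r subrr.
  by move=> p mp; exists 0; rewrite mul0r subr0.
split=> //.
- move=> p q [r mr] [s ms]; exists (r + s).
  by rewrite mulrDl opprD addrACA; apply: mD.
- by move=> a p [r mr]; exists (a * r); rewrite -mulrA -mulrBr; apply: mM.
- by move=> _ p Ip; exists 0; rewrite mul0r subr0; apply: (mI m0).
Qed.

End MaximalAvoiding.

Section MaximalPoint.
Variables (m : set P) (g : P).
Hypothesis idm : ideal m.
Hypothesis mg : forall N, ~ m (g ^+ N).
Hypothesis mmax : forall h, ~ m h -> exists N r, m (g ^+ N - r * h).

Lemma idealB p q : m p -> m q -> m (p - q).
Proof. by move=> mp mq; apply: (idealD idm) => //; rewrite -mulN1r; apply: (idealM idm). Qed.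

Lemma ideal_sum (J : Type) (r : seq J) (F : J -> P) :
  (forall j, m (F j)) -> m (\sum_(j <- r) F j).
Proof.
move=> mF; elim/big_rec: _ => [|j p _ mp]; first exact: ideal0.
exact: (idealD idm).
Qed.

Lemma maximal_prime p q : m (p * q) -> m p \/ m q.
Proof.
move=> mpq; have [|np] := pselect (m p); first by left.
have [|nq] := pselect (m q); first by right.
have [N [r mr]] := mmax np; have [N' [s ms]] := mmax nq.
case: (mg (N := (N + N')%N)); rewrite exprD.
have -> : g ^+ N * g ^+ N' = g ^+ N' * (g ^+ N - r * p) +
    (r * p) * (g ^+ N' - s * q) + (r * s) * (p * q) by ring.
by apply: (idealD idm); [apply: (idealD idm)|]; apply: (idealM idm).
Qed.

Lemma maximal_const c : m (mpoly.mpolyC n c) -> c = 0.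
Proof.
move=> mc; apply/eqP/negP => /negP c0; apply: (mg (N := 0)); rewrite expr0.
have -> : 1 = mpoly.mpolyC n c^-1 * mpoly.mpolyC n c.
  by rewrite -mpoly.mpolyCM mulVf.
exact: (idealM idm).
Qed.

(** If no x_i - c belonged to m, each real c would give r_c with r_c (x_i - c) equal to a power g^N
    modulo m. There are uncountably many c but countably many pairs of an exponent and a degree
    bound, so finitely many of the r_c, with the same N, are linearly dependent. Multiplying out
    yields S(x_i) in m for a nonzero S in one variable; as m is prime and S splits, a linear factor
    lies in m. *)
Lemma maximal_coord i : exists c, m (var i - mpoly.mpolyC n c).
Proof.
apply: contrapT => hN.
have hc (c : R) : exists Nr : nat * P,
    m (g ^+ Nr.1 - Nr.2 * (var i - mpoly.mpolyC n c%:C%C)).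
  have [N [r mr]] : exists N r, m (g ^+ N - r * (var i - mpoly.mpolyC n c%:C%C)).
    by apply: mmax => mc; apply: hN; exists c%:C%C.
  by exists (N, r).
have [F hF] := choice hc.
pose key c := ((F c).1, mpoly.mmeasure (@mpoly.mdeg n) (F c).2).
have [[N k] hd] := uncountable_pigeonhole key.
have [c c_inj ck] := hd (#|{: mpoly.bmultinom n k}|.+1).
have [j|a a0 asum] := @bounded_dependent k (fun j => (F (c j)).2).
  by have := ck j; rewrite /key => -[_ ->].
pose C j : K := (c j)%:C%C.
(* The numerator of the sum of the a_j / (X - C_j); its value at C_j is nonzero when a_j is. *)
pose S : {poly K} := \sum_j a 0 j *: \prod_(l | l != j) ('X - (C l)%:P).
have S0 : S != 0.
  have /rV0Pn [j aj] := a0.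
  have prodC l : (\prod_(l' | l' != l) ('X - (C l')%:P)).[C j] =
      \prod_(l' | l' != l) (C j - C l').
    by rewrite horner_prod; apply: eq_bigr => l' _; rewrite !hornerE.
  have SC : S.[C j] = a 0 j * \prod_(l | l != j) (C j - C l).
    rewrite horner_sum.
    have h l : l != j -> (a 0 l *: \prod_(l' | l' != l) ('X - (C l')%:P)).[C j] = 0.
      rewrite eq_sym => lj; rewrite hornerZ prodC (bigD1 j) //= subrr mul0r.
      by rewrite mulr0.
    rewrite (bigD1 (P := xpredT) j) //= hornerZ prodC.
    by rewrite [X in _ + X]big1 ?addr0 // => l /h.
  apply/eqP => S0; move: SC; rewrite S0 horner0 => /esym/eqP.
  rewrite mulf_eq0 (negPf aj) /= prodf_seq_eq0 => /hasP[l _ /andP[lj]].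
  rewrite subr_eq0 => /eqP/complexI/c_inj jl.
  by rewrite jl eqxx in lj.
pose ev : {rmorphism {poly K} -> P} := horner_alg (var i : P).
have evZ z p : ev (z *: p) = mpoly.mpolyC n z * ev p.
  by rewrite -mul_polyC rmorphM /= horner_algC; congr (_ * _); rewrite mpoly.alg_mpolyC.
have evXC z : ev ('X - z%:P) = var i - mpoly.mpolyC n z.
  by rewrite rmorphB /= horner_algX horner_algC mpoly.alg_mpolyC.
have mS : m (ev S).
  have : m (g ^+ N * ev S).
    suff -> : g ^+ N * ev S = \sum_j
        (mpoly.mpolyC n (a 0 j) * ev (\prod_(l | l != j) ('X - (C l)%:P))) *
        (g ^+ N - (F (c j)).2 * (var i - mpoly.mpolyC n (C j))).
      apply: ideal_sum => j; apply: (idealM idm).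
      by have := hF (c j); have := ck j; rewrite /key => -[-> _].
    under eq_bigr do rewrite mulrBr.
    have -> : ev S = \sum_j mpoly.mpolyC n (a 0 j) *
        ev (\prod_(l | l != j) ('X - (C l)%:P)).
      by rewrite /S rmorph_sum; apply: eq_bigr => j _; rewrite evZ.
    rewrite sumrB mulr_sumr.
    rewrite [X in _ = _ - X](_ : _ = 0) ?subr0.
      apply: eq_bigr => j _.
      by rewrite mulrC.
    have := mulr0 (ev (\prod_l ('X - (C l)%:P))).
    rewrite -{1}asum mulr_sumr => {2}<-; apply: eq_bigr => j _.
    have -> : ev (\prod_l ('X - (C l)%:P)) =
        (var i - mpoly.mpolyC n (C j)) * ev (\prod_(l | l != j) ('X - (C l)%:P)).
      by rewrite -evXC -rmorphM; congr (ev _); rewrite (bigD1 (P := xpredT) j).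
    rewrite -mpoly.mul_mpolyC; ring.
  by case/maximal_prime => // /mg.
have [r defS] := closed_field_poly_normal S.
have : m (ev (\prod_(z <- r) ('X - z%:P))).
  move: mS; rewrite defS evZ => /maximal_prime[|//].
  by move=> /maximal_const/eqP; rewrite lead_coef_eq0 (negPf S0).
elim: r {defS} => [|z r IHr].
  by rewrite big_nil rmorph1 -(expr0 g) => /mg.
rewrite big_cons rmorphM evXC => /maximal_prime[mz|/IHr] //.
by apply: hN; exists z.
Qed.

Lemma maximal_point : exists v : 'I_n -> K,
  forall p, m (p - mpoly.mpolyC n (mpoly.meval v p)).
Proof.
have [v hv] := choice maximal_coord; exists v => p.
pose Q p := m (p - mpoly.mpolyC n (mpoly.meval v p)).
have QC c : Q (mpoly.mpolyC n c).
  by rewrite /Q mpoly.mevalC subrr; apply: ideal0.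
have QD p1 p2 : Q p1 -> Q p2 -> Q (p1 + p2).
  rewrite /Q mpoly.mevalD mpoly.mpolyCD opprD addrACA; exact: (idealD idm).
have QM p1 p2 : Q p1 -> Q p2 -> Q (p1 * p2).
  rewrite /Q mpoly.mevalM mpoly.mpolyCM => Q1 Q2.
  have -> : p1 * p2 - mpoly.mpolyC n (mpoly.meval v p1) *
      mpoly.mpolyC n (mpoly.meval v p2) =
    p2 * (p1 - mpoly.mpolyC n (mpoly.meval v p1)) +
    mpoly.mpolyC n (mpoly.meval v p1) *
      (p2 - mpoly.mpolyC n (mpoly.meval v p2)) by ring.
  by apply: (idealD idm); apply: (idealM idm).
apply: (@mpoly_ring_ind Q) => // i.
by rewrite /Q mpoly.mevalXU.
Qed.

End MaximalPoint.

(** No Rabinowitsch variable is adjoined: the powers of g are avoided directly by a maximal choice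
    of ideal, and every polynomial is constant modulo that ideal. *)
Lemma nullstellensatz (I : set P) (g : P) : ideal I ->
  (forall v, (forall p, I p -> mpoly.meval v p = 0) -> mpoly.meval v g = 0) ->
  exists N, I (g ^+ N).
Proof.
move=> idI hg; apply: contrapT => /forallNP gI.
have [m [idm Im mg mmax]] := maximal_avoiding idI gI.
have [v hv] := maximal_point idm mg mmax.
have mv p : m p -> mpoly.meval v p = 0.
  move=> mp; apply: (maximal_const idm mg).
  have -> : mpoly.mpolyC n (mpoly.meval v p) =
    p - (p - mpoly.mpolyC n (mpoly.meval v p)) by ring.
  exact: idealB.
apply: (mg 1%N); rewrite expr1 -[g]subr0 -(mpoly.mpolyC0 n K).
by rewrite -(hg v) // => p /Im /mv.
Qed.

End Nullstellensatz.

(** * Regular functions *)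

Section Charts.
Variables (R : realType) (X : variety R).
Local Notation K := R[i].
Local Notation reg := (@regular_at R X).
Local Notation ev phi P y := (mpoly.meval (coords phi y) P).
Implicit Types (U A B : set X) (x y : X) (g h : X -> K).

Section Chart.
Variables (U : set X) (n : nat) (phi : 'I_n -> X -> K).
Hypothesis chartU : affine_chart reg U phi.

Lemma chart_open_self : open U.
Proof.
apply/(chart_open chartU) => // x Ux; exists 1.
by rewrite mpoly.meval1 oner_neq0.
Qed.

Lemma chart_open_nz P : open [set y | U y /\ ev phi P y != 0].
Proof.
apply/(chart_open chartU) => [x [] //|x [Ux Px]].
by exists P; split.
Qed.

Lemma chart_nbhs x A : U x -> nbhs x A -> exists P, ev phi P x != 0 /\
  forall y, U y -> ev phi P y != 0 -> A y.
Proof.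
move=> Ux; rewrite nbhsE => -[B [oB Bx] BA].
have oBU : open (B `&` U) by apply: openI => //; apply: chart_open_self.
have [|P [Px PB]] := (chart_open chartU (@subIsetr _ B U)).1 oBU x => //.
by exists P; split=> // y Uy /(PB y Uy)[/BA].
Qed.

Lemma chart_nz_nbhs x P : U x -> ev phi P x != 0 ->
  nbhs x [set y | U y /\ ev phi P y != 0].
Proof. by move=> Ux Px; apply: open_nbhs_nbhs; split=> //; apply: chart_open_nz. Qed.

(** A quotient valid only near x is made valid wherever its denominator is nonzero, by multiplying
    numerator and denominator by a polynomial that vanishes outside the neighbourhood. *)
Lemma chart_reg_near x g : U x -> reg x g <->
  exists P Q, ev phi Q x != 0 /\
    \forall y \near x, ev phi Q y != 0 /\ g y = ev phi P y / ev phi Q y.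
Proof.
move=> Ux; rewrite (chart_regular chartU g Ux); split=> -[P [Q [Qx h]]].
  exists P, Q; split=> //; apply: filterS (chart_nz_nbhs Ux Qx) => y [Uy Qy].
  by split=> //; apply: h.
have [S [Sx hS]] := chart_nbhs Ux h.
exists (P * S), (Q * S); rewrite mpoly.mevalM mulf_neq0 //; split=> // y Uy.
rewrite !mpoly.mevalM mulf_eq0 negb_or => /andP[Qy Sy].
have [_ ->] := hS y Uy Sy.
by rewrite -mulf_div divff // mulr1.
Qed.

End Chart.

Lemma chart_at x : exists U n (phi : 'I_n -> X -> K),
  U x /\ affine_chart reg U phi.
Proof.
have [n [U [Uaff Ucov]]] := variety_cover X.
by have [i Uix] := Ucov x; have [m [phi c]] := Uaff i; exists (U i), m, phi.
Qed.

Lemma affine_is_open U : affine U -> open U.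
Proof. by case=> n [phi c]; apply: chart_open_self c. Qed.

Lemma regular_near_eq x g h : reg x g -> (\forall y \near x, g y = h y) -> reg x h.
Proof.
have [U [n [phi [Ux c]]]] := chart_at x.
move=> /(chart_reg_near c _ Ux)[P [Q [Qx gPQ]]] gh.
apply/(chart_reg_near c _ Ux); exists P, Q; split=> //.
by apply: filterS2 gPQ gh => y [Qy ->] <-.
Qed.

Lemma regular_cst x a : reg x (fun=> a).
Proof.
have [U [n [phi [Ux c]]]] := chart_at x.
apply/(chart_reg_near c _ Ux); exists (mpoly.mpolyC n a), 1.
rewrite mpoly.meval1 oner_neq0; split=> //.
by apply: nearW => y; rewrite mpoly.meval1 mpoly.mevalC divr1 oner_neq0.
Qed.

Lemma regularD x g h : reg x g -> reg x h -> reg x (g + h).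
Proof.
have [U [n [phi [Ux c]]]] := chart_at x.
move=> /(chart_reg_near c _ Ux)[P [Q [Qx gPQ]]].
move=> /(chart_reg_near c _ Ux)[P' [Q' [Qx' hPQ]]].
apply/(chart_reg_near c _ Ux); exists (P * Q' + P' * Q), (Q * Q').
rewrite mpoly.mevalM mulf_neq0 //; split=> //.
apply: filterS2 gPQ hPQ => y [Qy gy] [Qy' hy].
rewrite mpoly.mevalD !mpoly.mevalM mulf_neq0 //; split=> //.
by rewrite -addf_div // -gy -hy.
Qed.

Lemma regularM x g h : reg x g -> reg x h -> reg x (g * h).
Proof.
have [U [n [phi [Ux c]]]] := chart_at x.
move=> /(chart_reg_near c _ Ux)[P [Q [Qx gPQ]]].
move=> /(chart_reg_near c _ Ux)[P' [Q' [Qx' hPQ]]].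
apply/(chart_reg_near c _ Ux); exists (P * P'), (Q * Q').
rewrite mpoly.mevalM mulf_neq0 //; split=> //.
apply: filterS2 gPQ hPQ => y [Qy gy] [Qy' hy].
rewrite !mpoly.mevalM mulf_neq0 //; split=> //.
by rewrite -mulf_div -gy -hy.
Qed.

Lemma regularZ x a g : reg x g -> reg x (a *: g).
Proof. by move=> rg; apply: (regularM (regular_cst x a) rg). Qed.

Lemma regularN x g : reg x g -> reg x (- g).
Proof. by move=> rg; rewrite -scaleN1r; apply: regularZ. Qed.

Lemma regularB x g h : reg x g -> reg x h -> reg x (g - h).
Proof. by move=> rg rh; apply: regularD => //; apply: regularN. Qed.

Lemma regular0 x : reg x 0.
Proof. exact: regular_cst. Qed.

Lemma regular1 x : reg x 1.
Proof. exact: regular_cst. Qed.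

Lemma regularX x g k : reg x g -> reg x (g ^+ k).
Proof.
move=> rg; elim: k => [|k IHk]; first exact: regular1.
by rewrite exprS; apply: regularM.
Qed.

Lemma regular_sum x (I : Type) (r : seq I) (F : I -> X -> K) :
  (forall i, reg x (F i)) -> reg x (\sum_(i <- r) F i).
Proof.
move=> rF; elim/big_rec: _ => [|i g _ rg]; first exact: regular0.
exact: regularD.
Qed.

Lemma regular_near x g : reg x g -> \forall y \near x, reg y g.
Proof.
have [U [n [phi [Ux c]]]] := chart_at x.
move=> /(chart_regular c _ Ux)[P [Q [Qx gPQ]]].
apply: filterS (chart_nz_nbhs c Ux Qx) => y [Uy Qy].
by apply/(chart_regular c _ Uy); exists P, Q.
Qed.

Lemma regular_neq0 x g : reg x g -> g x != 0 -> \forall y \near x, g y != 0.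
Proof.
have [U [n [phi [Ux c]]]] := chart_at x.
move=> /(chart_regular c _ Ux)[P [Q [Qx gPQ]]] gx.
have Px : ev phi P x != 0.
  by apply: contraNneq gx => Px; rewrite gPQ // Px mul0r.
have PQx : ev phi (P * Q) x != 0 by rewrite mpoly.mevalM mulf_neq0.
apply: filterS (chart_nz_nbhs c Ux PQx) => y [Uy].
rewrite mpoly.mevalM mulf_eq0 negb_or => /andP[Py Qy].
by rewrite gPQ // mulf_neq0 // invr_eq0.
Qed.

Lemma regularV x g : reg x g -> g x != 0 -> reg x (fun y => (g y)^-1).
Proof.
have [U [n [phi [Ux c]]]] := chart_at x => rg gx.
have g0 := regular_neq0 rg gx.
move: rg => /(chart_reg_near c _ Ux)[P [Q [Qx gPQ]]].
have Px : ev phi P x != 0.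
  by apply: contraNneq gx => Px; rewrite (nbhs_singleton gPQ).2 Px mul0r.
apply/(chart_reg_near c _ Ux); exists Q, P; split=> //.
apply: filterS2 gPQ g0 => y [Qy gy]; rewrite gy => gy0; split; last first.
  by rewrite invfM invrK mulrC.
by apply: contraNneq gy0 => ->; rewrite mul0r.
Qed.

Lemma regular_div x g h : reg x g -> reg x h -> h x != 0 ->
  reg x (fun y => g y / h y).
Proof. by move=> rg rh hx; apply: regularM rg (regularV rh hx). Qed.

Lemma open_meet A B x y : open A -> open B -> A x -> B y ->
  exists z, A z /\ B z.
Proof.
move=> oA oB Ax By; have [_ irr] := variety_irreducible X.
by have [z [Az Bz]] := irr A B oA oB (ex_intro _ x Ax) (ex_intro _ y By);
  exists z.
Qed.

Lemma open_regular_neq0 U g : open U -> regular_on U g ->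
  open [set y | U y /\ g y != 0].
Proof.
move=> oU rg; rewrite openE => y [Uy gy].
rewrite /interior; apply: filterS2 (open_nbhs_nbhs (conj oU Uy))
  (regular_neq0 (rg y Uy) gy) => z; by split.
Qed.

(** Identity theorem: by irreducibility, the open set where g is nonzero would meet the one where g
    vanishes. *)
Lemma regular_eq0 U g x : open U -> regular_on U g -> U x ->
  (\forall y \near x, g y = 0) -> forall y, U y -> g y = 0.
Proof.
move=> oU rg Ux g0 y Uy.
have : nbhs x [set z | g z = 0] by [].
rewrite nbhsE => -[B [oB Bx] Bg].
apply/eqP/negP => /negP gy.
have [z [[_ gz] Bz]] := open_meet (x := y) (y := x)
  (open_regular_neq0 oU rg) oB (conj Uy gy) Bx.
by rewrite Bg ?eqxx in gz.
Qed.

Section ChartFunctions.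
Variables (U : set X) (n : nat) (phi : 'I_n -> X -> K).
Hypothesis chartU : affine_chart reg U phi.

Lemma regular_ev P : regular_on U (fun y => ev phi P y).
Proof.
move=> x Ux; apply/(chart_regular chartU _ Ux); exists P, 1.
rewrite mpoly.meval1 oner_neq0; split=> // y _ _.
by rewrite mpoly.meval1 divr1.
Qed.

Lemma ideal_zero_chart (I : set (mpoly.mpoly n K)) (v : 'I_n -> K) :
  (forall P, (forall x, U x -> ev phi P x = 0) -> I P) ->
  (forall P, I P -> mpoly.meval v P = 0) ->
  exists2 x, U x & coords phi x = v.
Proof. by move=> UI Iv; apply: (chart_closed chartU) => P /UI /Iv. Qed.

(** The polynomials Q for which Q h is polynomial off the zeros of G form an ideal. Its zeros lie on
    the chart, which is closed, and a local denominator of h shows that G vanishes at them; the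
    Nullstellensatz applies to G. *)
Lemma regular_off_denominator G h :
  (forall x, U x -> ev phi G x != 0 -> reg x h) ->
  exists N P, forall y, U y -> ev phi G y != 0 ->
    ev phi G y ^+ N * h y = ev phi P y.
Proof.
move=> rh; pose I Q := exists P, forall y, U y -> ev phi G y != 0 ->
  ev phi Q y * h y = ev phi P y.
have idI : ideal I.
  split.
  - by exists 0 => y _ _; rewrite mpoly.meval0 mul0r.
  - move=> Q Q' [P hP] [P' hP']; exists (P + P') => y Uy Gy.
    by rewrite !mpoly.mevalD mulrDl hP // hP'.
  - move=> S Q [P hP]; exists (S * P) => y Uy Gy.
    by rewrite !mpoly.mevalM -mulrA hP.
have [v vI|N [P hP]] := @nullstellensatz _ _ I G idI.
  have [|x Ux xv] := @ideal_zero_chart I v _ vI.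
    move=> P P0; exists 0 => y Uy _.
    by rewrite P0 // mul0r mpoly.meval0.
  rewrite -xv; apply/eqP/negP => /negP Gx.
  have /(chart_regular chartU _ Ux)[P [Q [Qx hPQ]]] := rh x Ux Gx.
  (* The square is taken because h = P / Q is known only where Q is nonzero; where Q vanishes, Q^2 h
     = P Q holds trivially. *)
  have : mpoly.meval v (Q * Q) = 0.
    apply: vI; exists (P * Q) => y Uy Gy; rewrite !mpoly.mevalM.
    have [->|Qy] := eqVneq (ev phi Q y) 0; first by rewrite !mulr0 mul0r.
    by rewrite hPQ //; field.
  by rewrite -xv mpoly.mevalM => /eqP; rewrite mulf_eq0 (negPf Qx).
by exists N, P => y Uy Gy; rewrite -hP // rmorphXn.
Qed.

Lemma regular_is_poly g : regular_on U g ->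
  exists P, forall y, U y -> g y = ev phi P y.
Proof.
move=> rg; have [x Ux _|N [P hP]] := @regular_off_denominator 1 g.
  exact: rg.
exists P => y Uy; rewrite -hP ?mpoly.meval1 ?oner_neq0 //.
by rewrite expr1n mul1r.
Qed.

(* Partition of unity, in the form of a local-to-global principle. *)
Lemma regular_ideal (J : set (X -> K)) :
  (forall g h, J g -> J h -> J (g + h)) ->
  (forall g h, regular_on U g -> J h -> J (g * h)) ->
  (forall g h, (forall y, U y -> g y = h y) -> J g -> J h) ->
  (forall x, U x -> exists2 g, regular_on U g /\ J g & g x != 0) ->
  J 0 -> J 1.
Proof.
move=> JD JM Jeq Jx J0.
pose I P := J (fun y => ev phi P y).
have idI : ideal I.
  split.
  - by apply: Jeq J0 => y _; rewrite mpoly.meval0.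
  - by move=> P Q IP IQ; apply: Jeq (JD _ _ IP IQ) => y _; rewrite mpoly.mevalD.
  - move=> S P IP; apply: Jeq (JM _ _ (regular_ev S) IP) => y _.
    by rewrite mpoly.mevalM.
have [v vI|N] := @nullstellensatz _ _ I 1 idI; last first.
  by rewrite expr1n; apply: Jeq => y _; rewrite mpoly.meval1.
have [|x Ux xv] := @ideal_zero_chart I v _ vI.
  by move=> P P0; apply: Jeq J0 => y Uy; rewrite P0.
have [g [rg Jg] gx] := Jx x Ux; have [P hP] := regular_is_poly rg.
have : mpoly.meval v P = 0.
  by apply: vI; apply: Jeq Jg => y Uy; rewrite hP.
by rewrite -xv -hP // => gx0; rewrite gx0 eqxx in gx.
Qed.

End ChartFunctions.
End Charts.

(** * Principal affine opens and derivations *)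

Section AffineOpens.
Variables (R : realType) (X : variety R).
Local Notation K := R[i].
Local Notation reg := (@regular_at R X).
Local Notation ev phi P y := (mpoly.meval (coords phi y) P).
Implicit Types (U A B : set X) (x y : X) (g h : X -> K).

Lemma regular_meval x n (psi : 'I_n -> X -> K) P :
  (forall i, reg x (psi i)) -> reg x (fun y => ev psi P y).
Proof.
move=> rpsi; elim/mpoly_ring_ind: P => [c|i|p q rp rq|p q rp rq].
- by apply: regular_near_eq (regular_cst x c) _; apply: nearW => y;
    rewrite mpoly.mevalC.
- by apply: regular_near_eq (rpsi i) _; apply: nearW => y; rewrite mpoly.mevalXU.
- by apply: regular_near_eq (regularD rp rq) _; apply: nearW => y;
    rewrite mpoly.mevalD.
- by apply: regular_near_eq (regularM rp rq) _; apply: nearW => y;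
    rewrite mpoly.mevalM.
Qed.

Section Principal.
Variables (U : set X) (n : nat) (phi : 'I_n -> X -> K).
Variable G : mpoly.mpoly n K.
Hypothesis chartU : affine_chart reg U phi.

(* The Rabinowitsch chart of the principal open set [G != 0]. *)
Definition principal_chart : 'I_n.+1 -> X -> K := fun i y =>
  if unlift ord0 i is Some j then phi j y else (ev phi G y)^-1.

Local Notation W := [set y | U y /\ ev phi G y != 0].

Definition widen_mpoly (P : mpoly.mpoly n K) : mpoly.mpoly n.+1 K :=
  mpoly.comp_mpoly [tuple mpoly.mpolyX K (mpoly.mnm1 (lift ord0 i)) | i < n] P.

Lemma meval_widen v P :
  mpoly.meval v (widen_mpoly P) = mpoly.meval (fun i => v (lift ord0 i)) P.
Proof.
rewrite mpoly.comp_mpoly_meval; apply: mpoly.meval_eq => i.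
by rewrite tnth_mktuple mpoly.mevalXU.
Qed.

Lemma coords_principal y i : coords principal_chart y (lift ord0 i) = phi i y.
Proof. by rewrite /coords /principal_chart liftK. Qed.

Lemma ev_widen y P : ev principal_chart (widen_mpoly P) y = ev phi P y.
Proof.
rewrite meval_widen; apply: mpoly.meval_eq => i.
exact: coords_principal.
Qed.

Lemma principal_regular y i : W y -> reg y (principal_chart i).
Proof.
move=> [Uy Gy]; rewrite /principal_chart; case: (unlift ord0 i) => [j|].
  apply: regular_near_eq (regular_ev chartU (mpoly.mpolyX K (mpoly.mnm1 j)) Uy) _.
  by apply: nearW => z; rewrite mpoly.mevalXU.
exact: regularV (regular_ev chartU G Uy) Gy.
Qed.

Lemma principal_affine : affine W.
Proof.
have WU : W `<=` U by move=> y [].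
have oW := chart_open_nz chartU G.
exists n.+1, principal_chart; split.
- move=> x y [Ux _] [Uy _] exy; apply: (chart_inj chartU) => //.
  by apply/funext => i; rewrite /coords -!coords_principal exy.
- move=> v hv.
  have [|x Ux xv] := chart_closed chartU (v := fun i => v (lift ord0 i)).
    move=> P P0; rewrite -meval_widen; apply: hv => x [Ux _].
    by rewrite ev_widen P0.
  (* This equation forces the extra coordinate to be the inverse of G. *)
  have : mpoly.meval v (widen_mpoly G * mpoly.mpolyX K (mpoly.mnm1 ord0) - 1) = 0.
    apply: hv => y [_ Gy]; rewrite mpoly.mevalB mpoly.mevalM mpoly.meval1.
    rewrite ev_widen mpoly.mevalXU /coords /principal_chart unlift_none.
    by rewrite mulfV ?subrr.
  rewrite mpoly.mevalB mpoly.mevalM mpoly.meval1 mpoly.mevalXU meval_widen.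
  rewrite -xv => /eqP; rewrite subr_eq0 => /eqP Gv.
  have Gx : ev phi G x != 0.
    by apply: contra_eq_neq Gv => ->; rewrite mul0r eq_sym oner_neq0.
  exists x => //; apply/funext => i; rewrite /coords /principal_chart.
  case: unliftP => [j ->|->]; first by rewrite -[RHS](congr1 (@^~ j) xv).
  by apply: (mulfI Gx); rewrite Gv mulfV.
- move=> x g [Ux Gx]; split=> [/(chart_regular chartU _ Ux)|].
    move=> [P [Q [Qx gPQ]]]; exists (widen_mpoly P), (widen_mpoly Q).
    split=> [|y [Uy _]]; first by rewrite ev_widen.
    have transport (a a' c c' : K) : a' = a -> c' = c ->
        (c != 0 -> g y = a / c) -> c' != 0 -> g y = a' / c' by move=> -> ->.
    exact: transport (ev_widen y P) (ev_widen y Q) (gPQ y Uy).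
  move=> [P [Q [Qx gPQ]]].
  have rev S : reg x (fun y => ev principal_chart S y).
    by apply: regular_meval => i; apply: principal_regular.
  apply: regular_near_eq (regular_div (rev P) (rev Q) Qx) _.
  have := regular_neq0 (rev Q) Qx; apply: filterS2 (open_nbhs_nbhs (conj oW (conj Ux Gx))).
  by move=> y Wy Qy; rewrite gPQ.
- move=> A AW; split=> [oA x Ax|hA].
    have AU : A `<=` U by move=> y /AW [].
    have [P [Px PA]] := (chart_open chartU AU).1 oA x Ax.
    exists (widen_mpoly P); rewrite ev_widen; split=> // y [Uy _].
    by rewrite ev_widen; apply: PA.
  rewrite openE => x Ax; have [P [Px PA]] := hA x Ax.
  have Wx := AW _ Ax.
  have rP : reg x (fun y => ev principal_chart P y).
    by apply: regular_meval => i; apply: principal_regular.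
  have := regular_neq0 rP Px; rewrite /interior.
  apply: filterS2 (open_nbhs_nbhs (conj oW Wx)) => y Wy Py.
  exact: PA.
Qed.

End Principal.

Lemma small_affine x A : open A -> A x -> exists W, [/\ affine W, W x & W `<=` A].
Proof.
move=> oA Ax; have [U [n [phi [Ux c]]]] := chart_at x.
have [P [Px PA]] := chart_nbhs c Ux (open_nbhs_nbhs (conj oA Ax)).
exists [set y | U y /\ ev phi P y != 0]; split=> //.
- exact: principal_affine.
- by move=> y [Uy Py]; apply: PA.
Qed.

Lemma extend0_in A g y : A y -> extend0 A g y = g y.
Proof. by move=> Ay; rewrite /extend0 patchT // inE. Qed.

Lemma extend0_out A g y : ~ A y -> extend0 A g y = 0.
Proof. by move=> Ay; rewrite /extend0 patchC // inE. Qed.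

Lemma regular_extend0 U g : open U -> regular_on U g -> regular_on U (extend0 U g).
Proof.
move=> oU rg x Ux; apply: regular_near_eq (rg x Ux) _.
by apply: filterS (open_nbhs_nbhs (conj oU Ux)) => y Uy; rewrite extend0_in.
Qed.

Section Derivations.
Variables (W : set X) (theta : (X -> K) -> X -> K).
Hypothesis dtheta : derivation_on W theta.

Lemma deriv0 x : W x -> theta 0 x = 0.
Proof.
move=> Wx; have := derivation_linear dtheta 1 Wx (regular0 x) (regular0 x).
rewrite scaler0 addr0 mul1r => /eqP; rewrite -subr_eq subrr => /eqP e.
by rewrite -e.
Qed.

Lemma derivZ x a g : W x -> reg x g -> theta (a *: g) x = a * theta g x.
Proof.
move=> Wx rg; have := derivation_linear dtheta a Wx rg (regular0 x).
by rewrite addr0 deriv0 // addr0.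
Qed.

Lemma derivD x g h : W x -> reg x g -> reg x h ->
  theta (g + h) x = theta g x + theta h x.
Proof.
move=> Wx rg rh; have := derivation_linear dtheta 1 Wx rg rh.
by rewrite scale1r mul1r.
Qed.

Lemma deriv1 x : W x -> theta 1 x = 0.
Proof.
move=> Wx; have := derivation_leibniz dtheta Wx (regular1 x) (regular1 x).
rewrite mulr1 => /eqP; rewrite -[1 x]/(1 : K) mulr1 mul1r -subr_eq subrr.
by move=> /eqP e; rewrite -e.
Qed.

Lemma deriv_cst x a : W x -> theta (fun=> a) x = 0.
Proof.
move=> Wx; have -> : (fun=> a) = a *: (1 : X -> K).
  by apply/funext => y; rewrite /= -[RHS]/(a * 1) mulr1.
by rewrite derivZ ?deriv1 ?mulr0 //; apply: regular1.
Qed.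

Lemma deriv_meval n (psi : 'I_n -> X -> K) x P : W x ->
  (forall i, reg x (psi i)) ->
  theta (fun y => ev psi P y) x =
    \sum_i ev psi (mpoly.mderiv i P) x * theta (psi i) x.
Proof.
move=> Wx rpsi; pose F P : X -> K := fun y => ev psi P y.
have rF P' : reg x (F P') by exact: regular_meval.
rewrite -/(F P); elim/mpoly_ring_ind: P => [c|j|p q IHp IHq|p q IHp IHq].
- have -> : F (mpoly.mpolyC n c) = (fun=> c).
    by apply/funext => y; rewrite /F mpoly.mevalC.
  rewrite deriv_cst // big1 // => i _.
  by rewrite mpoly.mderivC mpoly.meval0 mul0r.
- have -> : F (mpoly.mpolyX K (mpoly.mnm1 j)) = psi j.
    by apply/funext => y; rewrite /F mpoly.mevalXU.
  rewrite (bigD1 j) //= big1 => [|i ij].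
    rewrite mpoly.mderivX mpoly.mnm1E eqxx -{1}(mpoly.add0m (mpoly.mnm1 j)).
    rewrite mpoly.addmK mpoly.mpolyX0 scale1r.
    by rewrite mpoly.meval1 mul1r addr0.
  by rewrite mpoly.mderivX mpoly.mnm1E eq_sym (negPf ij) scale0r mpoly.meval0 mul0r.
- have -> : F (p + q) = F p + F q.
    by apply/funext => y; rewrite /F mpoly.mevalD.
  rewrite (derivD Wx (rF p) (rF q)) IHp IHq.
  rewrite -big_split; apply: eq_bigr => i _ /=.
  by rewrite mpoly.mderivD mpoly.mevalD mulrDl.
- have -> : F (p * q) = F p * F q.
    by apply/funext => y; rewrite /F mpoly.mevalM.
  rewrite (derivation_leibniz dtheta Wx (rF p) (rF q)) IHp IHq.
  rewrite mulr_suml mulr_sumr -big_split; apply: eq_bigr => i _ /=.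
  rewrite mpoly.mderivM mpoly.mevalD.
  rewrite (mpoly.mevalM _ (mpoly.mderiv i p)) (mpoly.mevalM _ p) /F; ring.
Qed.

End Derivations.

End AffineOpens.

(** * Gluing functional equations *)

Section PolynomialDerivation.
Variables (R : realType) (n : nat) (p : 'I_n -> mpoly.mpoly n R[i]).

(** The vector field on affine space with coefficients [p]; it descends to a chart once it preserves
    the ideal of the chart. *)
Definition mpoly_field (P : mpoly.mpoly n R[i]) : mpoly.mpoly n R[i] :=
  \sum_i p i * mpoly.mderiv i P.

Lemma mpoly_fieldD P Q : mpoly_field (P + Q) = mpoly_field P + mpoly_field Q.
Proof.
rewrite /mpoly_field -big_split; apply: eq_bigr => i _ /=.
by rewrite mpoly.mderivD mulrDr.
Qed.

Lemma mpoly_fieldN P : mpoly_field (- P) = - mpoly_field P.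
Proof.
rewrite /mpoly_field -sumrN; apply: eq_bigr => i _ /=.
by rewrite mpoly.mderivN mulrN.
Qed.

Lemma mpoly_fieldM P Q :
  mpoly_field (P * Q) = mpoly_field P * Q + P * mpoly_field Q.
Proof.
rewrite /mpoly_field mulr_suml mulr_sumr -big_split; apply: eq_bigr => i _ /=.
by rewrite mpoly.mderivM; ring.
Qed.

Lemma mpoly_fieldC c : mpoly_field (mpoly.mpolyC n c) = 0.
Proof. by rewrite /mpoly_field big1 // => i _; rewrite mpoly.mderivC mulr0. Qed.

Lemma meval_sum_prod v (a b c d : mpoly.mpoly n R[i]) :
  mpoly.meval v (a * b + c * d) =
  mpoly.meval v a * mpoly.meval v b + mpoly.meval v c * mpoly.meval v d.
Proof. by rewrite mpoly.mevalD !mpoly.mevalM. Qed.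

Lemma meval_fieldM v P Q : mpoly.meval v (mpoly_field (P * Q)) =
  mpoly.meval v (mpoly_field P) * mpoly.meval v Q +
  mpoly.meval v P * mpoly.meval v (mpoly_field Q).
Proof. rewrite mpoly_fieldM; exact: meval_sum_prod. Qed.

Lemma meval_field_cross v P Q P' Q' :
  mpoly.meval v (mpoly_field (P * Q' - P' * Q)) =
  (mpoly.meval v (mpoly_field P) * mpoly.meval v Q' +
   mpoly.meval v P * mpoly.meval v (mpoly_field Q')) -
  (mpoly.meval v (mpoly_field P') * mpoly.meval v Q +
   mpoly.meval v P' * mpoly.meval v (mpoly_field Q)).
Proof.
rewrite mpoly_fieldD mpoly_fieldN mpoly.mevalB.
by congr (_ - _); apply: meval_fieldM.
Qed.

Lemma meval_field_lincomb v a P Q P' Q' :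
  mpoly.meval v (mpoly_field (mpoly.mpolyC n a * P * Q' + P' * Q)) =
  a * (mpoly.meval v (mpoly_field P) * mpoly.meval v Q' +
   mpoly.meval v P * mpoly.meval v (mpoly_field Q')) +
  (mpoly.meval v (mpoly_field P') * mpoly.meval v Q +
   mpoly.meval v P' * mpoly.meval v (mpoly_field Q)).
Proof.
rewrite mpoly_fieldD mpoly.mevalD; congr (_ + _); last exact: meval_fieldM.
rewrite -mulrA mpoly_fieldM mpoly_fieldC mul0r add0r mpoly.mevalM.
by rewrite mpoly.mevalC; congr (_ * _); apply: meval_fieldM.
Qed.

Lemma mpoly_fieldE P : mpoly_field P = \sum_i p i * mpoly.mderiv i P.
Proof. by []. Qed.

End PolynomialDerivation.

Opaque mpoly_field.

(** With a, b, c, d the derivatives of P, Q, P', Q', where P = h Q and P' = h Q', the expression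
    assumed to vanish is the derivative of P Q' - P' Q. *)
Lemma quotient_rule_unique (F : fieldType) (h a b c d q q' : F) :
  q != 0 -> q' != 0 -> (a * q' + h * q * d) - (c * q + h * q' * b) = 0 ->
  (a - h * b) / q = (c - h * d) / q'.
Proof.
move=> q0 q0' e; apply/eqP; rewrite eqr_div // -subr_eq0 -[X in _ == X]e.
by apply/eqP; ring.
Qed.

Lemma quotient_rule_lincomb (F : fieldType) (a p q p' q' dp dq dp' dq' A B C : F) :
  q != 0 -> q' != 0 -> A = a * (dp * q' + p * dq') + (dp' * q + p' * dq) ->
  B = dq * q' + q * dq' -> C = q * q' ->
  a * ((dp - p / q * dq) / q) + (dp' - p' / q' * dq') / q' =
  (A - (a * (p / q) + p' / q') * B) / C.
Proof. by move=> q0 q0' -> -> ->; field; rewrite q0 q0'. Qed.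

Lemma quotient_rule_product (F : fieldType) (p q p' q' dp dq dp' dq' A B C : F) :
  q != 0 -> q' != 0 -> A = dp * p' + p * dp' -> B = dq * q' + q * dq' ->
  C = q * q' ->
  (dp - p / q * dq) / q * (p' / q') + p / q * ((dp' - p' / q' * dq') / q') =
  (A - p / q * (p' / q') * B) / C.
Proof. by move=> q0 q0' -> -> ->; field; rewrite q0 q0'. Qed.

(** * Extending derivations from a neighbourhood to a chart *)

Section Extension.
Variables (R : realType) (X : variety R).
Local Notation K := R[i].
Local Notation reg := (@regular_at R X).
Local Notation ev phi P y := (mpoly.meval (coords phi y) P).
Implicit Types (g h : X -> K) (x y : X).

Section FractionDerivation.
Variables (U : set X) (n : nat) (phi : 'I_n -> X -> K).
Variable p : 'I_n -> mpoly.mpoly n K.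
Hypothesis chartU : affine_chart reg U phi.
Local Notation Th := (mpoly_field p).
Hypothesis field_vanish : forall P, (forall y, U y -> ev phi P y = 0) ->
  forall y, U y -> ev phi (Th P) y = 0.

(** A relation, since h has many representations P / Q near y and their quotient rules have to be
    compared. *)
Definition fraction_value h y (v : K) : Prop := exists P Q,
  [/\ ev phi Q y != 0,
      \forall z \near y, ev phi Q z != 0 /\ h z = ev phi P z / ev phi Q z &
      v = (ev phi (Th P) y - h y * ev phi (Th Q) y) / ev phi Q y].

Lemma fraction_value_exists h y : U y -> reg y h -> exists v, fraction_value h y v.
Proof.
move=> Uy /(chart_reg_near chartU _ Uy)[P [Q [Qy hPQ]]].
by eexists; exists P, Q; split.
Qed.

(** P Q' - P' Q vanishes near y, hence on all of U by irreducibility, and [field_vanish] makes its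
    derivative vanish too. *)
Lemma fraction_value_unique h y v w : U y ->
  fraction_value h y v -> fraction_value h y w -> v = w.
Proof.
move=> Uy [P [Q [Qy hPQ ->]]] [P' [Q' [Qy' hPQ' ->]]].
have E0 : forall z, U z -> ev phi (P * Q' - P' * Q) z = 0.
  apply: (regular_eq0 (chart_open_self chartU) (regular_ev chartU _) Uy).
  apply: filterS2 hPQ hPQ' => z [Qz hz] [Qz' hz'].
  have : ev phi P z / ev phi Q z = ev phi P' z / ev phi Q' z by rewrite -hz.
  move/eqP; rewrite eqr_div // => /eqP e.
  by rewrite mpoly.mevalB !mpoly.mevalM e subrr.
have hP : ev phi P y = h y * ev phi Q y.
  by rewrite (nbhs_singleton hPQ).2 divfK.
have hP' : ev phi P' y = h y * ev phi Q' y.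
  by rewrite (nbhs_singleton hPQ').2 divfK.
apply: (quotient_rule_unique Qy Qy'); rewrite -hP -hP' -meval_field_cross.
exact: field_vanish.
Qed.

Definition fraction_derivation h y : K := xget 0 [set v | fraction_value h y v].

Lemma fraction_derivationE h y v : U y -> fraction_value h y v ->
  fraction_derivation h y = v.
Proof.
move=> Uy hv; rewrite /fraction_derivation; case: xgetP => [w _ /= hw|/(_ v)//].
exact: fraction_value_unique hw hv.
Qed.

Lemma fraction_derivationP h y : U y -> reg y h ->
  fraction_value h y (fraction_derivation h y).
Proof.
move=> Uy /(fraction_value_exists Uy)[v hv].
by rewrite (fraction_derivationE Uy hv).
Qed.

Lemma fraction_derivation_on : derivation_on U fraction_derivation.
Proof.
have near_near (A : set X) x : nbhs x A -> \forall y \near x, nbhs y A.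
  by move=> /nbhs_interior.
split.
- move=> x g Ux rg; have [P [Q [Qx gPQ _]]] := fraction_derivationP Ux rg.
  have rev S : reg x (fun y => ev phi S y) by exact: (regular_ev chartU).
  apply: regular_near_eq (regular_div (regularB (rev (Th P))
    (regularM rg (rev (Th Q)))) (rev Q) Qx) _.
  have oU := open_nbhs_nbhs (conj (chart_open_self chartU) Ux).
  apply: filterS2 oU (near_near _ _ gPQ) => y Uy gy.
  apply/esym/(fraction_derivationE Uy); exists P, Q; split=> //.
  by have [] := nbhs_singleton gy.
- move=> x g h Ux rg gh; apply: (fraction_derivationE Ux).
  have rh := regular_near_eq rg gh.
  have [P [Q [Qx hPQ ->]]] := fraction_derivationP Ux rh.
  exists P, Q; split=> //; last by rewrite (nbhs_singleton gh).
  by apply: filterS2 gh hPQ => z ->.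
- move=> x a g h Ux rg rh; apply: (fraction_derivationE Ux).
  have [P [Q [Qx gPQ ->]]] := fraction_derivationP Ux rg.
  have [P' [Q' [Qx' hPQ ->]]] := fraction_derivationP Ux rh.
  exists (mpoly.mpolyC n a * P * Q' + P' * Q), (Q * Q').
  have eg := nbhs_singleton gPQ; have eh := nbhs_singleton hPQ; split.
  + by rewrite mpoly.mevalM mulf_neq0.
  + apply: filterS2 gPQ hPQ => z [Qz gz] [Qz' hz].
    rewrite mpoly.mevalD !mpoly.mevalM mpoly.mevalC mulf_neq0 //; split=> //.
    by rewrite -[LHS]/(a * g z + h z) gz hz; field; rewrite Qz Qz'.
  + rewrite -[(a *: g + h) x]/(a * g x + h x) eg.2 eh.2.
    apply: (quotient_rule_lincomb Qx Qx').
    * exact: meval_field_lincomb.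
    * exact: meval_fieldM.
    * exact: mpoly.mevalM.
- move=> x g h Ux rg rh; apply: (fraction_derivationE Ux).
  have [P [Q [Qx gPQ ->]]] := fraction_derivationP Ux rg.
  have [P' [Q' [Qx' hPQ ->]]] := fraction_derivationP Ux rh.
  exists (P * P'), (Q * Q').
  have eg := nbhs_singleton gPQ; have eh := nbhs_singleton hPQ; split.
  + by rewrite mpoly.mevalM mulf_neq0.
  + apply: filterS2 gPQ hPQ => z [Qz gz] [Qz' hz].
    rewrite !mpoly.mevalM mulf_neq0 //; split=> //.
    by rewrite -[LHS]/(g z * h z) gz hz; field; rewrite Qz Qz'.
  + rewrite -[(g * h) x]/(g x * h x) eg.2 eh.2.
    apply: (quotient_rule_product Qx Qx'); try exact: meval_fieldM.
    exact: mpoly.mevalM.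
Qed.

End FractionDerivation.

Section Bump.
Variables (U : set X) (n : nat) (phi : 'I_n -> X -> K) (x0 : X).
Hypothesis chartU : affine_chart reg U phi.
Hypothesis Ux0 : U x0.

Definition bump_fun (A : set X) (q : X -> K) : Prop :=
  [/\ regular_on U q, q x0 != 0 & forall y, q y != 0 -> U y /\ A y].

Lemma bump_poly A Q : ev phi Q x0 != 0 ->
  (forall y, U y -> ev phi Q y != 0 -> A y) ->
  bump_fun A (extend0 U (fun y => ev phi Q y)).
Proof.
move=> Qx QA; split.
- exact: regular_extend0 (chart_open_self chartU) (regular_ev chartU Q).
- by rewrite extend0_in.
- move=> y; have [Uy|nUy] := pselect (U y).
    by rewrite extend0_in // => /(QA y Uy).
  by rewrite extend0_out // eqxx.
Qed.

(** The bump is Q^2 S extended by zero: S restricts the support to A, one factor Q clears the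
    denominator, and the other covers the points where Q vanishes and h = P / Q says nothing. *)
Lemma bump_denominator A h : nbhs x0 A -> reg x0 h ->
  exists2 q, bump_fun A q & regular_on U (q * h).
Proof.
move=> Ax0 /(chart_regular chartU _ Ux0)[P [Q [Qx hPQ]]].
have [S [Sx SA]] := chart_nbhs chartU Ux0 Ax0.
exists (extend0 U (fun y => ev phi (Q * Q * S) y)).
  apply: bump_poly; first by rewrite !mpoly.mevalM !mulf_neq0.
  move=> y Uy; rewrite !mpoly.mevalM mulf_eq0 negb_or => /andP[_]; exact: SA.
move=> x Ux; apply: regular_near_eq (regular_ev chartU (P * Q * S) Ux) _.
apply: filterS (open_nbhs_nbhs (conj (chart_open_self chartU) Ux)) => y Uy.
rewrite -[RHS]/(extend0 _ _ y * h y) extend0_in // !mpoly.mevalM.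
have [->|Qy] := eqVneq (ev phi Q y) 0; first by rewrite !(mulr0, mul0r).
by rewrite hPQ //; field.
Qed.

Lemma bumpM A q r : bump_fun A q -> regular_on U r -> r x0 != 0 -> bump_fun A (q * r).
Proof.
move=> [rq qx qA] rr rx; split.
- by move=> y Uy; apply: regularM; [apply: rq|apply: rr].
- by rewrite -[_ x0]/(q x0 * r x0) mulf_neq0.
- move=> y; rewrite -[_ y]/(q y * r y) mulf_eq0 negb_or => /andP[/qA] //.
Qed.

(** With q clearing the denominators of all theta(phi_i), the products q theta(phi_i) are
    polynomials p_i on U, and theta' is induced by the vector field with these coefficients. The
    field preserves the ideal of U since this can be tested where q is nonzero, and there it acts as
    q theta. *)
Lemma bump_derivation W A theta : derivation_on W theta -> nbhs x0 W ->
  nbhs x0 A -> exists q theta', [/\ bump_fun (W `&` A) q, derivation_on U theta' &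
    forall y h, q y != 0 -> reg y h -> theta' h y = q y * theta h y].
Proof.
move=> dtheta Wx0 Ax0.
have rphi i y : U y -> reg y (phi i).
  move=> Uy; apply: regular_near_eq
    (regular_ev chartU (mpoly.mpolyX K (mpoly.mnm1 i)) Uy) _.
  by apply: nearW => z; rewrite mpoly.mevalXU.
have rthphi i : reg x0 (theta (phi i)).
  apply: (derivation_regular dtheta); first exact: nbhs_singleton Wx0.
  exact: rphi.
have hb i : exists q, bump_fun (W `&` A) q /\ regular_on U (q * theta (phi i)).
  have [q hq rq] := bump_denominator (filterI Wx0 Ax0) (rthphi i).
  by exists q.
have [qs hqs] := choice hb.
have [q0 bq0 _] := bump_denominator (filterI Wx0 Ax0) (regular1 x0).
pose q := q0 * \prod_i qs i.
have rqs (I : Type) (r : seq I) (F : I -> X -> K) x :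
    (forall i, reg x (F i)) -> reg x (\prod_(i <- r) F i).
  move=> rF; elim/big_rec: _ => [|i g _ rg]; first exact: regular1.
  exact: regularM.
have prodE (P : pred 'I_n) y : (\prod_(i | P i) qs i) y = \prod_(i | P i) qs i y.
  by elim/big_rec2: _ => // i _ g _ <-.
have bq : bump_fun (W `&` A) q.
  apply: bumpM => //.
    by move=> y Uy; apply: rqs => i; have [[rq _ _] _] := hqs i; apply: rq.
  by rewrite prodE; apply/prodf_neq0 => i _; have [[_ qx _] _] := hqs i.
have hp i : exists P, forall y, U y -> q y * theta (phi i) y = ev phi P y.
  have [|P hP] := regular_is_poly chartU (g := q * theta (phi i)).
    move=> y Uy; rewrite /q (bigD1 i) //= mulrC.
    have -> : theta (phi i) * (q0 * (qs i * \prod_(j | j != i) qs j)) =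
      q0 * ((qs i * theta (phi i)) * \prod_(j | j != i) qs j).
      by apply/funext => z; rewrite !mulrfctE; ring.
    apply: regularM; first by case: bq0 => rq _ _; apply: rq.
    apply: regularM; first by have [_] := hqs i; apply.
    rewrite big_mkcond; apply: rqs => j; case: ifP => _; last exact: regular1.
    by have [[rq _ _] _] := hqs j; apply: rq.
  by exists P => y /hP.
have [p hpE] := choice hp.
have field_chain P y : q y != 0 ->
    ev phi (mpoly_field p P) y = q y * theta (fun z => ev phi P z) y.
  move=> qy; have [_ _ /(_ y qy)[Uy [Wy _]]] := bq.
  rewrite (deriv_meval dtheta) //; last by move=> i; apply: rphi.
  rewrite mulr_sumr mpoly_fieldE raddf_sum; apply: eq_bigr => i _ /=.
  by rewrite mpoly.mevalM -hpE //; ring.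
have qnear y : q y != 0 -> \forall z \near y, q z != 0.
  move=> qy; have [rq _ /(_ y qy)[Uy _]] := bq.
  exact: regular_neq0 (rq y Uy) qy.
have vanish P : (forall y, U y -> ev phi P y = 0) ->
    forall y, U y -> ev phi (mpoly_field p P) y = 0.
  move=> P0; have oU := chart_open_self chartU.
  apply: (regular_eq0 oU (regular_ev chartU _) Ux0).
  have [_ qx _] := bq; apply: filterS (qnear _ qx) => y qy.
  rewrite field_chain //; have [_ _ /(_ y qy)[Uy [Wy _]]] := bq.
  have -> : theta (fun z => ev phi P z) y = theta 0 y.
    apply: (derivation_germ dtheta) => //; first exact: (regular_ev chartU).
    by apply: filterS (open_nbhs_nbhs (conj oU Uy)) => z /P0.
  by rewrite (deriv0 dtheta) ?mulr0.
exists q, (fraction_derivation phi p); split=> //.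
  exact: fraction_derivation_on.
move=> y h qy rh; have [_ _ /(_ y qy)[Uy [Wy _]]] := bq.
have [P [Q [Qy hPQ ->]]] := fraction_derivationP chartU vanish Uy rh.
have rev S : reg y (fun z => ev phi S z) by exact: (regular_ev chartU).
have thP : theta (fun z => ev phi P z) y =
    theta h y * ev phi Q y + h y * theta (fun z => ev phi Q z) y.
  rewrite -(derivation_leibniz dtheta Wy rh (rev Q)).
  apply: (derivation_germ dtheta) => //; apply: filterS hPQ => z [Qz hz].
  by rewrite mulrfctE hz divfK.
by rewrite !field_chain // thP; field.
Qed.

End Bump.
End Extension.

Section Gluing.
Variables (R : realType) (X : variety R) (Z : set X).
Local Notation K := R[i].
Local Notation reg := (@regular_at R X).
Implicit Types (g h f e : X -> K) (x y : X) (U W : set X).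
Hypothesis hZ : nonzero_reduced_divisor Z.

Lemma equation_sub U W f : W `<=` U -> equation Z U f -> equation Z W f.
Proof.
by move=> WU [rf Zf gen]; split=> [x /WU /rf|x /WU /Zf|x g /WU] //; apply: gen.
Qed.

Lemma divisor_closed : open (~` Z).
Proof.
have [_ _ hloc] := hZ.
rewrite openE => x nZx; have [U [f [oU Ux [rf Zf _]]]] := hloc x.
have fx : f x != 0 by apply/eqP => /(Zf x Ux).
rewrite /interior; apply: filterS2 (open_nbhs_nbhs (conj oU Ux))
  (regular_neq0 (rf x Ux) fx) => y Uy fy.
by move=> /(Zf y Uy) fy0; rewrite fy0 eqxx in fy.
Qed.

Lemma divisor_dense A x : open A -> A x -> exists y, A y /\ ~ Z y.
Proof.
move=> oA Ax; have [_ /eqP nZ _] := hZ.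
have [z nZz] : exists z, ~ Z z.
  apply: contrapT => /forallNP h; apply: nZ; apply/seteqP; split=> // z _.
  exact: contrapT (h z).
exact: open_meet oA divisor_closed Ax nZz.
Qed.

(** Each equation divides the other: f = e f' and f' = e' f. If e vanished at x, then 1 - e e' would
    be invertible near x and kill f, so f would vanish near x, although Z contains no nonempty open
    set. *)
Lemma equation_unit U W f f' x : open U -> open W -> U x -> W x ->
  equation Z U f -> equation Z W f' -> exists e, [/\ reg x e, e x != 0 &
    \forall y \near x, f y = e y * f' y].
Proof.
move=> oU oW Ux Wx [rf Zf genf] [rf' Zf' genf'].
have nU := open_nbhs_nbhs (conj oU Ux); have nW := open_nbhs_nbhs (conj oW Wx).
have Zf0 : \forall y \near x, Z y -> f y = 0.
  by apply: filterS nU => y Uy /(Zf y Uy).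
have Zf'0 : \forall y \near x, Z y -> f' y = 0.
  by apply: filterS nW => y Wy /(Zf' y Wy).
have [e re he] := genf' x f Wx (rf x Ux) Zf0.
have [e' re' he'] := genf x f' Ux (rf' x Wx) Zf'0.
exists e; split=> //; last by apply: filterS he => y ->; rewrite mulrC.
apply/eqP => ex.
pose d : X -> K := 1 - e * e'.
have rd : reg x d by exact: regularB (regular1 x) (regularM re re').
have dx : d x != 0.
  by rewrite -[d x]/(1 - e x * e' x) ex mul0r subr0 oner_neq0.
have fd : \forall y \near x, f y = 0.
  apply: filterS3 he he' (regular_neq0 rd dx) => y h1 h2 dy.
  apply: (mulIf dy); rewrite mul0r -[d y]/(1 - e y * e' y) mulrBr mulr1.
  by rewrite [e y * _]mulrC mulrA -h2 -h1 subrr.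
have : nbhs x (U `&` [set y | f y = 0]) by exact: filterI nU fd.
rewrite nbhsE => -[B [oB Bx] hB].
have [y [By nZy]] := divisor_dense oB Bx.
by have [Uy fy] := hB y By; apply: nZy; apply/(Zf y Uy).
Qed.

(** The element g b(s) f^s. *)
Definition multiple_of_one (U : set X) f (b : {poly K}) (g : X -> K) :
    nat -> X -> K :=
  fun j => g * extend0 (off_zeros U f) (fun=> b`_j).

(** The g with g b(s) f^s in S form an ideal without common zeros on an affine set, so 1 is among
    them. *)
Lemma functional_equation_glue U f b : affine U ->
  (forall S, Ds_submodule U f S ->
    S (fun j => if j is 0%N then extend0 (off_zeros U f) f else 0) ->
    forall x, U x -> exists q, [/\ regular_on U q, q x != 0 &
      S (multiple_of_one U f b q)]) ->
  functional_equation U f b.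
Proof.
move=> [n [phi c]] hq S hS Sf.
have [[S0 Slin] Smul _ _] := hS.
have [JD JM] : (forall u v, S u -> S v -> S (u + v)) /\ True.
  by split=> // u v Su Sv; have := Slin 1 u v Su Sv; rewrite scale1r.
have off0 y (a : K) : ~ U y -> extend0 (off_zeros U f) (fun=> a) y = 0.
  by move=> nUy; apply: extend0_out => -[].
have -> : (fun j => extend0 (off_zeros U f) (fun=> b`_j)) =
    multiple_of_one U f b 1.
  by apply/funext => j; rewrite /multiple_of_one mul1r.
apply: (regular_ideal c (J := [set g | S (multiple_of_one U f b g)])) => /=.
- move=> g h Sg Sh; have := JD _ _ Sg Sh; congr (S _).
  by apply/funext => j; rewrite /multiple_of_one mulrDl.
- move=> g h rg Sh; have := Smul _ _ rg Sh; congr (S _).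
  by apply/funext => j; rewrite /multiple_of_one mulrA.
- move=> g h gh; congr (S _); apply/funext => j; apply/funext => y.
  rewrite /multiple_of_one !mulrfctE; have [Uy|nUy] := pselect (U y).
    by rewrite gh.
  by rewrite off0 // !mulr0.
- by move=> x Ux; have [q [rq qx Sq]] := hq S hS Sf x Ux; exists q.
- by move: S0; congr (S _); apply/funext => j; rewrite /multiple_of_one mul0r.
Qed.

Section Local.
Variables (U W : set X) (f f' : X -> K) (x0 : X).
Hypothesis affU : affine U.
Hypothesis oW : open W.
Hypotheses (Ux0 : U x0) (Wx0 : W x0).
Hypotheses (eqf : equation Z U f) (eqf' : equation Z W f').

Definition supported (u : nat -> X -> K) := forall j y,
  (off_zeros W f' y -> reg y (u j)) /\ (~ off_zeros W f' y -> u j y = 0).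

Lemma open_off_zeros : open (off_zeros W f').
Proof. by apply: open_regular_neq0 => //; case: eqf'. Qed.

(** A submodule S over U is turned into one over W: the u of which some bump multiple is in S. As f
    = e f', identifying u f'^s with u f^s respects functions and s, but the actions of derivations
    differ by the term s theta(e) / e, which has to be corrected. *)
Lemma functional_equation_near b S : functional_equation W f' b ->
  Ds_submodule U f S ->
  S (fun j => if j is 0%N then extend0 (off_zeros U f) f else 0) ->
  exists q, [/\ regular_on U q, q x0 != 0 & S (multiple_of_one U f b q)].
Proof.
move=> hb hS Sf; have [n [phi chartU]] := affU.
have oU := chart_open_self chartU.
have [[S0 Slin] Smul Sder Ssh] := hS.
have [e [re ex he]] := equation_unit oU oW Ux0 Wx0 eqf eqf'.
have [rf _ _] := eqf; have [rf' _ _] := eqf'.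
have nW := open_nbhs_nbhs (conj oW Wx0).
pose A := W `&` [set y | [/\ reg y e, e y != 0 &
  \forall z \near y, f z = e z * f' z]].
have nA : nbhs x0 A.
  apply: filterI nW _.
  apply: filterS3 (regular_near re) (regular_neq0 re ex)
    (nbhs_interior he) => y h1 h2 h3; split=> //.
have bump_mul h : reg x0 h -> exists2 q, bump_fun U x0 A q & regular_on U (q * h).
  exact: (bump_denominator chartU Ux0 nA).
have [q1 bq1 _] := bump_mul 1 (regular1 x0).
have bmul q r : bump_fun U x0 A q -> bump_fun U x0 A r -> bump_fun U x0 A (q * r).
  by move=> bq [rr rx _]; apply: bumpM.
have Smul2 q u : bump_fun U x0 A q -> S u -> S (fun j => q * u j).
  by move=> [rq _ _] Su; apply: Smul.
pose S' u := supported u /\ exists2 q, bump_fun U x0 A q & S (fun j => q * u j).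
have offA y : A y -> (off_zeros U f y -> off_zeros W f' y) /\
    (U y -> off_zeros W f' y -> off_zeros U f y).
  move=> [Wy [_ ey /nbhs_singleton fy]]; split=> [[Uy]|Uy [_ f'y]].
    by rewrite fy mulf_eq0 negb_or => /andP[_].
  by split=> //; rewrite fy mulf_neq0.
have hS' : Ds_submodule W f' S'.
  split.
  - split.
      split; first by move=> j y; split=> // _; apply: regular0.
      exists q1 => //; move: S0; congr (S _).
      by apply/funext => j; rewrite mulr0.
    move=> a u v [su [q bq Su]] [sv [r br Sv]]; split.
      move=> j y; have [u1 u0] := su j y; have [v1 v0] := sv j y.
      split=> hy; first by apply: regularD (regularZ a (u1 hy)) (v1 hy).
      by rewrite -[LHS]/(a * u j y + v j y) u0 // v0 // mulr0 addr0.
    exists (q * r); first exact: bmul.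
    have := Slin a _ _ (Smul2 r _ br Su) (Smul2 q _ bq Sv).
    congr (S _); apply/funext => j; apply/funext => y.
    rewrite -[LHS]/(a * (r y * (q y * u j y)) + q y * (r y * v j y)).
    by rewrite -[RHS]/(q y * r y * (a * u j y + v j y)); ring.
  - move=> g u rg [su [q bq Su]]; split.
      move=> j y; have [u1 u0] := su j y; split=> hy.
        by apply: regularM (u1 hy); apply: rg; case: hy.
      by rewrite mulrfctE u0 // mulr0.
    have [r br rr] := bump_mul g (rg _ Wx0).
    exists (q * r); first exact: bmul.
    have := Smul _ _ rr Su; congr (S _); apply/funext => j; apply/funext => y.
    rewrite -[LHS]/(r y * g y * (q y * u j y)).
    by rewrite -[RHS]/(q y * r y * (g y * u j y)); ring.
  - move=> theta u dtheta [su [q0 bq0 Su]].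
    split.
      move=> j y; split=> hy; last first.
        rewrite addrfctE extend0_out // add0r.
        case: j => [//|j]; have [_ u0] := su j y; by rewrite u0 ?mulr0.
      have [Wy f'y] := hy; apply: regularD.
        apply: (regular_near_eq (g := theta (u j))).
          by apply: (derivation_regular dtheta) => //; have [u1 _] := su j y; apply: u1.
        apply: filterS (open_nbhs_nbhs (conj open_off_zeros hy)) => z hz.
        by rewrite extend0_in.
      case: j => [|j]; first exact: regular0.
      apply: regularM; last by have [u1 _] := su j y; apply: u1.
      apply: regular_div => //; last exact: rf'.
      by apply: (derivation_regular dtheta) => //; apply: rf'.
    have [q [theta' [bq dtheta' thE]]] := bump_derivation chartU Ux0 dtheta nW nA.
    have {}bq : bump_fun U x0 A q.
      by case: bq => h1 h2 h3; split=> // y /h3[Uy []].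
    have rthe : reg x0 (fun y => theta e y / e y).
      by apply: regular_div => //; apply: (derivation_regular dtheta).
    have [q2 bq2 rq2] := bump_mul _ rthe.
    have [rq0 _ supp0] := bq0; have [rq _ suppq] := bq; have [rq2' _ _] := bq2.
    exists (q * q * (q0 * q0) * q2); first by do !apply: (bmul).
    pose v j := q0 * u j.
    (* [Sa] comes from theta' acting on q0 u. Subtracting [Sb], the Leibniz term in theta'(q0), and
       [Sc], the term s theta(e) / e, leaves a bump multiple of theta acting on u f'^s; the factor
       q2 makes theta(e) / e regular on U. *)
    have Sa := Smul2 _ _ (bmul _ _ bq (bmul _ _ bq0 bq2)) (Sder _ _ dtheta' Su).
    have rthq0 : regular_on U (q * q2 * theta' q0).
      move=> y Uy; apply: regularM; first by apply: regularM; [apply: rq|apply: rq2'].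
      by apply: (derivation_regular dtheta') => //; apply: rq0.
    have Sb := Smul _ _ rthq0 Su.
    have rk : regular_on U (q * q * q0 * (q2 * (fun y => theta e y / e y))).
      move=> y Uy; apply: regularM; last exact: rq2.
      by apply: regularM; [apply: regularM; apply: rq|apply: rq0].
    have Sc := Smul _ _ rk (Ssh _ Su).
    have := Slin (-1) _ _ Sc (Slin (-1) _ _ Sb Sa).
    congr (S _); apply/funext => j; apply/funext => y.
    pose prev (w : nat -> K) := if j is j'.+1 then w j' else 0.
    have prevE (w : nat -> X -> K) :
        (if j is j'.+1 then w j' else 0) y = prev (fun j' => w j' y).
      by rewrite /prev; case: (j).
    rewrite -[RHS]/(q y * q y * (q0 y * q0 y) * q2 y *
      (extend0 (off_zeros W f') (theta (u j)) y + (if j is j'.+1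
        then (fun j' x => theta f' x / f' x * u j' x) j' else 0) y)).
    rewrite -[LHS]/(-1 * (q y * q y * q0 y * (q2 y * (theta e y / e y)) *
        (if j is j'.+1 then (fun j' => q0 * u j') j' else 0) y) +
      (-1 * (q y * q2 y * theta' q0 y * (q0 y * u j y)) +
       q y * (q0 y * q2 y) * (extend0 (off_zeros U f) (theta' (q0 * u j)) y +
        (if j is j'.+1
         then (fun j' x => theta' f x / f x * (q0 * u j') x) j' else 0) y))).
    rewrite !prevE.
    have [q0y|q0y] := eqVneq (q0 y) 0; first by rewrite q0y; ring.
    have [qy|qy] := eqVneq (q y) 0; first by rewrite qy; ring.
    have [Uy Ay] := suppq y qy; have [off1 off2] := offA y Ay.
    have [hy|hy] := pselect (off_zeros U f y); last first.
      have hy' : ~ off_zeros W f' y by move=> /(off2 Uy).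
      have u0 j' : u j' y = 0 by have [_] := su j' y; apply.
      rewrite !extend0_out // u0.
      rewrite /prev; case: (j) => [|j']; first by ring.
      by rewrite mulrfctE u0; ring.
    have hy' := off1 hy; rewrite !extend0_in //.
    have ru j' : reg y (u j') by have [+ _] := su j' y; apply.
    have [Wy [rey ey fef']] := Ay; have [_ f'y] := hy'.
    rewrite !thE //; last 3 first.
    - exact: rf.
    - by apply: regularM; [apply: rq0|apply: ru].
    - exact: rq0.
    rewrite (derivation_leibniz dtheta Wy (rq0 y Uy) (ru j)).
    have -> : theta f y = theta e y * f' y + e y * theta f' y.
      rewrite -(derivation_leibniz dtheta Wy rey (rf' y Wy)).
      by apply: (derivation_germ dtheta Wy (rf y Uy)); apply: filterS fef'.
    rewrite (nbhs_singleton fef') /prev; case: (j) => [|j'].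
      by ring.
    by rewrite !mulrfctE; field; rewrite ey f'y.
  - move=> u [su [q bq Su]]; split.
      move=> [|j] y; last exact: su.
      by split=> // _; apply: regular0.
    exists q => //; have := Ssh _ Su; congr (S _); apply/funext => -[|j] //.
    by rewrite mulr0.
have Sgen : S' (fun j => if j is 0%N then extend0 (off_zeros W f') f' else 0).
  split.
    move=> [|j] y; split=> hy //; last 2 first.
    - by rewrite extend0_out.
    - exact: regular0.
    apply: (regular_near_eq (g := f')); first by apply: rf'; case: hy.
    apply: filterS (open_nbhs_nbhs (conj open_off_zeros hy)) => z hz.
    by rewrite extend0_in.
  have [q bq rqe] := bump_mul _ (regularV re ex).
  exists q => //; have := Smul _ _ rqe Sf; congr (S _).
  apply/funext => -[|j]; apply/funext => y; last by rewrite !mulrfctE !mulr0.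
  rewrite !mulrfctE; have [->|qy] := eqVneq (q y) 0; first by rewrite !mul0r.
  have [_ _ /(_ y qy)[Uy Ay]] := bq; have [off1 off2] := offA y Ay.
  have [Wy [rey ey fef']] := Ay.
  have [hy|hy] := pselect (off_zeros U f y).
    rewrite !extend0_in //; last exact: off1.
    by rewrite (nbhs_singleton fef'); field.
  rewrite !extend0_out ?mulr0 // => /(off2 Uy) //.
have [_ [q bq Sq]] := hb _ hS' Sgen.
have [rq qx suppq] := bq.
exists q; split=> //; move: Sq; congr (S _); apply/funext => j; apply/funext => y.
rewrite /multiple_of_one !mulrfctE.
have [->|qy] := eqVneq (q y) 0; first by rewrite !mul0r.
have [Uy Ay] := suppq y qy; have [off1 off2] := offA y Ay.
have [hy|hy] := pselect (off_zeros U f y).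
  by rewrite !extend0_in //; apply: off1.
by rewrite !extend0_out // => /(off2 Uy).
Qed.

End Local.

Lemma functional_equation_local U f b : affine U -> equation Z U f ->
  (forall x, U x -> exists W f', [/\ affine W, W x, equation Z W f' &
    functional_equation W f' b]) ->
  functional_equation U f b.
Proof.
move=> affU eqf hloc; apply: functional_equation_glue => // S hS Sf x Ux.
have [W [f' [affW Wx eqf' hb]]] := hloc x Ux.
exact: (functional_equation_near affU (affine_is_open affW) Ux Wx eqf eqf' hb).
Qed.

End Gluing.

(** * The graph module as a module with operators *)

Definition linear_set {K : pzRingType} {W : lmodType K} (B : set W) : Prop :=
  B 0 /\ forall (a : K) u v, B u -> B v -> B (a *: u + v).

Section SubLmodule.
Variables (K : nzRingType) (W : lmodType K) (B : set W) (hB : linear_set B).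

Definition sub_pred : pred W := fun u => `[< B u >].

(* [hB] is a parameter because it provides the module structure below. *)
Definition sub_lmod of linear_set B : Type := {u : W | sub_pred u}.
Local Notation M := (sub_lmod hB).

HB.instance Definition _ := SubType.on M.
HB.instance Definition _ := [Choice of M by <:].

Lemma sub_pred_closed : subsemimod_closed sub_pred.
Proof.
have [B0 Blin] := hB.
split; first split.
- exact/asboolP.
- move=> u v /asboolP Bu /asboolP Bv; apply/asboolP.
  by rewrite -[u]scale1r; apply: Blin.
- move=> a u /asboolP Bu; apply/asboolP.
  by rewrite -[_ *: _]addr0; apply: Blin.
Qed.
HB.instance Definition _ :=
  GRing.SubChoice_isSubLmodule.Build K W sub_pred M sub_pred_closed.

Lemma sub_valP (u : M) : B (val u).
Proof. by apply/asboolP; exact: (valP u). Qed.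

Definition in_sub u (Bu : B u) : M := Sub u (asboolT Bu).

Lemma val_in_sub u (Bu : B u) : val (in_sub Bu) = u.
Proof. exact: SubK. Qed.

Lemma sub_lift (F : W -> W) : (forall u, B u -> B (F u)) ->
  (forall a u v, B u -> B v -> F (a *: u + v) = a *: F u + F v) ->
  exists G : {linear M -> M}, forall u, val (G u) = F (val u).
Proof.
move=> BF linF.
pose G u : M := in_sub (BF _ (sub_valP u)).
have valG u : val (G u) = F (val u) by rewrite val_in_sub.
have linG : linear G.
  move=> a u v; apply: val_inj.
  by rewrite !(valG, linearP) /= linF ?valG //; apply: sub_valP.
pose linGi := GRing.isLinear.Build K M M *:%R G linG.
pose Gl : {linear M -> M} := HB.pack_for {linear M -> M} G linGi.
by exists Gl.
Qed.

End SubLmodule.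

Section GraphModule.
Variables (R : realType) (X : variety R) (l : nat) (U : set X).
Variables (f : X -> R[i]) (beta : R[i]).
Hypotheses (oU : open U) (rf : regular_on U f).
Local Notation K := R[i].
Local Notation reg := (@regular_at R X).
Local Notation off := (off_zeros U f).
Local Notation W := (nat -> 'I_l -> X -> K).
Local Notation B := (@graph_module R X l U f).
Implicit Types (g h : X -> K) (w : W) (i : 'I_l) (j : nat) (y : X).

Lemma open_off : open off.
Proof. exact: open_regular_neq0. Qed.

Lemma off_nbhs y : off y -> nbhs y off.
Proof. by move=> hy; apply: open_nbhs_nbhs; split=> //; exact: open_off. Qed.

Lemma off_f_neq0 y : off y -> f y != 0. Proof. by case. Qed.

Lemma off_regular y g : regular_on U g -> off y -> reg y g.
Proof. by move=> rg [Uy _]; apply: rg. Qed.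

Lemma graph_linear : linear_set B.
Proof.
split.
  split; last by exists 0%N.
  by move=> j i; split=> // y _; apply: regular0.
move=> a u v [ru [m hm]] [rv [m' hm']]; split.
  move=> j i; have [u1 u0] := ru j i; have [v1 v0] := rv j i; split=> y hy.
    by apply: regularD (regularZ a (u1 y hy)) (v1 y hy).
  by rewrite -[LHS]/(a * u j i y + v j i y) u0 // v0 // mulr0 addr0.
exists (maxn m m') => j; rewrite geq_max => /andP[h1 h2].
by rewrite -[LHS]/(a *: u j + v j) hm // hm' // scaler0 addr0.
Qed.

Local Notation M := (sub_lmod graph_linear).

Lemma graph_act (F : W -> W) :
  (forall w j i y, B w -> off y -> reg y (F w j i)) ->
  (forall w j i y, B w -> ~ off y -> F w j i y = 0) ->
  (forall w m, (forall j, (m <= j)%N -> w j = 0) ->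
    forall j, (m.+1 <= j)%N -> F w j = 0) ->
  forall w, B w -> B (F w).
Proof.
move=> h1 h2 h3 w Bw; split.
  by move=> j i; split=> y hy; [apply: h1|apply: h2].
by have [_ [m hm]] := Bw; exists m.+1; apply: h3.
Qed.

Lemma graph_reg w j i y : B w -> off y -> reg y (w j i).
Proof. by move=> [rw _] hy; have [h _] := rw j i; apply: h. Qed.

Lemma graph_out w j i y : B w -> ~ off y -> w j i y = 0.
Proof. by move=> [rw _] hy; have [_] := rw j i; apply. Qed.

Lemma t_act_graph w : B w -> B (t_act f w).
Proof.
apply: graph_act => {}w => [j i y Bw hy|j i y Bw hy|m hm j mj].
- apply: regularB; first by apply: regularM (off_regular rf hy) (graph_reg _ _ Bw hy).
  by apply: regularM (regular_cst _ _) (graph_reg _ _ Bw hy).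
- by rewrite /t_act !(graph_out _ _ Bw hy) !mulr0 subrr.
- apply/funext => i; apply/funext => y; rewrite /t_act hm ?(ltnW mj) //.
  by rewrite hm ?mulr0 ?subrr // ltnW // ltnW.
Qed.

Lemma t_act_linear a u v : t_act f (a *: u + v) = a *: t_act f u + t_act f v :> W.
Proof.
apply/funext => j; apply/funext => i; apply/funext => y.
rewrite -[RHS]/(a * (f y * u j i y - j.+1%:R * u j.+1 i y) +
  (f y * v j i y - j.+1%:R * v j.+1 i y)).
rewrite -[LHS]/(f y * (a * u j i y + v j i y) -
  j.+1%:R * (a * u j.+1 i y + v j.+1 i y)); ring.
Qed.

Lemma dt_act_graph w : B w -> B (dt_act w).
Proof.
apply: graph_act => {}w => [[|j] i y Bw hy|[|j] i y Bw hy|m hm [|j] mj] //=.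
- exact: regular0.
- exact: graph_reg.
- exact: graph_out.
- exact: hm.
Qed.

Lemma dt_act_linear a u v : dt_act (a *: u + v) = a *: dt_act u + dt_act v :> W.
Proof. by apply/funext => -[|j] //=; rewrite -[RHS]/(a *: 0 + 0) scaler0 addr0. Qed.

Lemma fun_act_graph g w : regular_on U g -> B w -> B (fun j i => g * w j i).
Proof.
move=> rg; apply: (@graph_act (fun w j i => g * w j i)) => {}w.
- by move=> j i y Bw hy; apply: regularM (off_regular rg hy) (graph_reg _ _ Bw hy).
- by move=> j i y Bw hy; rewrite mulrfctE (graph_out _ _ Bw hy) mulr0.
- by move=> m hm j mj; apply/funext => i; rewrite hm ?(ltnW mj) // mulr0.
Qed.

Section Theta.
Variables (theta : (X -> K) -> X -> K) (dtheta : derivation_on U theta).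

Lemma derivation_off y g : off y -> reg y g -> reg y (extend0 off (theta g)).
Proof.
move=> hy rg; apply: (regular_near_eq (g := theta g)).
  by apply: (derivation_regular dtheta) => //; case: hy.
by apply: filterS (off_nbhs hy) => z hz; rewrite extend0_in.
Qed.

Lemma theta_act_graph w : B w -> B (theta_act U f beta theta w).
Proof.
apply: graph_act => {}w => [j i y Bw hy|j i y Bw hy|m hm j mj].
- have rth : reg y (theta f).
    by apply: (derivation_regular dtheta); [case: hy|apply: off_regular].
  apply: regularB.
    apply: regularD; first exact: derivation_off hy (graph_reg _ _ Bw hy).
    apply: regularM (graph_reg _ _ Bw hy); apply: regularM (regular_cst _ _) _.
    by apply: regular_div rth (off_regular rf hy) (off_f_neq0 hy).
  case: j => [|j]; first exact: regular0.
  by apply: regularM rth (graph_reg _ _ Bw hy).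
- rewrite /theta_act extend0_out // (graph_out _ _ Bw hy) mulr0 addr0 sub0r.
  by case: j => [|j]; rewrite ?(graph_out _ _ Bw hy) ?mulr0 oppr0.
- apply/funext => i; apply/funext => y; rewrite /theta_act.
  case: j mj => // j mj; rewrite (hm j mj) (hm j.+1 (ltnW mj)) !mulr0 subr0 addr0.
  have [hy|hy] := pselect (off y); last by rewrite extend0_out.
  by rewrite extend0_in // -[_ i]/(0 : X -> K) (deriv0 dtheta) //; case: hy.
Qed.

Lemma theta_act_linear a u v : B u -> B v ->
  theta_act U f beta theta (a *: u + v) =
  a *: theta_act U f beta theta u + theta_act U f beta theta v.
Proof.
move=> Bu Bv; apply/funext => j; apply/funext => i; apply/funext => y.
pose prev (w : W) := if j is j'.+1 then theta f y * w j' i y else 0.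
rewrite -[RHS]/(a * (extend0 off (theta (u j i)) y +
    i%:R * beta * (theta f y / f y) * u j i y - prev u) +
  (extend0 off (theta (v j i)) y +
    i%:R * beta * (theta f y / f y) * v j i y - prev v)).
rewrite -[LHS]/(extend0 off (theta (a *: u j i + v j i)) y +
    i%:R * beta * (theta f y / f y) * (a * u j i y + v j i y) - prev (a *: u + v)).
have -> : prev (a *: u + v) = a * prev u + prev v.
  rewrite /prev; case: (j) => [|j']; first by rewrite mulr0 addr0.
  by rewrite -[LHS]/(theta f y * (a * u j' i y + v j' i y)); ring.
have -> : extend0 off (theta (a *: u j i + v j i)) y =
    a * extend0 off (theta (u j i)) y + extend0 off (theta (v j i)) y.
  have [hy|hy] := pselect (off y); last by rewrite !extend0_out // mulr0 addr0.
  rewrite !extend0_in // (derivation_linear dtheta) //; first by case: hy.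
    exact: graph_reg.
  exact: graph_reg.
by ring.
Qed.

Lemma theta_t_act w : B w -> theta_act U f beta theta (t_act f w) =
  t_act f (theta_act U f beta theta w).
Proof.
move=> Bw; apply/funext => j; apply/funext => i; apply/funext => y.
have [hy|hy] := pselect (off y); last first.
  rewrite (graph_out _ _ (theta_act_graph (t_act_graph Bw)) hy).
  by rewrite (graph_out _ _ (t_act_graph (theta_act_graph Bw)) hy).
have [Uy fy] := hy.
rewrite /t_act /theta_act !extend0_in //.
have -> : theta (fun x => f x * w j i x - j.+1%:R * w j.+1 i x) y =
    theta f y * w j i y + f y * theta (w j i) y - j.+1%:R * theta (w j.+1 i) y.
  have rj j' : reg y (w j' i) by apply: graph_reg.
  have rfy := off_regular rf hy.
  have -> : (fun x => f x * w j i x - j.+1%:R * w j.+1 i x) =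
      (- j.+1%:R) *: w j.+1 i + f * w j i.
    apply/funext => z.
    by rewrite -[RHS]/(- j.+1%:R * w j.+1 i z + f z * w j i z) mulNr addrC.
  rewrite (derivation_linear dtheta) //; last exact: regularM.
  by rewrite (derivation_leibniz dtheta) //; ring.
by case: j => [|j]; field.
Qed.

Lemma theta_dt_act w : theta_act U f beta theta (dt_act w) =
  dt_act (theta_act U f beta theta w).
Proof.
apply/funext => -[|j]; apply/funext => i; apply/funext => y; rewrite /theta_act /=.
  rewrite mulr0 subr0 addr0.
  have [hy|hy] := pselect (off y); last by rewrite extend0_out.
  by rewrite extend0_in // -[_ i]/(0 : X -> K) (deriv0 dtheta) //; case: hy.
by case: j => [|j] //; rewrite mulr0.
Qed.

End Theta.

Lemma t_dt_act w : t_act f (dt_act w) = dt_act (t_act f w) - w.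
Proof.
apply/funext => -[|j]; apply/funext => i; apply/funext => y.
  by rewrite -[LHS]/(f y * 0 - 1%:R * w 0%N i y) -[RHS]/(0 - w 0%N i y); ring.
rewrite -[LHS]/(f y * w j i y - j.+2%:R * w j.+1 i y).
rewrite -[RHS]/(f y * w j i y - j.+1%:R * w j.+1 i y - w j.+1 i y).
by rewrite [j.+2%:R]mulrSr; ring.
Qed.

Lemma t_act_inj w : B w -> t_act f w = 0 -> w = 0.
Proof.
move=> Bw tw; have [_ [m hm]] := Bw.
suff h k j : (m <= j + k)%N -> w j = 0.
  by apply/funext => j; apply: (h m); apply: leq_addl.
elim: k j => [|k IHk] j; first by rewrite addn0; apply: hm.
rewrite addnS -addSn => /IHk wj.
apply/funext => i; apply/funext => y.
have [hy|hy] := pselect (off y); last exact: graph_out.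
have := congr1 (fun w : W => w j i y) tw; rewrite /t_act wj mulr0 subr0 => /eqP.
by rewrite mulf_eq0 (negPf (off_f_neq0 hy)) => /eqP.
Qed.

Definition mono j i g : W :=
  fun j' i' => if (j' == j) && (i' == i) then extend0 off g else 0.

Lemma mono_graph j i g : (forall y, off y -> reg y g) -> B (mono j i g).
Proof.
move=> rg; split.
  move=> j' i'; rewrite /mono; case: ifP => _; split=> y hy //.
  - apply: regular_near_eq (rg y hy) _.
    by apply: filterS (off_nbhs hy) => z hz; rewrite extend0_in.
  - by rewrite extend0_out.
  - exact: regular0.
exists j.+1 => j' jj'; apply/funext => i'; rewrite /mono.
by rewrite gtn_eqF.
Qed.

(** The top coefficient is divided by f, which lowers the order of what remains to be solved. *)
Lemma t_act_surj w : B w -> exists2 v, B v & t_act f v = w.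
Proof.
move=> Bw; have [_ [m hm]] := Bw.
have Blin := graph_linear.2.
elim: m w Bw hm => [|m IHm] w Bw hm.
  exists 0; first exact: graph_linear.1.
  have -> : w = 0 by apply/funext => j; apply: hm.
  apply/funext => j; apply/funext => i; apply/funext => y.
  by rewrite -[LHS]/(f y * 0 - j.+1%:R * 0) !mulr0 subrr.
pose v1 : W := fun j i => if j == m then extend0 off (fun y => w m i y / f y) else 0.
have Bv1 : B v1.
  split.
    move=> j i; rewrite /v1; case: ifP => _; split=> y hy //.
    - apply: (regular_near_eq (g := fun y => w m i y / f y)).
        apply: regular_div (graph_reg _ _ Bw hy) (off_regular rf hy) (off_f_neq0 hy).
      by apply: filterS (off_nbhs hy) => z hz; rewrite extend0_in.
    - by rewrite extend0_out.
    - exact: regular0.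
  by exists m.+1 => j mj; apply/funext => i; rewrite /v1 gtn_eqF.
have [|j mj|v Bv tv] := IHm (- 1 *: t_act f v1 + w).
- by apply: Blin => //; apply: t_act_graph.
- apply/funext => i; apply/funext => y.
  rewrite -[LHS]/(-1 * (f y * v1 j i y - j.+1%:R * v1 j.+1 i y) + w j i y).
  rewrite {2}/v1 gtn_eqF ?ltnS // mulr0 subr0 /v1; case: eqP => [->|/eqP jm].
    have [hy|hy] := pselect (off y).
      by rewrite extend0_in //; field; case: hy.
    by rewrite extend0_out // (graph_out _ _ Bw hy) mulr0 mulr0 addr0.
  by rewrite hm ?mulr0 ?addr0 // ltn_neqAle eq_sym jm.
exists (1 *: v + v1); first exact: Blin.
by rewrite t_act_linear tv scale1r scaleN1r addrC addNKr.
Qed.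

Definition toM w : M := insubd 0 w.

Lemma toMK w : B w -> val (toM w) = w.
Proof. by move=> Bw; rewrite val_insubd ifT //; apply/asboolP. Qed.

Lemma gm_graph (u : M) : B (val u). Proof. exact: sub_valP. Qed.

Lemma t_lift : exists G : {linear M -> M}, forall u, val (G u) = t_act f (val u).
Proof. by apply: sub_lift => [u /t_act_graph|a u v _ _]; [|exact: t_act_linear]. Qed.
Definition gm_t : {linear M -> M} := sval (cid t_lift).
Lemma val_gm_t u : val (gm_t u) = t_act f (val u).
Proof. exact: svalP (cid t_lift) u. Qed.

Lemma d_lift : exists G : {linear M -> M}, forall u, val (G u) = dt_act (val u).
Proof. by apply: sub_lift => [u /dt_act_graph|a u v _ _]; [|exact: dt_act_linear]. Qed.
Definition gm_d : {linear M -> M} := sval (cid d_lift).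
Lemma val_gm_d u : val (gm_d u) = dt_act (val u).
Proof. exact: svalP (cid d_lift) u. Qed.

Lemma gm_ti_ex (u : M) : exists v, gm_t v = u.
Proof.
have [v Bv tv] := t_act_surj (gm_graph u); exists (toM v).
by apply: val_inj; rewrite val_gm_t toMK.
Qed.
Definition gm_ti (u : M) : M := sval (cid (gm_ti_ex u)).

Lemma gm_tiK : cancel gm_ti gm_t.
Proof. by move=> u; apply: svalP (cid (gm_ti_ex u)). Qed.

Lemma gm_tK : cancel gm_t gm_ti.
Proof.
move=> u; apply/eqP; rewrite -subr_eq0; apply/eqP/val_inj.
apply: t_act_inj; first exact: gm_graph.
by rewrite -val_gm_t linearB /= gm_tiK subrr.
Qed.

Definition gm_ops : set {linear M -> M} := [set F : {linear M -> M} |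
  (exists2 g, regular_on U g & forall u, val (F u) = fun j i => g * val u j i) \/
  (exists2 theta, derivation_on U theta &
    forall u, val (F u) = theta_act U f beta theta (val u))].

Lemma fun_t_act g w : (fun j i => g * t_act f w j i) = t_act f (fun j i => g * w j i).
Proof.
apply/funext => j; apply/funext => i; apply/funext => y.
rewrite -[LHS]/(g y * (f y * w j i y - j.+1%:R * w j.+1 i y)).
by rewrite -[RHS]/(f y * (g y * w j i y) - j.+1%:R * (g y * w j.+1 i y)); ring.
Qed.

Definition graph_tmodule : tmodule R.
Proof.
refine (@TModule R M gm_t gm_d gm_ti gm_tK gm_tiK _ gm_ops _ _).
- move=> u; apply: val_inj.
  by rewrite linearB /= val_gm_t !val_gm_d val_gm_t t_dt_act.
- move=> F u [[g rg hF]|[theta dtheta hF]]; apply: val_inj.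
    by rewrite hF !val_gm_t hF fun_t_act.
  by rewrite hF !val_gm_t hF theta_t_act //; apply: gm_graph.
- move=> F u [[g rg hF]|[theta dtheta hF]]; apply: val_inj.
    rewrite hF !val_gm_d hF; apply/funext => -[|j] //=.
    by apply/funext => i; rewrite mulr0.
  by rewrite hF !val_gm_d hF theta_dt_act.
Defined.

End GraphModule.

(** * Calculus in the graph module *)

Section GraphTModule.
Variables (R : realType) (X : variety R) (l : nat) (U : set X).
Variables (f : X -> R[i]) (beta : R[i]).
Hypotheses (oU : open U) (rf : regular_on U f).
Local Notation K := R[i].
Local Notation reg := (@regular_at R X).
Local Notation off := (off_zeros U f).
Local Notation W := (nat -> 'I_l -> X -> K).
Local Notation B := (@graph_module R X l U f).
Local Notation GM := (graph_tmodule l beta oU rf).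
Local Notation T := (@tm_t R GM).
Local Notation D := (@tm_d R GM).
Local Notation Ti := (@tm_ti R GM).
Local Notation E := (@tm_e R GM).
Implicit Types (g h : X -> K) (w : W) (i : 'I_l) (j : nat) (y : X).
Implicit Types (u v : GM) (S : set GM).

Definition gval u : W := \val (u : sub_lmod (graph_linear l U f)).
Definition gmk w : GM := toM U f w.

Lemma gval_inj : injective gval. Proof. exact: val_inj. Qed.
Lemma gvalP u : B (gval u). Proof. exact: gm_graph. Qed.
Lemma gmkK w : B w -> gval (gmk w) = w. Proof. exact: toMK. Qed.

Lemma gval_is_linear : linear gval.
Proof. by move=> a u v; rewrite /gval linearP. Qed.

Lemma gval0 : gval 0 = 0. Proof. by []. Qed.
Lemma gvalB u v : gval (u - v) = gval u - gval v.
Proof. by rewrite -scaleN1r addrC gval_is_linear scaleN1r addrC. Qed.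
Lemma gvalD u v : gval (u + v) = gval u + gval v.
Proof. by rewrite -[u]scale1r gval_is_linear !scale1r. Qed.
Lemma gvalZ a u : gval (a *: u) = a *: gval u.
Proof. by rewrite -[a *: u]addr0 gval_is_linear gval0 addr0. Qed.
Lemma gval_sum (I : Type) (r : seq I) (F : I -> GM) :
  gval (\sum_(j <- r) F j) = \sum_(j <- r) gval (F j).
Proof. by elim/big_rec2: _ => // j w u _ <-; rewrite gvalD. Qed.

Lemma gval_t u : gval (T u) = t_act f (gval u).
Proof. exact: val_gm_t. Qed.
Lemma gval_d u : gval (D u) = dt_act (gval u).
Proof. exact: val_gm_d. Qed.
Lemma gval_e u : gval (E u) = dt_act (t_act f (gval u)).
Proof. by rewrite /tm_e gval_d gval_t. Qed.

Definition gfun g u : GM := gmk (fun j i => g * gval u j i).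
Definition gder theta u : GM := gmk (theta_act U f beta theta (gval u)).

Lemma gval_fun g u : regular_on U g -> gval (gfun g u) = fun j i => g * gval u j i.
Proof. by move=> rg; apply: gmkK; exact: fun_act_graph rg (gvalP u). Qed.

Lemma gval_der theta u : derivation_on U theta ->
  gval (gder theta u) = theta_act U f beta theta (gval u).
Proof. by move=> dt; apply: gmkK; apply: theta_act_graph => //; apply: gvalP. Qed.

Lemma gfun_ops g : regular_on U g ->
  exists2 F, @tm_ops R GM F & forall u, F u = gfun g u.
Proof.
move=> rg.
have [F hF] : exists F : {linear GM -> GM},
    forall u, gval (F u) = fun j i => g * gval u j i.
  apply: (@sub_lift _ _ _ (graph_linear l U f) (fun w j i => g * w j i)).
    by move=> w Bw; exact: fun_act_graph rg Bw.
  move=> a u v _ _.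
  apply/funext => j; apply/funext => i; apply/funext => y.
  rewrite -[LHS]/(g y * (a * u j i y + v j i y)).
  by rewrite -[RHS]/(a * (g y * u j i y) + g y * v j i y); ring.
exists F; first by left; exists g.
by move=> u; apply: gval_inj; rewrite hF gval_fun.
Qed.

Lemma gder_ops theta : derivation_on U theta ->
  exists2 F, @tm_ops R GM F & forall u, F u = gder theta u.
Proof.
move=> dtheta.
have [F hF] : exists F : {linear GM -> GM},
    forall u, gval (F u) = theta_act U f beta theta (gval u).
  apply: (@sub_lift _ _ _ (graph_linear l U f) (theta_act U f beta theta)).
    by move=> w Bw; apply: theta_act_graph.
  by move=> a u v Bu Bv; apply: theta_act_linear.
exists F; first by right; exists theta.
by move=> u; apply: gval_inj; rewrite hF gval_der.
Qed.

Lemma gproj_ex i : exists F : {linear GM -> GM},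
  forall u, gval (F u) = fun j i' => if i' == i then gval u j i' else 0.
Proof.
apply: (@sub_lift _ _ _ (graph_linear l U f)
  (fun w j i' => if i' == i then w j i' else 0)).
  move=> w [rw [m hm]]; split.
    move=> j i'; case: ifP => _; first exact: rw.
    by split=> // y _; apply: regular0.
  by exists m => j /hm wj; apply/funext => i'; rewrite wj; case: ifP.
move=> a u v _ _; apply/funext => j; apply/funext => i'; apply/funext => y.
rewrite -[LHS]/((if i' == i then (a *: u + v) j i' else 0) y).
rewrite -[RHS]/(a * (if i' == i then u j i' else 0) y +
  (if i' == i then v j i' else 0) y).
by case: ifP => // _; rewrite -[RHS]/(a * 0 + 0) mulr0 addr0.
Qed.

Lemma ops_cases F : @tm_ops R GM F ->
  (exists2 g, regular_on U g & forall u, F u = gfun g u) \/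
  (exists2 theta, derivation_on U theta & forall u, F u = gder theta u).
Proof.
case=> [[g rg hF]|[theta dt hF]]; [left; exists g|right; exists theta] => // u;
  apply: gval_inj.
- by rewrite gval_fun //; apply: hF.
- by rewrite gval_der //; apply: hF.
Qed.

Lemma graph_e_submodule S : S 0 ->
  (forall a u v, S u -> S v -> S (a *: u + v)) ->
  (forall g u, regular_on U g -> S u -> S (gfun g u)) ->
  (forall theta u, derivation_on U theta -> S u -> S (gder theta u)) ->
  (forall u, S u -> S (E u)) -> e_submodule S.
Proof.
move=> S0 Sl Sg St Se; split=> // F u /ops_cases[[g rg ->]|[theta dt ->]] Su.
  exact: Sg.
exact: St.
Qed.

Section SubmoduleOps.
Variables (S : set GM) (hS : e_submodule S).

Lemma es_fun g u : regular_on U g -> S u -> S (gfun g u).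
Proof. by move=> /gfun_ops[F hF <-]; apply: es_ops. Qed.

Lemma es_der theta u : derivation_on U theta -> S u -> S (gder theta u).
Proof. by move=> /gder_ops[F hF <-]; apply: es_ops. Qed.
End SubmoduleOps.

Definition off_regular_fun g : Prop := forall y, off y -> reg y g.

Lemma on_off_regular g : regular_on U g -> off_regular_fun g.
Proof. by move=> rg y hy; apply: off_regular hy. Qed.

Lemma off_regularM g h : off_regular_fun g -> off_regular_fun h ->
  off_regular_fun (g * h).
Proof. by move=> rg rh y hy; apply: regularM; [apply: rg|apply: rh]. Qed.

Lemma off_regularP a g h : off_regular_fun g -> off_regular_fun h ->
  off_regular_fun (a *: g + h).
Proof. by move=> rg rh y hy; apply: regularD; [apply: regularZ; apply: rg|apply: rh]. Qed.

Lemma off_regularV : off_regular_fun (fun y => (f y)^-1).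
Proof. by move=> y hy; apply: regularV; [apply: off_regular hy|case: hy]. Qed.

Lemma off_regular_der theta g : derivation_on U theta -> off_regular_fun g ->
  off_regular_fun (theta g).
Proof. by move=> dt rg y hy; apply: (derivation_regular dt); [case: hy|apply: rg]. Qed.

Lemma off_regularX g k : off_regular_fun g -> off_regular_fun (g ^+ k).
Proof. by move=> rg y hy; apply: regularX; apply: rg. Qed.

(** The element g y^i delta. *)
Definition gmono i g : GM := gmk (mono U f 0 i g).

Lemma gval_mono i g : off_regular_fun g -> gval (gmono i g) = mono U f 0 i g.
Proof. by move=> rg; apply: gmkK; apply: mono_graph. Qed.

Lemma gmono_ext i g h : (forall y, off y -> g y = h y) -> gmono i g = gmono i h.
Proof.
move=> gh; congr gmk; apply/funext => j; apply/funext => i'; rewrite /mono.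
case: ifP => // _; apply/funext => y.
have [hy|hy] := pselect (off y); first by rewrite !extend0_in // gh.
by rewrite !extend0_out.
Qed.

Lemma gmonoP i a g h : off_regular_fun g -> off_regular_fun h ->
  gmono i (a *: g + h) = a *: gmono i g + gmono i h.
Proof.
move=> rg rh; apply: gval_inj.
rewrite gval_is_linear !gval_mono //; last exact: off_regularP.
apply/funext => j; apply/funext => i'; apply/funext => y.
rewrite -[RHS]/(a * mono U f 0 i g j i' y + mono U f 0 i h j i' y) /mono.
case: ifP => _; last by rewrite -[RHS]/(a * 0 + 0) mulr0 addr0.
have [hy|hy] := pselect (off y); first by rewrite !extend0_in.
by rewrite !extend0_out // mulr0 addr0.
Qed.

Lemma off_regular0 : off_regular_fun 0.
Proof. by move=> y _; apply: regular0. Qed.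

Lemma off_regular1 : off_regular_fun 1.
Proof. by move=> y _; apply: regular1. Qed.

Lemma gmono0 i : gmono i 0 = 0.
Proof.
have := gmonoP i 1 off_regular0 off_regular0.
by rewrite scaler0 addr0 scale1r => /eqP; rewrite -subr_eq subrr eq_sym => /eqP.
Qed.

Lemma gmonoZ i a g : off_regular_fun g -> gmono i (a *: g) = a *: gmono i g.
Proof. by move=> rg; rewrite -[a *: g]addr0 gmonoP ?gmono0 ?addr0 //; apply: off_regular0. Qed.

Lemma gmonoD i g h : off_regular_fun g -> off_regular_fun h ->
  gmono i (g + h) = gmono i g + gmono i h.
Proof. by move=> rg rh; rewrite -[g in LHS]scale1r gmonoP // scale1r. Qed.

Lemma gmono_t i g : off_regular_fun g -> T (gmono i g) = gmono i (f * g).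
Proof.
move=> rg; apply: gval_inj; rewrite gval_t !gval_mono //; last first.
  by apply: off_regularM => //; apply: on_off_regular.
apply/funext => j; apply/funext => i'; apply/funext => y.
rewrite /t_act /mono /= mulr0 subr0; case: ifP => _; last by rewrite mulr0.
have [hy|hy] := pselect (off y); first by rewrite !extend0_in.
by rewrite !extend0_out // mulr0.
Qed.

Lemma gmono_ti i g : off_regular_fun g -> Ti (gmono i g) = gmono i (fun y => g y / f y).
Proof.
move=> rg; apply: (can_inj (@tm_tK R GM)); rewrite tm_tiK gmono_t.
  apply: gmono_ext => y [Uy fy]; rewrite mulrfctE; field; exact: fy.
exact: (off_regularM rg off_regularV).
Qed.

Lemma gfun_mono i g h : regular_on U g -> off_regular_fun h ->
  gfun g (gmono i h) = gmono i (g * h).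
Proof.
move=> rg rh; apply: gval_inj; rewrite gval_fun // !gval_mono //; last first.
  by apply: off_regularM => //; apply: on_off_regular.
apply/funext => j; apply/funext => i'; apply/funext => y.
rewrite mulrfctE /mono; case: ifP => _; last by rewrite mulr0.
have [hy|hy] := pselect (off y); first by rewrite !extend0_in.
by rewrite !extend0_out // mulr0.
Qed.

Local Notation bi i := (i%:R * beta).

(* [- E] acts as s on f^s; the shift by [bi i] accounts for the factor
   f^(i beta) of the [i]-th component. *)
Definition gs i u : GM := bi i *: u - E u.

Lemma gs_is_linear i : linear (gs i).
Proof.
move=> a u v; have eE : E (a *: u + v) = a *: E u + E v.
  exact: (tm_e_is_linear (M := GM)).
rewrite /gs eE !scalerDr !scalerA [a * _]mulrC.
by rewrite opprD scalerN addrACA.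
Qed.
HB.instance Definition _ i := GRing.isLinear.Build K GM GM *:%R (gs i) (gs_is_linear i).

(** The term - theta(f) g d_t delta equals - E applied to (theta(f) / f) g delta; together with the
    term in i beta it gives the action of s, so derivations act as on f^s. *)
Lemma gder_mono i theta g : derivation_on U theta -> off_regular_fun g ->
  gder theta (gmono i g) =
  gmono i (theta g) + gs i (gmono i (fun y => theta f y / f y * g y)).
Proof.
move=> dt rg.
have rtf : off_regular_fun (fun y => theta f y / f y * g y).
  apply: (off_regularM (off_regularM _ off_regularV) rg).
  exact: off_regular_der dt (on_off_regular rf).
have rtg := off_regular_der dt rg.
apply: gval_inj; rewrite gval_der // /gs gvalD gvalB gvalZ gval_e.
rewrite !gval_mono //; apply/funext => j; apply/funext => i'; apply/funext => y.
set k := fun y => theta f y / f y * g y.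
rewrite -[RHS]/(mono U f 0 i (theta g) j i' y + (bi i * mono U f 0 i k j i' y -
  dt_act (t_act f (mono U f 0 i k)) j i' y)) /theta_act.
have [hy|hy] := pselect (off y); last first.
  rewrite extend0_out // /mono; case: j => [|[|j]] /=; rewrite /t_act /=.
  - by case: ifP => _; rewrite ?extend0_out //; ring.
  - by case: ifP => _; rewrite ?extend0_out //; ring.
  - by ring.
have Uy : U y by case: hy.
have th0 : theta (0 : X -> K) y = 0 by rewrite (deriv0 dt).
rewrite extend0_in //; case: j => [|[|j]] /=; rewrite /mono /t_act /=.
- case: eqP => [->|_] /=; last by rewrite th0; ring.
  have -> : theta (extend0 off g) y = theta g y.
    apply/esym/(derivation_germ dt Uy); first exact: rg.
    by apply: filterS (off_nbhs oU rf hy) => z hz; rewrite extend0_in.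
  by rewrite !extend0_in // /k; ring.
- rewrite th0; case: ifP => _; last by ring.
  by rewrite !extend0_in // /k; field; case: hy.
- by rewrite th0; ring.
Qed.

End GraphTModule.

Opaque graph_tmodule.
Arguments graph_tmodule {R X} l {U f} beta oU rf : simpl never.

(** * Translation of V-filtrations between the two encodings *)

Section Transport.
Variables (R : realType) (X : variety R) (l : nat) (U : set X).
Variables (f : X -> R[i]) (beta : R[i]).
Hypotheses (oU : open U) (rf : regular_on U f).
Local Notation K := R[i].
Local Notation W := (nat -> 'I_l -> X -> K).
Local Notation B := (@graph_module R X l U f).
Local Notation GM := (graph_tmodule l beta oU rf).
Local Notation T := (@tm_t R GM).
Local Notation D := (@tm_d R GM).
Local Notation Ti := (@tm_ti R GM).
Local Notation E := (@tm_e R GM).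
Local Notation pe := (op_poly E).
Implicit Types (g h : X -> K) (w : W) (i : 'I_l) (j : nat) (y : X).
Implicit Types (u v : GM) (S : set GM).
Local Notation gval := (@gval R X l U f beta oU rf).
Local Notation gmk := (@gmk R X l U f beta oU rf).
Local Notation gfun := (@gfun R X l U f beta oU rf).
Local Notation gder := (@gder R X l U f beta oU rf).

Lemma gval_surj w : B w -> exists u, gval u = w.
Proof. by move=> Bw; exists (gmk w); apply: gmkK. Qed.

Lemma v0_preimage (S : set W) : V0D_submodule U f beta S ->
  v0_submodule (M := GM) [set u | S (gval u)].
Proof.
move=> [[S0 Slin] Sg Sth St Sdt]; split; last first.
  by move=> u /= Su; rewrite gval_t; apply: St.
apply: graph_e_submodule => /=.
- by rewrite gval0.
- by move=> a u v Su Sv; rewrite gval_is_linear; apply: Slin.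
- by move=> g u rg Su; rewrite gval_fun //; apply: (Sg g (gval u)).
- by move=> theta u dt Su; rewrite gval_der //; apply: Sth.
- by move=> u Su; rewrite gval_e; apply: Sdt.
Qed.

Lemma v0_image S : v0_submodule S -> V0D_submodule U f beta (gval @` S).
Proof.
move=> hS; split.
- split; first by exists 0; [exact: (es0 hS)|rewrite gval0].
  move=> a _ _ [u Su <-] [v Sv <-]; exists (a *: u + v); first exact: (esP hS).
  by rewrite gval_is_linear.
- move=> g _ rg [u Su <-]; exists (gfun g u); first exact: (es_fun hS).
  by rewrite gval_fun.
- move=> theta _ dt [u Su <-]; exists (gder theta u); first exact: (es_der hS).
  by rewrite gval_der.
- by move=> _ [u Su <-]; exists (T u); [exact: (vs_t hS)|rewrite gval_t].
- by move=> _ [u Su <-]; exists (E u); [exact: (es_e hS)|rewrite gval_e].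
Qed.

Lemma gval_nilpotent c m u :
  iter m (fun w : W => dt_act (t_act f w) - c *: w) (gval u) =
  gval (pe (('X - c%:P) ^+ m) u).
Proof.
elim: m => [|m IHm] /=; first by rewrite expr0 (op_poly1 E).
rewrite IHm exprS (op_polyM E) -gval_e -gvalZ -gvalB; congr gval.
by rewrite (op_polyD E) (op_polyN E) (op_polyC E) (op_polyX E).
Qed.

Lemma v_filtration_of (V : R -> set W) : V_filtration U f beta V ->
  v_filtration (M := GM) (fun c => [set u | V c (gval u)]).
Proof.
move=> hV.
have VB c w : V c w -> B w by move=> Vw; rewrite -(V_exhaustive hV); exists c.
split.
- by move=> c; apply: v0_preimage; apply: (V_submodule hV).
- move=> c; have [n [e [Ve genV]]] := V_fingen hV c.
  exists n, (fun k => gmk (e k)); split.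
    by move=> k /=; rewrite gmkK //; apply: VB (Ve k).
  move=> S hS Se u /= Vu.
  have [k|v Sv /gval_inj <- //] := genV _ (v0_image hS) _ _ Vu.
  by exists (gmk (e k)) => //; rewrite gmkK //; apply: VB (Ve k).
- by move=> c c' cc' u; apply: (V_decreasing hV).
- move=> u; have : B (gval u) by apply: gvalP.
  by rewrite -(V_exhaustive hV) => -[c _ Vu]; exists c.
- move=> c; have [e e0 [h1 h2]] := V_discrete hV c; exists e => //.
  split=> c' hc'; first by rewrite h1.
  by rewrite h2.
- by move=> c u Vu /=; rewrite gval_t; apply: (V_t hV); exists (gval u).
- move=> c u c0 /=; rewrite -(V_t_eq hV) // => -[w Vw tw].
  have [v vw] := gval_surj (VB _ _ Vw).
  have -> : u = T v by apply: gval_inj; rewrite gval_t vw.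
  by have /= -> := @tm_tK R GM v; rewrite vw.
- by move=> c u Vu /=; rewrite gval_d; apply: (V_dt hV); exists (gval u).
- move=> c; have [m hm] := V_nilpotent hV c; exists m => u /hm.
  by rewrite gval_nilpotent => -[c' cc' Vc']; exists c'.
Qed.

Lemma V_filtration_of (V : R -> set GM) : v_filtration V ->
  V_filtration U f beta (fun c => gval @` V c).
Proof.
move=> hV; split.
- by move=> c; apply: v0_image; apply: av_sub.
- move=> c; have [n [e [Ve genV]]] := av_fingen hV c.
  exists n, (fun k => gval (e k)); split; first by move=> k; exists (e k).
  move=> S hS Se _ [u Vu <-]; exact: (genV _ (v0_preimage hS) Se u Vu).
- by move=> c c' cc' _ [u Vu <-]; exists u => //; apply: (av_dec hV) Vu.
- apply/seteqP; split=> [w [c _ [u _ <-]]|w Bw]; first exact: gvalP.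
  have [u uw] := gval_surj Bw; have [c Vc] := av_exh hV u.
  by exists c => //; exists u.
- move=> c; have [e e0 [h1 h2]] := av_disc hV c; exists e => //.
  split=> c' hc'; first by rewrite h1.
  rewrite h2 //; apply/seteqP; split=> [_ [u [c2 cc2 Vu] <-]|_ [c2 cc2 [u Vu <-]]].
    by exists c2 => //; exists u.
  by exists u => //; exists c2.
- move=> c _ [_ [u Vu <-] <-]; exists (T u); last by rewrite gval_t.
  exact: (av_t hV).
- move=> c c0; apply/seteqP; split.
    move=> _ [_ [u Vu <-] <-]; exists (T u); last by rewrite gval_t.
    exact: (av_t hV).
  move=> _ [u Vu <-]; exists (gval (Ti u)).
    by exists (Ti u) => //; apply: (av_ti hV).
  by rewrite -gval_t tm_tiK.
- move=> c _ [_ [u Vu <-] <-]; exists (D u); last by rewrite gval_d.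
  exact: (av_d hV).
- move=> c; have [m hm] := av_nil hV c; exists m => _ [u Vu <-].
  have [c' cc' Vc'] := hm u Vu; exists c' => //.
  by rewrite gval_nilpotent; exists (pe (('X - c%:C%C%:P) ^+ m) u).
Qed.

End Transport.

(** * From functional equations to the graph module *)

Section Transfer.
Variables (R : realType) (X : variety R) (l : nat) (U : set X).
Variables (f : X -> R[i]) (beta : R[i]).
Hypotheses (oU : open U) (rf : regular_on U f).
Local Notation K := R[i].
Local Notation off := (off_zeros U f).
Local Notation W := (nat -> 'I_l -> X -> K).
Local Notation B := (@graph_module R X l U f).
Local Notation GM := (graph_tmodule l beta oU rf).
Local Notation T := (@tm_t R GM).
Local Notation D := (@tm_d R GM).
Local Notation E := (@tm_e R GM).
Local Notation pe := (op_poly E).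
Implicit Types (g h : X -> K) (w : W) (i : 'I_l) (j : nat) (y : X).
Implicit Types (u v : GM) (S : set GM).
Local Notation gval := (@gval R X l U f beta oU rf).
Local Notation gmk := (@gmk R X l U f beta oU rf).
Local Notation gfun := (@gfun R X l U f beta oU rf).
Local Notation gder := (@gder R X l U f beta oU rf).
Local Notation gmono := (@gmono R X l U f beta oU rf).
Local Notation gs := (@gs R X l U f beta oU rf).
Local Notation bi i := (i%:R * beta).

Definition gbounded m u : Prop := forall j, (m <= j)%N -> gval u j = 0.

Lemma gbounded_ex u : exists m, gbounded m u.
Proof. by have [_ [m hm]] := gvalP u; exists m. Qed.

Lemma gval_off_regular u j i : off_regular_fun U f (gval u j i).
Proof. by move=> y hy; apply: graph_reg (gvalP u) hy. Qed.

Lemma graph_ind (P : GM -> Prop) : P 0 -> (forall u v, P u -> P v -> P (u + v)) ->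
  (forall u, P u -> P (D u)) ->
  (forall i g, off_regular_fun U f g -> P (gmono i g)) -> forall u, P u.
Proof.
move=> P0 PD Pd Pm u; have [m] := gbounded_ex u.
elim: m u => [|m IHm] u hm.
  by rewrite (_ : u = 0) //; apply: gval_inj; rewrite gval0; apply/funext => j;
    apply: hm.
have Bw : B (fun j => gval u j.+1).
  have [ru [m' hm']] := gvalP u; split; first by move=> j i; apply: ru.
  by exists m' => j mj; apply: hm'; apply: leqW.
pose u' := gmk (fun j => gval u j.+1).
have -> : u = \sum_i gmono i (gval u 0 i) + D u'.
  apply: gval_inj; rewrite gvalD gval_sum gval_d gmkK //.
  apply/funext => j; apply/funext => i; apply/funext => y.
  rewrite -[RHS]/((\sum_i0 gval (gmono i0 (gval u 0 i0))) j i y + _).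
  have -> : (\sum_i0 gval (gmono i0 (gval u 0 i0))) j i y =
      \sum_i0 gval (gmono i0 (gval u 0 i0)) j i y.
    by elim/big_rec2: _ => // i0 _ w _ <-.
  rewrite (bigD1 i) //= big1 => [|i0 i0i]; last first.
    rewrite gval_mono; last exact: gval_off_regular.
    by rewrite /mono [i == i0]eq_sym (negPf i0i) andbF.
  rewrite gval_mono; last exact: gval_off_regular.
  rewrite /mono eqxx andbT; case: j => [|j] /=; last by rewrite !add0r.
  rewrite !addr0; have [hy|hy] := pselect (off y); first by rewrite extend0_in.
  by rewrite extend0_out // (graph_out _ _ (gvalP u) hy).
apply: (PD).
  elim/big_rec: _ => // i v _ Pv; apply: (PD) => //; apply: Pm.
  exact: gval_off_regular.
by apply: Pd; apply: IHm => j mj; rewrite gmkK //; apply: hm.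
Qed.

(** With [I] a single index this is the lattice of one summand y^i; with all indices it is the
    lattice for the whole of pi_+ O_W, on which the V-filtration is defined. *)
Definition gspan (I : set 'I_l) : set GM :=
  e_span [set u | exists2 i, I i & u = gmono i 1].

Lemma gspan_mono (I : set 'I_l) i g : I i -> regular_on U g -> gspan I (gmono i g).
Proof.
move=> Ii rg; rewrite -[g]mulr1 -gfun_mono //; last exact: off_regular1.
apply: (es_fun (e_submodule_span _)) => //.
by apply: sub_e_span; exists i.
Qed.

Lemma gspan_v0 I : v0_submodule (gspan I).
Proof.
apply: v0_submodule_span => u [i Ii ->].
rewrite gmono_t ?mulr1; last exact: off_regular1.
exact: gspan_mono.
Qed.

Lemma gspan_sub (I : set 'I_l) S : e_submodule S -> (forall i, I i -> S (gmono i 1)) ->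
  gspan I `<=` S.
Proof. by move=> hS SI; apply: e_span_sub => // u [i Ii ->]; apply: SI. Qed.

Lemma pole_bound g : affine U -> off_regular_fun U f g ->
  exists N h, regular_on U h /\ forall y, off y -> f y ^+ N * g y = h y.
Proof.
move=> [n [phi c]] rg.
have [G hG] := regular_is_poly c rf.
have [|N [P hP]] := regular_off_denominator c (G := G) (h := g).
  by move=> x Ux Gx; apply: rg; split=> //; rewrite hG.
exists N, (fun y => mpoly.meval (coords phi y) P); split.
  exact: (regular_ev c).
by move=> y [Uy fy]; rewrite hG // hP // -hG.
Qed.

Lemma gspan_exhaust : affine U -> forall u, exists k, gspan setT (iter k T u).
Proof.
move=> affU; have v0N := gspan_v0 setT.
have itD k u v : iter k T (u + v) = iter k T u + iter k T v.
  by have := iter_linear_sub T k 1 u v; rewrite !scale1r.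
have up k k' u : gspan setT (iter k T u) -> gspan setT (iter (k' + k) T u).
  by move=> Nu; rewrite iterD; exact: (v0_iter k' v0N Nu).
apply: graph_ind.
- by exists 0%N; apply: (es0 v0N).
- move=> u v [k Nu] [k' Nv]; exists (k + k')%N; rewrite itD.
  by apply: (esD v0N); [rewrite addnC|]; apply: up.
- move=> u [k Nu]; exists k.+1; rewrite iterSr.
  (* t d_t = E - 1, so one further power of t absorbs d_t. *)
  have -> : T (D u) = E u - u by exact: (@tm_td R GM u).
  rewrite -[- u]scaleN1r addrC iter_linear_sub; apply: (esP v0N) => //.
  exact: (es_e (v0_submodule_t k v0N)).
- move=> i g rg; have [N [h [rh hE]]] := pole_bound affU rg.
  exists N.
  have -> : iter N T (gmono i g) = gmono i (f ^+ N * g).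
    elim: (N) => [|n IHn] /=; first by rewrite expr0 mul1r.
    rewrite IHn gmono_t ?exprS ?mulrA //.
    by apply: off_regularM => //; apply: off_regularX; apply: on_off_regular.
  rewrite (_ : gmono i (f ^+ N * g) = gmono i h); first exact: gspan_mono.
  apply: gmono_ext => y hy; rewrite -hE // mulrfctE; congr (_ * _).
  by elim: (N) => [|n IHn]; rewrite ?expr0 // !exprS mulrfctE IHn.
Qed.

(** The image of the sum of the v_j s^j f^s when s acts as [gs i] and f^s becomes y^i delta. It is
    cut off at m because sequences in a [Ds_submodule] may be infinite. *)
Definition gPhi m i (v : nat -> X -> K) : GM :=
  \sum_(j < m) iter j (gs i) (gmono i (v j)).

Definition fin_seq m (v : nat -> X -> K) : Prop :=
  (forall j, off_regular_fun U f (v j)) /\ forall j, (m <= j)%N -> v j = 0.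

Lemma fin_seq_le m m' (v : nat -> X -> K) : (m <= m')%N -> fin_seq m v -> fin_seq m' v.
Proof. by move=> mm [rv v0]; split=> // j mj; apply: v0; apply: leq_trans mj. Qed.

Lemma iter_gs0 i k : iter k (gs i) 0 = 0.
Proof. by elim: k => //= k ->; rewrite linear0. Qed.

Lemma gPhi_widen m m' i (v : nat -> X -> K) : (m <= m')%N -> fin_seq m v -> gPhi m' i v = gPhi m i v.
Proof.
move=> /subnKC <- [rv v0]; rewrite /gPhi big_split_ord /=.
rewrite [X in _ + X]big1 ?addr0 // => j _.
by rewrite v0 ?leq_addr // gmono0 iter_gs0.
Qed.

Lemma fin_seqP m a (u v : nat -> X -> K) : fin_seq m u -> fin_seq m v -> fin_seq m (a *: u + v).
Proof.
move=> [ru u0] [rv v0]; split=> j; first exact: off_regularP (ru j) (rv j).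
by move=> mj; rewrite -[LHS]/(a *: u j + v j) u0 // v0 // scaler0 addr0.
Qed.

Lemma gPhiP m i a (u v : nat -> X -> K) : fin_seq m u -> fin_seq m v ->
  gPhi m i (a *: u + v) = a *: gPhi m i u + gPhi m i v.
Proof.
move=> [ru _] [rv _]; rewrite /gPhi scaler_sumr -big_split; apply: eq_bigr => j _ /=.
rewrite -[(a *: u + v) j]/(a *: u j + v j) gmonoP //.
exact: (iter_linear_sub (gs i)).
Qed.

Definition shift_seq (v : nat -> X -> K) : nat -> X -> K :=
  fun j => if j is j'.+1 then v j' else 0.

Lemma fin_seq_shift m (v : nat -> X -> K) : fin_seq m v -> fin_seq m.+1 (shift_seq v).
Proof.
move=> [rv v0]; split=> -[|j] //=; first exact: off_regular0.
by move=> mj; apply: v0.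
Qed.

Lemma gPhi_shift m i (v : nat -> X -> K) : gPhi m.+1 i (shift_seq v) = gs i (gPhi m i v).
Proof.
rewrite /gPhi big_ord_recl /= gmono0 add0r linear_sum.
by apply: eq_bigr => j _.
Qed.

Lemma gs_ops i F u : @tm_ops R GM F -> F (gs i u) = gs i (F u).
Proof.
move=> hF; rewrite /gs linearB linearZ /=; congr (_ - _).
exact: (@tm_opse R GM F u hF).
Qed.

Lemma iter_gs_ops i F u k : @tm_ops R GM F -> F (iter k (gs i) u) = iter k (gs i) (F u).
Proof. by move=> hF; elim: k => //= k <-; rewrite gs_ops. Qed.

Lemma fin_seq_fun m g (v : nat -> X -> K) : regular_on U g -> fin_seq m v ->
  fin_seq m (fun j => g * v j).
Proof.
move=> rg [rv v0]; split=> j; last by move=> mj; rewrite v0 // mulr0.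
by apply: off_regularM => //; apply: on_off_regular.
Qed.

Lemma gPhi_fun m i g (v : nat -> X -> K) : regular_on U g -> fin_seq m v ->
  gPhi m i (fun j => g * v j) = gfun g (gPhi m i v).
Proof.
move=> rg [rv _]; have [F hF FE] := gfun_ops l beta oU rf rg.
rewrite -FE /gPhi linear_sum; apply: eq_bigr => j _ /=.
by rewrite iter_gs_ops // FE gfun_mono.
Qed.

Lemma fin_seq_der m theta (v : nat -> X -> K) : derivation_on U theta -> fin_seq m v ->
  fin_seq m (fun j => if (j < m)%N then theta (v j) else 0) /\
  fin_seq m (fun j y => theta f y / f y * v j y).
Proof.
move=> dt [rv v0]; split.
  split=> j; last by rewrite ltnNge => ->.
  by case: ifP => _; [exact: off_regular_der dt (rv j)|exact: off_regular0].
split=> j.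
  apply: (off_regularM (off_regularM _ (off_regularV rf)) (rv j)).
  exact: off_regular_der dt (on_off_regular rf).
by move=> mj; apply/funext => y; rewrite v0 // mulr0.
Qed.

Lemma gPhi_der m i theta (v : nat -> X -> K) : derivation_on U theta -> fin_seq m v ->
  gder theta (gPhi m i v) =
  gPhi m i (fun j => if (j < m)%N then theta (v j) else 0) +
  gs i (gPhi m i (fun j y => theta f y / f y * v j y)).
Proof.
move=> dt [rv _]; have [F hF FE] := gder_ops l beta oU rf dt.
rewrite -FE /gPhi !linear_sum -big_split; apply: eq_bigr => j _ /=.
rewrite iter_gs_ops // FE gder_mono // ltn_ord.
rewrite -[gs i (iter j _ _)]iterS iterSr.
by have := iter_linear_sub (gs i) j 1 (gmono i (theta (v j)))
  (gs i (gmono i (fun y => theta f y / f y * v j y))); rewrite !scale1r.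
Qed.

Definition theta_seq (theta : (X -> K) -> X -> K) (v : nat -> X -> K) :
    nat -> X -> K :=
  fun j => extend0 off (theta (v j)) +
    (if j is j'.+1 then (fun x => theta f x / f x * v j' x) else 0).

Lemma gPhi_theta m i theta (v : nat -> X -> K) :
  derivation_on U theta -> fin_seq m v -> fin_seq m.+1 (theta_seq theta v) /\
  gPhi m.+1 i (theta_seq theta v) = gder theta (gPhi m i v).
Proof.
move=> dt fv; have [f1 f2] := fin_seq_der dt fv.
(* theta(0) is known to vanish on U only, so the tail is set to zero by hand. *)
pose v1 j := if (j < m)%N then theta (v j) else 0.
pose v2 j y := theta f y / f y * v j y.
have fsum : fin_seq m.+1 (1 *: v1 + shift_seq v2).
  by apply: fin_seqP; [exact: fin_seq_le f1|exact: fin_seq_shift].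
have v3E j y : off y -> theta_seq theta v j y = (1 *: v1 + shift_seq v2) j y.
  move=> hy; rewrite -[LHS]/(extend0 off (theta (v j)) y + shift_seq v2 j y).
  rewrite -[RHS]/(1 * v1 j y + shift_seq v2 j y) mul1r extend0_in //.
  rewrite /v1; case: ifPn => //; rewrite -leqNgt => mj.
  by have [_ ->] := fv; rewrite // (deriv0 dt) //; case: hy.
split.
  split=> j.
    move=> y hy; apply: regular_near_eq (fsum.1 j y hy) _.
    by apply: filterS (off_nbhs oU rf hy) => z hz; rewrite -v3E.
  move=> mj; apply/funext => y; have [hy|hy] := pselect (off y).
    by have /(congr1 (@^~ y)) := fsum.2 j mj; rewrite -v3E.
  rewrite -[LHS]/(extend0 off (theta (v j)) y + shift_seq v2 j y).
  rewrite extend0_out // add0r; case: j mj => // j mj /=.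
  by rewrite /v2; have [_ ->] := fv; rewrite ?mulr0.
have -> : gPhi m.+1 i (theta_seq theta v) = gPhi m.+1 i (1 *: v1 + shift_seq v2).
  by apply: eq_bigr => j _; congr (iter j _ _); apply: gmono_ext => y /v3E.
rewrite gPhiP; last 2 first.
- exact: fin_seq_le f1.
- exact: fin_seq_shift.
by rewrite gPhi_shift (gPhi_widen _ (leqnSn m) f1) scale1r -gPhi_der.
Qed.

Lemma gs_submodule i S u : e_submodule S -> S u -> S (gs i u).
Proof.
move=> hS Su; rewrite /gs addrC -scaleN1r; apply: (esP hS); first exact: (es_e hS).
exact: (esZ hS).
Qed.

Definition coef_seq (b : {poly K}) : nat -> X -> K :=
  fun j => extend0 off (fun=> b`_j).

Lemma fin_seq_coef (b : {poly K}) : fin_seq (size b) (coef_seq b).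
Proof.
split=> j.
  move=> y hy; apply: regular_near_eq (regular_cst y b`_j) _.
  by apply: filterS (off_nbhs oU rf hy) => z hz; rewrite /coef_seq extend0_in.
move=> mj; apply/funext => y; rewrite /coef_seq nth_default //.
have [hy|hy] := pselect (off y); first by rewrite extend0_in.
by rewrite extend0_out.
Qed.

Lemma gPhi_coef i (b : {poly K}) : gPhi (size b) i (coef_seq b) = op_poly (gs i) b (gmono i 1).
Proof.
apply: eq_bigr => j _.
have -> : gmono i (coef_seq b j) = b`_j *: gmono i 1.
  rewrite -gmonoZ; last exact: off_regular1.
  apply: gmono_ext => y hy; rewrite /coef_seq extend0_in //.
  by rewrite -[RHS]/(b`_j * 1) mulr1.
have itZ k (a : K) u : iter k (gs i) (a *: u) = a *: iter k (gs i) u.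
  by elim: k => //= k ->; rewrite linearZ.
exact: itZ.
Qed.

(** The finite sequences whose image under [gPhi] is in S form a [Ds_submodule], to which the
    functional equation applies. *)
Lemma functional_transfer b S i : functional_equation U f b -> e_submodule S ->
  S (gmono i f) -> S (op_poly (gs i) b (gmono i 1)).
Proof.
move=> hb hS Sf.
pose S' (v : nat -> X -> K) := exists m, fin_seq m v /\ S (gPhi m i v).
have hS' : Ds_submodule U f S'.
  split.
  - split; first by exists 0%N; rewrite /gPhi big_ord0; split=> //; [split=> j //;
      exact: off_regular0|exact: (es0 hS)].
    move=> a u v [m [fu Su]] [m' [fv Sv]]; exists (maxn m m').
    have fu' := fin_seq_le (leq_maxl m m') fu.
    have fv' := fin_seq_le (leq_maxr m m') fv.
    split; first exact: fin_seqP.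
    rewrite gPhiP // (gPhi_widen _ (leq_maxl m m') fu).
    by rewrite (gPhi_widen _ (leq_maxr m m') fv); apply: (esP hS).
  - move=> g v rg [m [fv Sv]]; exists m; split; first exact: fin_seq_fun.
    by rewrite gPhi_fun //; apply: (es_fun hS).
  - move=> theta v dt [m [fv Sv]]; exists m.+1.
    have [fth hth] := gPhi_theta i dt fv; split=> //.
    by rewrite -/(theta_seq theta v) hth; apply: (es_der hS).
  - move=> v [m [fv Sv]]; exists m.+1; split; first exact: fin_seq_shift.
    by rewrite gPhi_shift; apply: gs_submodule.
have [|m [fb Sb]] := hb S' hS'.
  exists 1%N; split.
    split=> -[|j] //; last exact: off_regular0.
    move=> y hy; apply: (regular_near_eq (g := f)); first exact: off_regular hy.
    by apply: filterS (off_nbhs oU rf hy) => z hz; rewrite extend0_in.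
  rewrite /gPhi big_ord1 /= (_ : gmono i (extend0 off f) = gmono i f) //.
  by apply: gmono_ext => y hy; rewrite extend0_in.
rewrite -gPhi_coef; have fc := fin_seq_coef b.
rewrite -(gPhi_widen _ (leq_maxr m (size b)) fc).
by rewrite (gPhi_widen _ (leq_maxl m (size b)) fb).
Qed.

Lemma gs_poly i p u : op_poly (gs i) p u = pe (p \Po ((bi i)%:P - 'X)) u.
Proof.
elim/poly_ind: p u => [|p c IHp] u; first by rewrite comp_poly0 !op_poly0.
rewrite comp_polyD comp_polyM comp_polyX comp_polyC !op_polyD !op_polyC.
rewrite op_polyMX IHp op_polyM; congr (pe _ _ + _).
by rewrite op_polyD op_polyN op_polyC op_polyX.
Qed.

End Transfer.

(** * Twisted derivatives *)

Section RisingPolynomial.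
Variable K : comNzRingType.

Definition rising_poly (c : K) k : {poly K} :=
  \prod_(m < k) ('X + (c + m%:R)%:P).

Lemma rising_polyS c k :
  rising_poly c k.+1 = ('X + c%:P) * rising_poly (c + 1) k.
Proof.
rewrite /rising_poly big_ord_recl /= addr0; congr (_ * _).
by apply: eq_bigr => m _; rewrite /bump /= natrD addrA.
Qed.

Lemma rising_polySr c k :
  rising_poly c k.+1 = rising_poly c k * ('X + (c + k%:R)%:P).
Proof. by rewrite /rising_poly big_ord_recr. Qed.

Lemma rising_poly_shift c a k :
  rising_poly c k \Po ('X + a%:P) = rising_poly (c + a) k.
Proof.
rewrite /rising_poly rmorph_prod; apply: eq_bigr => m _ /=.
rewrite comp_polyD comp_polyX comp_polyC -addrA -polyCD.
by congr (_ + _%:P); rewrite addrCA addrA.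
Qed.

(** A Chu-Vandermonde identity. Pascal's rule pairs the terms of the sum for k + 1 so that they
    differ by the factors X + a + i and X + i; the difference of these is a, which leaves a times
    the sum for k and a + 1. *)
Lemma rising_poly_vandermonde k (a : K) :
  \sum_(i < k.+1) ((-1) ^+ i * 'C(k, i)%:R) *:
    (rising_poly 0 i * rising_poly (a + i%:R) (k - i)) =
  (\prod_(m < k) (a + m%:R))%:P.
Proof.
elim: k a => [|k IHk] a.
  rewrite big_ord1 /= bin0 expr0 mulr1 scale1r addr0.
  by rewrite /rising_poly !big_ord0 mulr1.
pose t (b : nat) i := ((-1) ^+ i * b%:R) *:
    (rising_poly 0 i * rising_poly (a + i%:R) (k.+1 - i)).
have step (i : 'I_k.+1) : t 'C(k, i) i +
    ((-1) ^+ i.+1 * 'C(k, i)%:R) *: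
      (rising_poly 0 i.+1 * rising_poly (a + i.+1%:R) (k - i)) =
    a *: (((-1) ^+ i * 'C(k, i)%:R) *:
    (rising_poly 0 i * rising_poly (a + 1 + i%:R) (k - i))).
  rewrite /t subSn ?leq_ord // rising_polyS rising_polySr add0r.
  have -> : a + i.+1%:R = a + 1 + i%:R by rewrite mulrSr; ring.
  have -> : a + i%:R + 1 = a + 1 + i%:R by ring.
  rewrite exprS -!mul_polyC !polyCM !polyCD polyCN polyC1; ring.
transitivity (\sum_(i < k.+1) a *: (((-1) ^+ i * 'C(k, i)%:R) *:
    (rising_poly 0 i * rising_poly (a + 1 + i%:R) (k - i)))); last first.
  rewrite -scaler_sumr IHk big_ord_recl addr0 -mul_polyC -polyCM.
  congr (_ * _)%:P; apply: eq_bigr => m _.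
  by rewrite /bump /= natrD addrA.
rewrite -(eq_bigr _ (fun i _ => step i)) big_split /=.
rewrite big_ord_recl /= [in RHS]big_ord_recl /= /t !bin0 -addrA; congr (_ + _).
have -> : \sum_(i < k) ((-1) ^+ bump 0 i * 'C(k, bump 0 i)%:R) *:
    (rising_poly 0 (bump 0 i) * rising_poly (a + (bump 0 i)%:R) (k.+1 - bump 0 i)) =
  \sum_(i < k.+1) ((-1) ^+ bump 0 i * 'C(k, bump 0 i)%:R) *:
    (rising_poly 0 (bump 0 i) * rising_poly (a + (bump 0 i)%:R) (k.+1 - bump 0 i)).
  rewrite [RHS]big_ord_recr /= [X in _ = _ + X](_ : _ = 0) ?addr0 //.
  by rewrite /bump /= bin_small // mulr0 scale0r.
rewrite -big_split /=; apply: eq_bigr => i _.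
by rewrite /bump /= add1n subSS -scalerDl -mulrDr -natrD.
Qed.

End RisingPolynomial.

Section TwistedDerivative.
Variables (R : realType) (M : tmodule R) (c : R[i]).
Local Notation T := (@tm_t R M).
Local Notation D := (@tm_d R M).
Local Notation Ti := (@tm_ti R M).
Local Notation E := (@tm_e R M).
Local Notation pe := (op_poly E).
Implicit Types (u v : M) (p : {poly R[i]}).

(** Formally t^(-c) d_t t^c. For c = - i beta it is the twisted derivative of the summand y^i. *)
Definition tm_dc u := D u + c *: Ti u.

Lemma tm_dc_is_linear : linear tm_dc.
Proof.
move=> a u v; rewrite /tm_dc !linearP /= !scalerDr !scalerA [a * c]mulrC.
by rewrite addrACA.
Qed.
HB.instance Definition _ := GRing.isLinear.Build _ M M *:%R tm_dc tm_dc_is_linear.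

Lemma tm_dcE u : tm_dc u = pe ('X + c%:P) (Ti u).
Proof. by rewrite /tm_dc tm_dE op_polyD op_polyX op_polyC. Qed.

Lemma tm_dc_e u : tm_dc (E u) = E (tm_dc u) + 1 *: tm_dc u.
Proof.
rewrite !tm_dcE tm_tie linearD /= scale1r; congr (_ + _).
by rewrite -op_poly_comm.
Qed.

Lemma tm_dc_ops F u : tm_ops F -> F (tm_dc u) = tm_dc (F u).
Proof. by move=> hF; rewrite /tm_dc linearD linearZ /= tm_opsd // ops_ti. Qed.

Lemma iter_tm_dc_ops F k u : tm_ops F -> F (iter k tm_dc u) = iter k tm_dc (F u).
Proof. by move=> hF; elim: k => //= k <-; rewrite tm_dc_ops. Qed.

Lemma tm_dc_t u : tm_dc (T u) = E u + c *: u.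
Proof. by rewrite /tm_dc tm_tK. Qed.

Lemma iter_tm_dc_poly k p u :
  iter k tm_dc (pe p u) = pe (p \Po ('X + (k%:R)%:P)) (iter k tm_dc u).
Proof.
elim: k => [|k IHk] /=; first by rewrite addr0 comp_polyXr.
rewrite IHk (@op_poly_shift _ _ E tm_dc 1); last by move=> v /=; rewrite tm_dc_e.
by rewrite comp_poly_shift mulrSr.
Qed.

(** Normal form: a polynomial in E after a power of t^(-1). Relations between d_t, its twist and
    t^(-1) thus become polynomial identities. *)
Lemma iter_tm_dcE k u : iter k tm_dc u = pe (rising_poly c k) (iter k Ti u).
Proof.
elim: k u => [|k IHk] u; first by rewrite /rising_poly big_ord0 op_poly1.
rewrite iterS IHk tm_dcE tm_ti_poly -op_polyM rising_poly_shift.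
by rewrite rising_polyS.
Qed.

Lemma iter_ti_tm_dc m k u : iter m Ti (iter k tm_dc u) =
  pe (rising_poly (c + m%:R) k) (iter (m + k) Ti u).
Proof. by rewrite iter_tm_dcE iter_tm_ti_poly rising_poly_shift iterD. Qed.

Lemma e_submodule_dc (S : set M) k : e_submodule S ->
  e_submodule [set u | S (iter k tm_dc u)].
Proof.
move=> hS; split=> /=.
- by rewrite iter_fix ?linear0 //; apply: (es0 hS).
- by move=> a u v Su Sv; rewrite iter_linear_sub; apply: (esP hS).
- by move=> F u hF Su; rewrite -iter_tm_dc_ops //; apply: (es_ops hS).
- by move=> u Su; rewrite -op_polyX iter_tm_dc_poly; apply: (es_poly hS).
Qed.

Lemma v_can_mono (N N' : set M) a : N `<=` N' -> v_can N a `<=` v_can N' a.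
Proof. by move=> NN u hu m; have [q hq Nq] := hu m; exists q => //; apply: NN. Qed.

End TwistedDerivative.

Lemma iter_tm_dE (R : realType) (M : tmodule R) k (u : M) :
  iter k (@tm_d R M) u = op_poly (@tm_e R M) (rising_poly 0 k) (iter k (@tm_ti R M) u).
Proof.
rewrite -iter_tm_dcE; apply: eq_iter => v.
by rewrite /tm_dc scale0r addr0.
Qed.

(** * The summand f^beta: Hodge filtration and functional equations *)

Section HodgeComputation.
Variables (R : realType) (X : variety R) (l : nat) (U : set X).
Variables (f : X -> R[i]) (beta : R[i]).
Hypotheses (oU : open U) (rf : regular_on U f).
Local Notation K := R[i].
Local Notation off := (off_zeros U f).
Local Notation W := (nat -> 'I_l -> X -> K).
Local Notation B := (@graph_module R X l U f).
Local Notation GM := (graph_tmodule l beta oU rf).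
Local Notation T := (@tm_t R GM).
Local Notation D := (@tm_d R GM).
Local Notation Ti := (@tm_ti R GM).
Local Notation E := (@tm_e R GM).
Local Notation pe := (op_poly E).
Local Notation gval := (@gval R X l U f beta oU rf).
Local Notation gfun := (@gfun R X l U f beta oU rf).
Local Notation gder := (@gder R X l U f beta oU rf).
Local Notation gmono := (@gmono R X l U f beta oU rf).
Local Notation bi i := (i%:R * beta).
Local Notation gspan := (@gspan R X l U f beta oU rf).
Local Notation gs := (@gs R X l U f beta oU rf).
Local Notation gbounded := (@gbounded R X l U f beta oU rf).
Local Notation gPhi := (@gPhi R X l U f beta oU rf).
Local Notation gmk := (@gmk R X l U f beta oU rf).
Local Notation dc i := (@tm_dc R GM (- (bi i))).
Implicit Types (g h : X -> K) (w : W) (i : 'I_l) (j : nat) (y : X).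
Implicit Types (u v : GM) (S : set GM).

Definition gproj i : {linear GM -> GM} := sval (cid (gproj_ex beta oU rf i)).

Lemma gval_proj i u :
  gval (gproj i u) = fun j i' => if i' == i then gval u j i' else 0.
Proof. exact: svalP (cid (gproj_ex beta oU rf i)) u. Qed.

Lemma gproj_t i u : gproj i (T u) = T (gproj i u).
Proof.
apply: gval_inj; rewrite gval_t !gval_proj gval_t.
apply/funext => j; apply/funext => i'; apply/funext => y; rewrite /t_act.
by case: ifP => // _; rewrite !mulr0 subrr.
Qed.

Lemma gproj_d i u : gproj i (D u) = D (gproj i u).
Proof.
apply: gval_inj; rewrite gval_d !gval_proj gval_d.
by apply/funext => -[|j] //=; apply/funext => i'; case: ifP.
Qed.

Lemma gproj_ti i u : gproj i (Ti u) = Ti (gproj i u).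
Proof.
apply: (can_inj (@tm_tK R GM)); rewrite -gproj_t.
by rewrite !(@tm_tiK R GM).
Qed.

Lemma gproj_e i u : gproj i (E u) = E (gproj i u).
Proof. by rewrite /tm_e gproj_d gproj_t. Qed.

Lemma gproj_poly i p u : gproj i (pe p u) = pe p (gproj i u).
Proof. by apply: op_poly_comm => v; apply: gproj_e. Qed.

Lemma gproj_iter_ti i k u : gproj i (iter k Ti u) = iter k Ti (gproj i u).
Proof. by elim: k => //= k <-; rewrite gproj_ti. Qed.

Lemma gproj_fun i g u : regular_on U g -> gproj i (gfun g u) = gfun g (gproj i u).
Proof.
move=> rg; apply: gval_inj; rewrite gval_fun // !gval_proj gval_fun //.
by apply/funext => j; apply/funext => i'; case: ifP; rewrite ?mulr0.
Qed.

Lemma gproj_der i theta u : derivation_on U theta ->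
  gproj i (gder theta u) = gder theta (gproj i u).
Proof.
move=> dt; apply: gval_inj; rewrite gval_der // !gval_proj gval_der //.
apply/funext => j; apply/funext => i'; apply/funext => y; rewrite /theta_act.
case: ifP => // _; rewrite mulr0 addr0.
have -> : extend0 off (theta 0) y = 0.
  have [hy|hy] := pselect (off y); last by rewrite extend0_out.
  by rewrite extend0_in // (deriv0 dt) //; case: hy.
by case: j => [|j]; rewrite ?mulr0 subr0.
Qed.

Lemma gproj_mono i i' g : off_regular_fun U f g ->
  gproj i (gmono i' g) = if i' == i then gmono i' g else 0.
Proof.
move=> rg; apply: gval_inj; rewrite gval_proj gval_mono //.
case: (eqVneq i' i) => [->|ii'].
  rewrite gval_mono //; apply/funext => j; apply/funext => i2; rewrite /mono.
  by case: (eqVneq i2 i) => // _; rewrite andbF.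
rewrite gval0; apply/funext => j; apply/funext => i2; rewrite /mono.
case: (eqVneq i2 i) => // ->.
by rewrite [i == i']eq_sym (negPf ii') andbF.
Qed.

Lemma e_submodule_proj i S : e_submodule S -> e_submodule [set u | S (gproj i u)].
Proof.
move=> hS; apply: graph_e_submodule => /=.
- by rewrite linear0; apply: (es0 hS).
- by move=> a u v Su Sv; rewrite linearP; apply: (esP hS).
- by move=> g u rg Su; rewrite gproj_fun //; apply: (es_fun hS).
- by move=> theta u dt Su; rewrite gproj_der //; apply: (es_der hS).
- by move=> u Su; rewrite gproj_e; apply: (es_e hS).
Qed.

Lemma gspan_proj i u : gspan setT u -> gspan [set i] (gproj i u).
Proof.
have es_i := vs_es (gspan_v0 beta oU rf [set i]).
apply: (gspan_sub (e_submodule_proj i es_i)) => i' _ /=.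
rewrite gproj_mono; last exact: off_regular1.
case: eqVneq => [->|_]; last exact: (es0 es_i).
by apply: gspan_mono => // y _; apply: regular1.
Qed.

Lemma v_can_proj i c u : v_can (gspan setT) c u -> v_can (gspan [set i]) c (gproj i u).
Proof.
move=> hu m; have [q hq Nq] := hu m; exists q => //.
by rewrite -gproj_poly -gproj_iter_ti; apply: gspan_proj.
Qed.

Lemma gspan_subset (I J : set 'I_l) : I `<=` J -> gspan I `<=` gspan J.
Proof.
move=> IJ; apply: gspan_sub; first exact: (vs_es (gspan_v0 beta oU rf J)).
by move=> i /IJ Ji; apply: gspan_mono => // y _; apply: regular1.
Qed.

Definition real_roots (b : {poly K}) : Prop :=
  forall z, root b z -> exists x : R, z = x%:C%C.

Lemma real_roots_bounds b : b != 0 -> real_roots b -> exists c0 c1 : R,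
  roots_in (ge_re c0) b /\ roots_in (fun z => z <= c1%:C%C) b.
Proof.
move=> b0 hb; have [r defb] := closed_field_poly_normal b.
pose c := \sum_(z <- r) `|complex.Re z|.
have rootr z : root b z -> exists2 x : R, z = x%:C%C & `|x| <= c.
  move=> rz; have [x zx] := hb z rz; exists x => //.
  have : z \in r.
    by move: rz; rewrite defb rootZ ?lead_coef_eq0 // root_prod_XsubC.
  rewrite /c => /(big_rem z) -> /=; rewrite {1}zx /= lerDl.
  by apply: sumr_ge0.
exists (- c), c; split=> z /rootr[x -> hx].
  by rewrite /ge_re lecR lerNl (le_trans _ hx) // -normrN ler_norm.
by rewrite lecR (le_trans (ler_norm _)).
Qed.

Lemma root_comp_sub (p : {poly K}) c z : root (p \Po (c%:P - 'X)) z = root p (c - z).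
Proof. by rewrite rootE horner_comp !hornerE -rootE. Qed.

Lemma comp_sub_neq0 (p : {poly K}) c : p != 0 -> p \Po (c%:P - 'X) != 0.
Proof.
apply: contra => /eqP p0; apply/eqP.
have : (p \Po (c%:P - 'X)) \Po (c%:P - 'X) = p.
  rewrite -comp_polyA -[RHS]comp_polyXr; congr (_ \Po _).
  by rewrite comp_polyB comp_polyX comp_polyC; ring.
by rewrite p0 comp_poly0.
Qed.

(** f y^i delta = t y^i delta lies in t N, so the functional equation puts b(s) y^i delta into t
    N. *)
Lemma gspan_bernstein b i (I : set 'I_l) : I i -> functional_equation U f b ->
  gspan I (Ti (pe (b \Po ((bi i)%:P - 'X)) (gmono i 1))).
Proof.
move=> Ii hb; rewrite -gs_poly.
apply: (functional_transfer hb (S := [set u | gspan I (Ti u)])).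
  exact: (e_submodule_ti (gspan_v0 beta oU rf I) 1).
change (gspan I (Ti (gmono i f))).
have -> : gmono i f = T (gmono i 1).
  by rewrite gmono_t ?mulr1 //; apply: off_regular1.
have -> : Ti (T (gmono i 1)) = gmono i 1 by exact: (@tm_tK R GM).
by apply: gspan_mono => // y _; exact: regular1.
Qed.

Lemma graph_v_can_filtration b (b' : R) : affine U -> beta = b'%:C%C ->
  b != 0 -> real_roots b -> functional_equation U f b ->
  v_filtration (v_can (gspan setT)).
Proof.
move=> affU betaE b0 hb fb.
pose bb (i : 'I_l) := b \Po ((bi i)%:P - 'X).
(* s = i beta - E depends on the component; the product over all components is a b-function for the
   whole lattice. *)
pose P := \prod_i bb i.
have P0 : P != 0 by apply/prodf_neq0 => i _; apply: comp_sub_neq0.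
have Preal : real_roots P.
  move=> z; rewrite /P rootE horner_prod prodf_seq_eq0 => /hasP[i _ /=].
  rewrite -rootE root_comp_sub betaE => /hb[x zx].
  exists (i%:R * b' - x).
  have -> : z = i%:R * b'%:C%C - x%:C%C by rewrite -zx; ring.
  by rewrite rmorphB rmorphM rmorph_nat.
have [c0 [c1 [Pge Ple]]] := real_roots_bounds P0 Preal.
have v0N : v0_submodule (gspan setT) by apply: gspan_v0.
apply: (v_can_filtration v0N (e := fun i => gmono i 1) _ _ _ Pge Ple).
- by move=> i; apply: gspan_mono => // y _; apply: regular1.
- move=> S hS Se; apply: gspan_sub => // i _; exact: Se.
- exact: gspan_exhaust.
- have es1 := e_submodule_ti v0N 1.
  apply: (gspan_sub (e_submodule_poly es1 P)) => i _.
  change (gspan setT (Ti (pe P (gmono i 1)))).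
  rewrite /P (bigD1 i) // (op_polyMC E); apply: (es_poly es1).
  exact: gspan_bernstein.
Qed.

Lemma gbounded_le m m' u : (m <= m')%N -> gbounded m u -> gbounded m' u.
Proof. by move=> mm hu j mj; apply: hu; apply: leq_trans mj. Qed.

Lemma gbounded0 m : gbounded m 0.
Proof. by move=> j _; rewrite gval0. Qed.

Lemma gboundedP m a u v : gbounded m u -> gbounded m v -> gbounded m (a *: u + v).
Proof.
move=> hu hv j mj; rewrite gval_is_linear.
by rewrite -[LHS]/(a *: gval u j + gval v j) hu // hv // scaler0 addr0.
Qed.

Lemma gboundedD m u v : gbounded m u -> gbounded m v -> gbounded m (u + v).
Proof. by move=> hu hv; rewrite -[u]scale1r; apply: gboundedP. Qed.

Lemma gboundedZ m a u : gbounded m u -> gbounded m (a *: u).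
Proof. by move=> hu; rewrite -[_ *: _]addr0; apply: gboundedP => //; apply: gbounded0. Qed.

Lemma gbounded_eq0 u : gbounded 0 u -> u = 0.
Proof. by move=> hu; apply: gval_inj; apply/funext => j; rewrite hu. Qed.

Lemma gbounded_t m u : gbounded m u -> gbounded m (T u).
Proof.
move=> hu j mj; rewrite gval_t; apply/funext => i; apply/funext => y.
by rewrite /t_act hu // hu ?(leqW mj) // !mulr0 subrr.
Qed.

Lemma gbounded_ti m u : gbounded m u -> gbounded m (Ti u).
Proof.
move=> hu; have [m' hm'] := gbounded_ex (Ti u).
suff h k j : (m <= j)%N -> (m' <= j + k)%N -> gval (Ti u) j = 0.
  by move=> j mj; apply: (h m') => //; apply: leq_addl.
elim: k j => [|k IHk] j mj; first by rewrite addn0; apply: hm'.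
rewrite addnS -addSn => /(IHk _ (leqW mj)) z0.
apply/funext => i; apply/funext => y.
have [hy|hy] := pselect (off y); last by rewrite (graph_out _ _ (gvalP _) hy).
have : t_act f (gval (Ti u)) j i y = 0.
  have TTi : T (Ti u) = u by exact: (@tm_tiK R GM).
  by rewrite -gval_t TTi hu.
rewrite /t_act z0 mulr0 subr0 => /eqP; rewrite mulf_eq0.
by case: hy => _ /negPf -> /eqP.
Qed.

Lemma gbounded_d m u : gbounded m u -> gbounded m.+1 (D u).
Proof. by move=> hu [|j] // mj; rewrite gval_d /=; apply: hu. Qed.

Lemma gbounded_mono i g : off_regular_fun U f g -> gbounded 1 (gmono i g).
Proof. by move=> rg [|j] // _; rewrite gval_mono //; apply/funext => i'. Qed.

Lemma gbounded_dc i m u : gbounded m u -> gbounded m.+1 (dc i u).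
Proof.
move=> hu; apply: gboundedD; first exact: gbounded_d.
by apply: gboundedZ; apply: (gbounded_le (leqnSn m)); apply: gbounded_ti.
Qed.

Lemma gval_dc_top i m u : gbounded m.+1 u -> gval (dc i u) m.+1 = gval u m.
Proof.
move=> hu; rewrite /tm_dc gvalD gvalZ.
rewrite -[LHS]/(gval (D u) m.+1 + - bi i *: gval (Ti u) m.+1).
by rewrite gval_d (gbounded_ti hu) // scaler0 addr0.
Qed.

Lemma gbounded_iter_dc i k m u : gbounded m u -> gbounded (m + k) (iter k (dc i) u).
Proof. by move=> hu; elim: k => [|k IHk]; rewrite ?addn0 //= addnS; apply: gbounded_dc. Qed.

Lemma gval_iter_dc_top i k m u : gbounded m.+1 u ->
  gval (iter k (dc i) u) (m + k) = gval u m.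
Proof.
move=> hu; elim: k => [|k IHk]; first by rewrite addn0.
by rewrite addnS /= gval_dc_top // -addSn; apply: gbounded_iter_dc.
Qed.

(** Each twisted derivative raises the order by one and keeps the leading coefficient. *)
Lemma iter_dc_order_eq0 i p u : gbounded p (iter p (dc i) u) -> u = 0.
Proof.
move=> hu; have [m] := gbounded_ex u; elim: m => [|m IHm] hm.
  exact: gbounded_eq0.
apply: IHm => j; rewrite leq_eqVlt => /orP[/eqP <-|]; last exact: hm.
by rewrite -(gval_iter_dc_top i p hm) hu // leq_addl.
Qed.

Lemma dc_t i u : dc i (T u) = - gs i u.
Proof.
have -> : dc i (T u) = E u + - bi i *: u by exact: (@tm_dc_t R GM).
by rewrite /gs scaleNr opprB.
Qed.

Lemma gs1E i u : pe ((bi i + 1)%:P - 'X) u = gs i u + u.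
Proof.
rewrite (op_polyD E) (op_polyN E) (op_polyC E) (op_polyX E) scalerDl scale1r.
by rewrite addrAC.
Qed.

(** s multiplies the leading coefficient by - f and raises the order, so (s + 1) u has positive
    order unless u = 0. This is what allows the factor s + 1 to be cancelled. *)
Lemma gs_order_eq0 i u h : off_regular_fun U f h -> pe ((bi i + 1)%:P - 'X) u = gmono i h -> u = 0.
Proof.
rewrite gs1E => rh e; have [m] := gbounded_ex u; elim: m => [|m IHm] hm.
  exact: gbounded_eq0.
apply: IHm => j; rewrite leq_eqVlt => /orP[/eqP <-|]; last exact: hm.
have := congr1 (fun v => gval v m.+1) e.
rewrite (gbounded_mono i rh) // /gs gvalD gvalB gvalZ gval_e => e1.
apply/funext => i'; apply/funext => y.
have := congr1 (fun w : 'I_l -> X -> K => w i' y) e1.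
rewrite -[LHS]/(bi i * gval u m.+1 i' y - t_act f (gval u) m i' y + gval u m.+1 i' y).
rewrite /t_act hm // mulr0 mulr0 subr0 sub0r addr0 -[RHS]/(0 : K) => /eqP.
rewrite oppr_eq0 mulf_eq0.
have [[_ /negPf ->] /eqP //|hy] := pselect (off y).
by rewrite (graph_out _ _ (gvalP _) hy).
Qed.

Lemma off_regular_div theta g : derivation_on U theta -> off_regular_fun U f g ->
  off_regular_fun U f (fun y => theta f y / f y * g y).
Proof.
move=> dt rg; apply: (off_regularM (off_regularM _ (off_regularV rf)) rg).
exact: off_regular_der dt (on_off_regular rf).
Qed.

Lemma gder_mono_dc i theta g : derivation_on U theta -> off_regular_fun U f g ->
  gder theta (gmono i g) = gmono i (theta g) - dc i (gmono i (theta f * g)).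
Proof.
move=> dt rg; rewrite gder_mono //; congr (_ + _).
have rk := off_regular_div dt rg.
rewrite -[LHS]opprK -dc_t gmono_t //; congr (- dc i _).
by apply: gmono_ext => y [_ fy]; rewrite !mulrfctE; field.
Qed.

Lemma ge_mono i g : off_regular_fun U f g ->
  E (gmono i g) = dc i (gmono i (f * g)) + bi i *: gmono i g.
Proof. by move=> rg; rewrite -gmono_t // dc_t /gs opprB subrK. Qed.

Definition gjac i : set GM := e_span [set u | u = gmono i f \/
  exists2 theta, derivation_on U theta & u = gmono i (theta f)].

Lemma gjac_f i g : regular_on U g -> gjac i (gmono i (g * f)).
Proof.
move=> rg; rewrite -gfun_mono //; last exact: on_off_regular.
by apply: (es_fun (e_submodule_span _)) => //; apply: sub_e_span; left.
Qed.

Lemma gjac_theta i g theta : regular_on U g -> derivation_on U theta ->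
  gjac i (gmono i (g * theta f)).
Proof.
move=> rg dt; rewrite -gfun_mono //; last exact: off_regular_der dt (on_off_regular rf).
apply: (es_fun (e_submodule_span _)) => //; apply: sub_e_span; right.
by exists theta.
Qed.

Lemma gfunD g u v : regular_on U g -> gfun g (u + v) = gfun g u + gfun g v.
Proof. by move=> /(gfun_ops l beta oU rf)[F _ FE]; rewrite -!FE linearD. Qed.

Lemma gderD theta u v : derivation_on U theta ->
  gder theta (u + v) = gder theta u + gder theta v.
Proof. by move=> /(gder_ops l beta oU rf)[F _ FE]; rewrite -!FE linearD. Qed.

Lemma gfun_poly g p u : regular_on U g -> gfun g (pe p u) = pe p (gfun g u).
Proof.
move=> /(gfun_ops l beta oU rf)[F hF FE]; rewrite -!FE.
by apply: op_poly_comm => v; apply: (@tm_opse R GM F v hF).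
Qed.

Lemma gder_poly theta p u : derivation_on U theta ->
  gder theta (pe p u) = pe p (gder theta u).
Proof.
move=> /(gder_ops l beta oU rf)[F hF FE]; rewrite -!FE.
by apply: op_poly_comm => v; apply: (@tm_opse R GM F v hF).
Qed.

Lemma ge_poly p u : E (pe p u) = pe p (E u).
Proof. by rewrite -[LHS](op_polyX E) -op_polyMC (op_polyM E) (op_polyX E). Qed.

(** O f delta + (s + 1) J is stable, because theta(g f delta) = theta(g) f delta + (s + 1) g
    theta(f) delta modulo (s + 1) J. It contains f delta, hence (s + 1) q(s) delta = g f delta + (s
    + 1) y with y in J, and (s + 1) (q(s) delta - y) has order 0. *)
Lemma gjac_bernstein i (q : {poly K}) : functional_equation U f (q * ('X + 1)) ->
  gjac i (op_poly (gs i) q (gmono i 1)).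
Proof.
move=> hq; have esJ : e_submodule (gjac i) by apply: e_submodule_span.
pose p : {poly K} := (bi i + 1)%:P - 'X.
pose S : set GM := fun u => exists g v,
  [/\ regular_on U g, gjac i v & u = gmono i (g * f) + pe p v].
have rmf g : regular_on U g -> off_regular_fun U f (g * f).
  by move=> rg; apply: off_regularM; apply: on_off_regular.
have hS : e_submodule S.
  apply: graph_e_submodule.
  - exists 0, 0; split; first by move=> y _; apply: regular0.
      exact: (es0 esJ).
    by rewrite mul0r gmono0 linear0 addr0.
  - move=> a _ _ [g [y [rg Jy ->]]] [h [z [rh Jz ->]]].
    exists (a *: g + h), (a *: y + z); split.
    + by move=> x Ux; apply: regularD; [apply: regularZ; apply: rg|apply: rh].
    + exact: (esP esJ).
    + have -> : (a *: g + h) * f = a *: (g * f) + h * f.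
        apply/funext => x; rewrite -[LHS]/((a * g x + h x) * f x).
        by rewrite -[RHS]/(a * (g x * f x) + h x * f x); ring.
      rewrite gmonoP; [|exact: rmf|exact: rmf].
      by rewrite linearP /= scalerDr addrACA.
  - move=> h _ rh [g [y [rg Jy ->]]]; exists (h * g), (gfun h y); split.
    + by move=> x Ux; apply: regularM; [apply: rh|apply: rg].
    + exact: (es_fun esJ).
    + by rewrite gfunD // gfun_poly // gfun_mono ?mulrA //; apply: rmf.
  - move=> theta _ dt [g [y [rg Jy ->]]].
    exists (theta g), (gder theta y + gmono i (g * theta f)); split.
    + by move=> x Ux; apply: (derivation_regular dt) => //; apply: rg.
    + by apply: (esD esJ); [exact: (es_der esJ)|exact: gjac_theta].
    + have rgt : off_regular_fun U f (g * theta f).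
        by apply: off_regularM; [exact: on_off_regular|exact: off_regular_der dt (on_off_regular rf)].
      have rtg : off_regular_fun U f (theta g * f).
        by apply: off_regularM; [exact: off_regular_der dt (on_off_regular rg)|exact: on_off_regular].
      rewrite gderD // gder_poly // (gder_mono beta oU rf i dt (rmf g rg)).
      have -> : gmono i (theta (g * f)) = gmono i (theta g * f) + gmono i (g * theta f).
        rewrite -gmonoD //; apply: gmono_ext => x hx; have [Ux _] := hx.
        by rewrite (derivation_leibniz dt) //; [apply: rg|apply: rf].
      have -> : gmono i (fun x => theta f x / f x * (g * f) x) = gmono i (g * theta f).
        by apply: gmono_ext => x [_ fx]; rewrite !mulrfctE; field.
      rewrite linearD /= (gs1E i (gmono i (g * theta f))).
      move: (gs i _) (pe p _) => a c; rewrite -!addrA; congr (_ + _).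
      by rewrite addrA addrC [gmono _ _ + _]addrC.
  - move=> _ [g [y [rg Jy ->]]].
    exists ((bi i + 1) *: g), (E y - gmono i (g * f)); split.
    + by move=> x Ux; apply: regularZ; apply: rg.
    + rewrite -scaleN1r addrC; apply: (esP esJ); first exact: gjac_f.
      exact: (es_e esJ).
    + have -> : (bi i + 1) *: g * f = (bi i + 1) *: (g * f).
        by apply/funext => x; apply/esym; exact: mulrA.
      rewrite gmonoZ; last exact: rmf.
      have -> : E (gmono i (g * f) + pe p y) = E (gmono i (g * f)) + E (pe p y).
        exact: (linearD (@tm_e R GM : {linear GM -> GM})).
      have peG : pe p (gmono i (g * f)) =
          (bi i + 1) *: gmono i (g * f) - E (gmono i (g * f)).
        by rewrite (op_polyD E) (op_polyN E) (op_polyC E) (op_polyX E).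
      rewrite ge_poly linearB /= peG opprB [RHS]addrC -addrA subrK addrC //.
have [|g [y [rg Jy e]]] := functional_transfer hq hS (i := i).
  exists 1, 0; split; first by move=> y _; apply: regular1.
    exact: (es0 esJ).
  by rewrite mul1r linear0 addr0.
set z := op_poly (gs i) q (gmono i 1).
suff -> : z = y by [].
apply/eqP; rewrite -subr_eq0; apply/eqP.
apply: (gs_order_eq0 (h := g * f) (i := i)); first exact: rmf.
rewrite linearB /=; apply/eqP; rewrite subr_eq -e; apply/eqP.
rewrite op_polyMC /z gs1E op_polyD op_poly1 op_polyX.
by [].
Qed.

Lemma gspan_dc_jac i u : gjac i u -> gspan [set i] (dc i u).
Proof.
have esS : e_submodule (gspan [set i]) by apply: (vs_es (gspan_v0 _ _ _ _)).
have r1 := @off_regular1 R X U f.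
have S1 : gspan [set i] (gmono i 1).
  by apply: gspan_mono => // y _; apply: regular1.
apply: (e_span_sub (e_submodule_dc (- bi i) 1 esS)) => v [->|[theta dt ->]].
- change (gspan [set i] (dc i (gmono i f))).
  have -> : gmono i f = T (gmono i 1) by rewrite gmono_t ?mulr1.
  by rewrite dc_t -scaleN1r; apply: (esZ esS); exact: (gs_submodule i esS S1).
- change (gspan [set i] (dc i (gmono i (theta f)))).
  have := gder_mono_dc i dt r1; rewrite mulr1.
  have -> : gmono i (theta 1) = 0.
    rewrite -(gmono0 beta oU rf i); apply: gmono_ext => y [Uy _].
    by rewrite (deriv1 dt).
  rewrite sub0r => e; rewrite -[dc i _]opprK -e -scaleN1r.
  by apply: (esZ esS); exact: (es_der esS dt S1).
Qed.

Lemma v_can_delta (b : {poly K}) i : functional_equation U f b ->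
  roots_in (ge_re 1) (b \Po ((bi i)%:P - 'X)) ->
  v_can (gspan [set i]) 1 (gmono i 1).
Proof.
move=> hb hroots; have v0N : v0_submodule (gspan [set i]) by apply: gspan_v0.
have NTi u : gspan [set i] u ->
    gspan [set i] (Ti (pe (b \Po ((bi i)%:P - 'X)) u)).
  apply: (gspan_sub (e_submodule_poly (e_submodule_ti v0N 1) _)) => _ ->.
  exact: gspan_bernstein.
move=> m; have [q hq Nq] := N_up hroots NTi m.
by exists q => //; apply: Nq; apply: gspan_mono => // y _; apply: regular1.
Qed.

(** Induction on k: dc q(s) delta is in N, so dc^(k+1) q(s) delta is in dc^k N, hence in V^1. Moving
    q(s) to the left of dc^(k+1) turns it into a polynomial in E with roots at least p - k >= 1,
    which can be divided out. *)
Lemma v_can_iter_dc (q : {poly K}) (al : R) p i : 0 < al <= 1 ->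
  bi i = (1 - al)%:C%C -> functional_equation U f (q * ('X + 1)) ->
  roots_in (fun z => z <= (- (p%:R + al))%:C%C) q ->
  forall k, (k <= p)%N -> v_can (gspan [set i]) 1 (iter k (dc i) (gmono i 1)).
Proof.
move=> /andP[al0 al1] biE hq hroots.
have v0N : v0_submodule (gspan [set i]) by apply: gspan_v0.
have v0V := v_can_submodule v0N.
elim=> [_|k IHk kp].
  apply: (v_can_delta hq) => z; rewrite root_comp_sub rootM => /orP[/hroots|].
    rewrite biE lerBlDr -lerBlDl -rmorphB /ge_re; apply: le_trans.
    by rewrite lecR; have := ler0n R p; lra.
  (* The root -1 of s + 1 corresponds to E = 2 - al, which is at least 1 because al <= 1. *)
  rewrite rootE !hornerE addr_eq0 => /eqP e.
  have -> : z = (1 - al + 1)%:C%C.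
    by rewrite -[z](subKr (bi i)) e opprK biE -(rmorph1 (real_complex R)) -rmorphD.
  by rewrite /ge_re lecR; lra.
have hJ : gjac i (op_poly (gs i) q (gmono i 1)) by exact: gjac_bernstein hq.
have hN := gspan_dc_jac hJ.
have hV : gspan [set i] `<=` [set u | v_can (gspan [set i]) 1 (iter k (dc i) u)].
  apply: gspan_sub; first exact: (e_submodule_dc _ _ (v0V 1)).
  by move=> _ ->; apply: IHk; apply: ltnW.
have := hV _ hN; rewrite /mkset -iterSr gs_poly.
have -> : iter k.+1 (dc i) (pe (q \Po ((bi i)%:P - 'X)) (gmono i 1)) =
    pe ((q \Po ((bi i)%:P - 'X)) \Po ('X + (k.+1%:R)%:P)) (iter k.+1 (dc i) (gmono i 1)).
  exact: iter_tm_dc_poly.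
apply: v_can_prod => // z; rewrite root_comp_shift root_comp_sub => /hroots.
rewrite biE lerBlDr -lerBlDl -rmorphB -lerBlDr -(rmorph_nat (real_complex R)).
rewrite -rmorphB /ge_re; apply: le_trans; rewrite lecR.
have : (k.+1%:R <= p%:R :> R) by rewrite ler_nat.
by lra.
Qed.

Lemma iter_d_ti_dc i (al : K) k a u : (a <= k)%N -> bi i = 1 - al ->
  iter a D (Ti (iter (k - a) (dc i) u)) =
  pe (rising_poly 0 a * rising_poly (al + a%:R) (k - a)) (iter k.+1 Ti u).
Proof.
move=> ak biE; rewrite op_polyM.
have -> : iter a D (Ti (iter (k - a) (dc i) u)) =
    pe (rising_poly 0 a) (iter a Ti (Ti (iter (k - a) (dc i) u))).
  exact: iter_tm_dE.
congr (pe _ _); rewrite -[Ti (iter _ _ _)]/(iter 1 Ti (iter (k - a) (dc i) u)).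
rewrite -iterD.
have -> : iter (a + 1) Ti (iter (k - a) (dc i) u) =
    pe (rising_poly (- bi i + (a + 1)%:R) (k - a)) (iter (a + 1 + (k - a)) Ti u).
  exact: iter_ti_tm_dc.
have -> : (a + 1 + (k - a) = k.+1)%N by lia.
by rewrite biE natrD; congr (pe (rising_poly _ _) _); ring.
Qed.

Lemma off_regular_expV k : off_regular_fun U f (fun y => (f y ^+ k)^-1).
Proof.
move=> y hy; have [Uy fy] := hy; elim: k => [|k IHk].
  by apply: regular_near_eq (regular_cst y 1) _; apply: nearW => z; rewrite expr0 invr1.
apply: regular_near_eq (regularM (regularV (off_regular rf hy) fy) IHk) _.
by apply: nearW => z; rewrite mulrfctE exprS invfM.
Qed.

Lemma gmono_iter_ti i k : iter k Ti (gmono i 1) = gmono i (fun y => (f y ^+ k)^-1).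
Proof.
elim: k => [|k IHk].
  by apply: gmono_ext => y _; rewrite expr0 invr1.
rewrite iterS IHk gmono_ti; last exact: off_regular_expV.
apply: gmono_ext => y _.
by rewrite exprS invfM mulrC.
Qed.

Lemma hodge_filtration_of_v_can (al : R) k i1 g : val i1 = 1%N -> 0 < al ->
  beta = (1 - al)%:C%C ->
  v_filtration (v_can (gspan setT)) -> regular_on U g ->
  (forall k', (k' <= k)%N ->
    v_can (gspan setT) 1 (iter k' (dc i1) (gmono i1 1))) ->
  hodge_filtration_M l U f beta k (extend0 off (fun x => g x / f x ^+ k.+1)).
Proof.
move=> i1E al0 betaE hV rg hk.
have biE : bi i1 = 1 - al%:C%C by rewrite i1E mul1r betaE rmorphB rmorph1.
have v0N : v0_submodule (gspan setT) by apply: gspan_v0.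
(* The rising factorial (al)_k, by which the identity for t^(-k-1) delta is divided; it is nonzero
   because al > 0. *)
pose cst : K := \prod_(m < k) (al%:C%C + m%:R).
have cst0 : cst != 0.
  apply/prodf_neq0 => m _; rewrite -(rmorph_nat (real_complex R)) -rmorphD.
  by rewrite -(rmorph0 (real_complex R)) (inj_eq (@complexI R)) gt_eqF // ltr_wpDr.
pose C (a : nat) : K := cst^-1 * ((-1) ^+ a * 'C(k, a)%:R).
pose v (a : nat) : GM := gfun g (C a *: Ti (iter (k - a) (dc i1) (gmono i1 1))).
exists (fun c => gval @` v_can (gspan setT) c); first exact: V_filtration_of.
exists (fun a => gval (v a)); split.
  move=> a ak; split.
    exists (v a) => //; have v0V := v_can_submodule v0N 0.
    apply: (es_fun v0V) => //; apply: (esZ v0V); apply: v_can_ti.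
    by rewrite add0r; apply: hk; apply: leq_subr.
  move=> j kj; rewrite gval_fun //; apply/funext => i.
  have hb : gbounded (k - a).+1 (C a *: Ti (iter (k - a) (dc i1) (gmono i1 1))).
    apply: gboundedZ; apply: gbounded_ti; rewrite -add1n.
    by apply: gbounded_iter_dc; apply: gbounded_mono; apply: off_regular1.
  by rewrite hb // mulr0.
have gE a u : iter a dt_act (gval u) = gval (iter a D u).
  by elim: a => //= a ->; rewrite gval_d.
rewrite (eq_bigr (fun a : 'I_k.+1 => gval (iter a D (v a)))); last by move=> a _; rewrite gE.
rewrite -gval_sum.
have [F hF FE] := gfun_ops l beta oU rf rg.
have -> : \sum_(a < k.+1) iter a D (v a) = gfun g (iter k.+1 Ti (gmono i1 1)).
  have FD a u : iter a D (F u) = F (iter a D u).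
    by elim: a => //= a ->; rewrite (@tm_opsd R GM F _ hF).
  rewrite (eq_bigr (fun a : 'I_k.+1 => F (C a *: pe (rising_poly 0 a *
      rising_poly (al%:C%C + a%:R) (k - a)) (iter k.+1 Ti (gmono i1 1))))).
    rewrite -linear_sum FE; congr gfun.
    rewrite (eq_bigr (fun a : 'I_k.+1 => cst^-1 *: pe (((-1) ^+ a * 'C(k, a)%:R) *:
      (rising_poly 0 a * rising_poly (al%:C%C + a%:R) (k - a)))
        (iter k.+1 Ti (gmono i1 1)))).
      rewrite -scaler_sumr -(op_poly_sum E) rising_poly_vandermonde (op_polyC E).
      by rewrite scalerA mulVf // scale1r.
    by move=> a _; rewrite (op_polyZ E) scalerA.
  move=> a _; rewrite /v -FE FD; congr (F _).
  have itZ b (z : K) u : iter b D (z *: u) = z *: iter b D u.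
    by elim: b => //= b ->; rewrite linearZ.
  by rewrite itZ (iter_d_ti_dc _ (leq_ord a) biE).
rewrite gmono_iter_ti gval_fun // gval_mono; last exact: off_regular_expV.
apply/funext => -[|j]; apply/funext => i; rewrite /mono /=; last by rewrite mulr0.
rewrite -i1E -val_eqE; case: ifP => _; last by rewrite mulr0.
apply/funext => y; rewrite mulrfctE; have [hy|hy] := pselect (off y).
  by rewrite !extend0_in.
by rewrite !extend0_out // mulr0.
Qed.

(** * The lattice without poles *)

Record lattice_closed i S : Prop := LatticeClosed {
  lc0 : S 0;
  lcD : forall u v, S u -> S v -> S (u + v);
  lc_dc : forall u, S u -> S (dc i u);
  lc_mono : forall h, regular_on U h -> S (gmono i h)
}.

(* The lattice of the elements of the [i]-th component without poles along the
   divisor, in the frame given by the powers of the twisted derivative. *)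
Definition glat i : set GM := fun u => forall S, lattice_closed i S -> S u.

Lemma glat_closed i : lattice_closed i (glat i).
Proof.
split.
- by move=> S hS; apply: (lc0 hS).
- by move=> u v hu hv S hS; apply: (lcD hS); [apply: hu|apply: hv].
- by move=> u hu S hS; apply: (lc_dc hS); apply: hu.
- by move=> h rh S hS; apply: (lc_mono hS).
Qed.

Lemma dcD i u v : dc i (u + v) = dc i u + dc i v.
Proof. exact: (linearD (@tm_dc R GM (- bi i) : {linear GM -> GM})). Qed.

Lemma dc0 i : dc i 0 = 0.
Proof. exact: (linear0 (@tm_dc R GM (- bi i) : {linear GM -> GM})). Qed.

Lemma dcZ i (a : K) u : dc i (a *: u) = a *: dc i u.
Proof.
rewrite -[a *: u]addr0.
have -> : dc i (a *: u + 0) = a *: dc i u + dc i 0 by exact: tm_dc_is_linear.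
by rewrite dc0 addr0.
Qed.

Lemma geD u v : E (u + v) = E u + E v.
Proof. exact: (linearD (@tm_e R GM : {linear GM -> GM})). Qed.

Lemma ge0 : E 0 = 0.
Proof. exact: (linear0 (@tm_e R GM : {linear GM -> GM})). Qed.

Lemma gfun0 g : regular_on U g -> gfun g 0 = 0.
Proof. by move=> /(gfun_ops l beta oU rf)[F _ <-]; rewrite linear0. Qed.

Lemma gder0 theta : derivation_on U theta -> gder theta 0 = 0.
Proof. by move=> /(gder_ops l beta oU rf)[F _ <-]; rewrite linear0. Qed.

Lemma gfun_dc i g u : regular_on U g -> gfun g (dc i u) = dc i (gfun g u).
Proof. by move=> /(gfun_ops l beta oU rf)[F hF FE]; rewrite -!FE; exact: tm_dc_ops. Qed.

Lemma gder_dc i theta u : derivation_on U theta -> gder theta (dc i u) = dc i (gder theta u).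
Proof. by move=> /(gder_ops l beta oU rf)[F hF FE]; rewrite -!FE; exact: tm_dc_ops. Qed.

Lemma ge_dc i u : E (dc i u) = dc i (E u) - dc i u.
Proof.
have -> : dc i (E u) = E (dc i u) + 1 *: dc i u by exact: tm_dc_e.
by rewrite scale1r addrK.
Qed.

Lemma regular_onM g h : regular_on U g -> regular_on U h -> regular_on U (g * h).
Proof. by move=> rg rh x Ux; apply: regularM; [apply: rg|apply: rh]. Qed.

Lemma regular_onD g h : regular_on U g -> regular_on U h -> regular_on U (g + h).
Proof. by move=> rg rh x Ux; apply: regularD; [apply: rg|apply: rh]. Qed.

Lemma regular_onZ a g : regular_on U g -> regular_on U (a *: g).
Proof. by move=> rg x Ux; apply: regularZ; apply: rg. Qed.

Lemma regular_on_der theta g : derivation_on U theta -> regular_on U g ->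
  regular_on U (theta g).
Proof. by move=> dt rg x Ux; apply: (derivation_regular dt) => //; apply: rg. Qed.

Lemma glatZ i a u : glat i u -> glat i (a *: u).
Proof.
have hL := glat_closed i => hu; apply: (hu [set u | glat i (a *: u)]); split.
- by rewrite /mkset scaler0; apply: (lc0 hL).
- by move=> v w hv hw; rewrite /mkset scalerDr; apply: (lcD hL).
- by move=> v hv; rewrite /mkset -dcZ; apply: (lc_dc hL).
- move=> h rh; rewrite /mkset -gmonoZ; last exact: on_off_regular.
  by apply: (lc_mono hL); apply: regular_onZ.
Qed.

Lemma glat_submodule i : e_submodule (glat i).
Proof.
have hL := glat_closed i; apply: graph_e_submodule.
- exact: (lc0 hL).
- by move=> a u v hu hv; apply: (lcD hL) => //; apply: glatZ.
- move=> g u rg hu; apply: (hu [set u | glat i (gfun g u)]); split.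
  + by rewrite /mkset gfun0 //; apply: (lc0 hL).
  + by move=> v w hv hw; rewrite /mkset gfunD //; apply: (lcD hL).
  + by move=> v hv; rewrite /mkset gfun_dc //; apply: (lc_dc hL).
  + move=> h rh; rewrite /mkset gfun_mono //; last exact: on_off_regular.
    by apply: (lc_mono hL); apply: regular_onM.
- move=> theta u dt hu; apply: (hu [set u | glat i (gder theta u)]); split.
  + by rewrite /mkset gder0 //; apply: (lc0 hL).
  + by move=> v w hv hw; rewrite /mkset gderD //; apply: (lcD hL).
  + by move=> v hv; rewrite /mkset gder_dc //; apply: (lc_dc hL).
  + move=> h rh; rewrite /mkset gder_mono_dc //; last exact: on_off_regular.
    apply: (lcD hL); first by apply: (lc_mono hL); apply: regular_on_der.
    rewrite -scaleN1r; apply: glatZ; apply: (lc_dc hL); apply: (lc_mono hL).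
    by apply: regular_onM => //; apply: regular_on_der.
(* Both memberships are proved together, since E dc u = dc E u - dc u involves dc u as well. *)
- move=> u hu; suff [] : glat i u /\ glat i (E u) by [].
  apply: (hu [set u | glat i u /\ glat i (E u)]); split.
  + by split; rewrite ?ge0; apply: (lc0 hL).
  + by move=> v w [h1 h2] [h3 h4]; split; rewrite ?geD; apply: (lcD hL).
  + move=> v [h1 h2]; split; first exact: (lc_dc hL).
    rewrite ge_dc; apply: (lcD hL); first exact: (lc_dc hL).
    by rewrite -scaleN1r; apply: glatZ; apply: (lc_dc hL).
  + move=> h rh; split; first exact: (lc_mono hL).
    rewrite ge_mono; last exact: on_off_regular.
    apply: (lcD hL); last by apply: glatZ; apply: (lc_mono hL).
    by apply: (lc_dc hL); apply: (lc_mono hL); apply: regular_onM.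
Qed.

Definition dc_sum i m (h : nat -> X -> K) : GM :=
  \sum_(j < m) iter j (dc i) (gmono i (h j)).

Definition regular_seq (h : nat -> X -> K) : Prop := forall j, regular_on U (h j).

Lemma iter_dc_lin i k a u v :
  iter k (dc i) (a *: u + v) = a *: iter k (dc i) u + iter k (dc i) v.
Proof. exact: (iter_linear_sub (@tm_dc R GM (- bi i) : {linear GM -> GM})). Qed.

Lemma iter_dc0 i k : iter k (dc i) 0 = 0.
Proof. by elim: k => //= k ->; apply: dc0. Qed.

Lemma regular_on0 : regular_on U (0 : X -> K).
Proof. by move=> x _; apply: regular0. Qed.

Lemma dc_sum_pad i m m' (h : nat -> X -> K) : regular_seq h -> (m <= m')%N ->
  exists2 h' : nat -> X -> K, regular_seq h' & dc_sum i m' h' = dc_sum i m h.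
Proof.
move=> rh /subnKC <-; exists (fun j => if (j < m)%N then h j else 0).
  by move=> j; case: ifP => _; [exact: rh|exact: regular_on0].
rewrite /dc_sum big_split_ord /= [X in _ + X]big1 ?addr0.
  by apply: eq_bigr => j _; rewrite ltn_ord.
by move=> j _; rewrite ltnNge leq_addr /= gmono0 iter_dc0.
Qed.

Lemma dc_sumP i m a (h h' : nat -> X -> K) : regular_seq h -> regular_seq h' ->
  dc_sum i m (a *: h + h') = a *: dc_sum i m h + dc_sum i m h'.
Proof.
move=> rh rh'; rewrite /dc_sum scaler_sumr -big_split; apply: eq_bigr => j _ /=.
rewrite -iter_dc_lin -gmonoP //; exact: on_off_regular.
Qed.

Lemma glat_sum i u : glat i u -> exists m (h : nat -> X -> K), regular_seq h /\ u = dc_sum i m h.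
Proof.
move=> hu; apply: (hu [set u | exists m (h : nat -> X -> K), regular_seq h /\ u = dc_sum i m h]).
split.
- exists 0%N, (fun=> 0); split; first by move=> j; apply: regular_on0.
  by rewrite /dc_sum big_ord0.
- move=> _ _ [m [h [rh ->]]] [m' [h' [rh' ->]]].
  have [g rg <-] := dc_sum_pad i rh (leq_maxl m m').
  have [g' rg' <-] := dc_sum_pad i rh' (leq_maxr m m').
  exists (maxn m m'), (1 *: g + g'); split.
    by move=> j; apply: regular_onD; [apply: regular_onZ; apply: rg|apply: rg'].
  by rewrite dc_sumP // scale1r.
- move=> _ [m [h [rh ->]]]; exists m.+1, (shift_seq h); split.
    by case=> [|j]; [exact: regular_on0|exact: rh].
  rewrite /dc_sum big_ord_recl /= gmono0 add0r.
  by elim/big_rec2: _ => [|j v w _ <-]; rewrite ?dc0 ?dcD.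
- move=> h rh; exists 1%N, (fun=> h); split=> //.
  by rewrite /dc_sum big_ord1.
Qed.

Lemma dc_sum_bounded i m (h : nat -> X -> K) : regular_seq h -> gbounded m (dc_sum i m h).
Proof.
move=> rh; rewrite /dc_sum; elim/big_rec: _ => [|j u _ hu]; first exact: gbounded0.
apply: gboundedD => //; apply: (@gbounded_le (1 + j)).
  by rewrite add1n.
by apply: gbounded_iter_dc; apply: gbounded_mono; apply: on_off_regular.
Qed.

Lemma dc_sum_top i m (h : nat -> X -> K) y : regular_seq h -> off y ->
  gval (dc_sum i m.+1 h) m i y = h m y.
Proof.
move=> rh hy; rewrite /dc_sum big_ord_recr /= gvalD.
rewrite -[LHS]/(gval (dc_sum i m h) m i y + gval (iter m (dc i) (gmono i (h m))) m i y).
rewrite (dc_sum_bounded i rh) // add0r.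
have r1 : off_regular_fun U f (h m) by apply: on_off_regular.
have := gval_iter_dc_top i m (gbounded_mono i r1).
rewrite add0n => ->; rewrite gval_mono // /mono !eqxx /=.
by rewrite extend0_in.
Qed.

Lemma glat_trunc i k u : glat i u -> gbounded k u ->
  exists2 h : nat -> X -> K, regular_seq h & u = dc_sum i k h.
Proof.
move=> /glat_sum[m [h [rh ->]]]; elim: m => [|m IHm] hu.
  by have [h' rh' e] := dc_sum_pad i rh (leq0n k); exists h'.
have [mk|km] := ltnP m k.
  by have [h' rh' e] := dc_sum_pad i rh mk; exists h'.
have hm0 : gmono i (h m) = 0.
  rewrite -(gmono0 beta oU rf i); apply: gmono_ext => y hy.
  by rewrite -(dc_sum_top i m rh hy) hu.
have e : dc_sum i m.+1 h = dc_sum i m h.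
  by rewrite /dc_sum big_ord_recr /= hm0 iter_dc0 addr0.
by rewrite e in hu *; apply: IHm.
Qed.

Lemma gspan_glat i : gspan [set i] `<=` glat i.
Proof.
apply: gspan_sub; first exact: glat_submodule.
by move=> _ ->; apply: (lc_mono (glat_closed i)) => y _; apply: regular1.
Qed.

(** dc^m t^m is a polynomial in E with roots at most i beta < c, and it takes u into the lattice; so
    does a polynomial with roots at least c. *)
Lemma v_can_glat i (b0 c : R) u : bi i = b0%:C%C -> b0 < c ->
  v_can (gspan [set i]) c u -> (exists m, glat i (iter m T u)) -> glat i u.
Proof.
move=> biE bc hu [m hm].
have [q hq /gspan_glat Nq] := hu 0%N.
have Lm : glat i (iter m (dc i) (iter m T u)).
  by elim: (m) (iter m T u) hm => //= k IHk v /IHk; apply: (lc_dc (glat_closed i)).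
have e : iter m (dc i) (iter m T u) = pe (rising_poly (- bi i) m) u.
  rewrite -{2}(iter_tm_tK m u); exact: iter_tm_dcE.
rewrite e in Lm; apply: (es_coprime (glat_submodule i) _ Nq Lm).
apply: (roots_in_coprime _ hq).
  apply: (roots_in_neq0 (z := (c - 1)%:C%C) _ hq).
  by rewrite /ge_re lecR -ltNge ltrBlDr ltrDl.
move=> z; rewrite /rising_poly rootE horner_prod prodf_seq_eq0 => /hasP[j _ /=].
rewrite hornerD hornerX hornerC addr_eq0 => /eqP ->; rewrite biE /ge_re.
have -> : - (- b0%:C%C + j%:R) = (b0 - j%:R)%:C%C.
  by rewrite rmorphB rmorph_nat opprD opprK.
by rewrite lecR -ltNge (le_lt_trans _ bc) // gerBl.
Qed.

(** E u = d_t t u has no coefficient of order 0, so only the constant term of p counts. *)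
Lemma gval_poly0 p u i y : gval (pe p u) 0 i y = p`_0 * gval u 0 i y.
Proof.
elim/poly_ind: p u => [|p c IHp] u; first by rewrite (op_poly0 E) gval0 coef0 mul0r.
rewrite (op_polyD E) (op_polyC E) (op_polyMX E) gvalD gvalZ coefD coefMX coefC /=.
rewrite add0r -[LHS]/(gval (pe p (E u)) 0 i y + c * gval u 0 i y) IHp gval_e /=.
by rewrite mulr0 add0r.
Qed.

Lemma gmono_fun1 i h : regular_on U h -> gmono i h = gfun h (gmono i 1).
Proof. by move=> rh; rewrite gfun_mono ?mulr1 //; apply: off_regular1. Qed.

Lemma iter_ti_mono i k h : regular_on U h ->
  iter k Ti (gmono i h) = gmono i (fun y => h y * (f y ^+ k)^-1).
Proof.
move=> rh; rewrite gmono_fun1 //.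
have [F hF FE] := gfun_ops l beta oU rf rh.
have -> : iter k Ti (gfun h (gmono i 1)) = gfun h (iter k Ti (gmono i 1)).
  by rewrite -!FE; apply/esym; exact: iter_ops_ti.
rewrite gmono_iter_ti gfun_mono //; exact: off_regular_expV.
Qed.

Lemma gval_ti_dc0 i j h y : regular_on U h -> off y ->
  gval (Ti (iter j (dc i) (gmono i h))) 0 i y =
  (rising_poly (1 - bi i) j)`_0 * (h y * (f y ^+ j.+1)^-1).
Proof.
move=> rh hy.
have -> : Ti (iter j (dc i) (gmono i h)) =
    pe (rising_poly (- bi i + 1%:R) j) (iter (1 + j) Ti (gmono i h)).
  exact: (@iter_ti_tm_dc R GM (- bi i) 1 j).
rewrite gval_poly0 add1n iter_ti_mono // addrC; congr (_ * _).
rewrite gval_mono; last first.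
  apply: (off_regularM (on_off_regular rh)); exact: off_regular_expV.
by rewrite /mono !eqxx /= extend0_in.
Qed.

Lemma rising_poly_coef0 (a : R) j : 0 < a -> (rising_poly a%:C%C j)`_0 != 0.
Proof.
move=> a0; rewrite -horner_coef0 /rising_poly horner_prod.
apply/prodf_neq0 => m _; rewrite hornerD hornerX hornerC add0r -(rmorph_nat (real_complex R)) -rmorphD.
by rewrite -(rmorph0 (real_complex R)) (inj_eq (@complexI R)) gt_eqF // ltr_wpDr.
Qed.

(** t v0 is a sum of dc^j h_j delta with j <= k. Comparing coefficients of order 0 in v0 gives
    f^(-k-1) as the sum of the a_j h_j f^(-j-1), that is a_k h_k = 1 - f H. Now dc^k h_k delta is in
    V^1 after subtraction of the lower terms, and for k > 0 so is dc^k f H delta = - dc^(k-1) s H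
    delta. *)
Lemma v_can_dc_step (al : R) i k v0 : 0 < al -> bi i = (1 - al)%:C%C ->
  v_can (gspan [set i]) 0 v0 -> (exists m, glat i (iter m T (T v0))) ->
  gbounded k.+1 v0 ->
  (forall y, off y -> gval v0 0 i y = (f y ^+ k.+1)^-1) ->
  (forall j, (j < k)%N -> v_can (gspan [set i]) 1 (iter j (dc i) (gmono i 1))) ->
  v_can (gspan [set i]) 1 (iter k (dc i) (gmono i 1)).
Proof.
move=> al0 biE V0 hm hb hv0 IH.
have v0N : v0_submodule (gspan [set i]) by apply: gspan_v0.
have v0V := v_can_submodule v0N 1; pose w0 := T v0.
have V1 : v_can (gspan [set i]) 1 w0 by rewrite -[1]add0r; apply: (v_can_t v0N).
have Lw : glat i w0 by apply: (v_can_glat biE _ V1 hm); lra.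
have [h rh ew] := glat_trunc Lw (gbounded_t hb).
pose a j := (rising_poly (1 - bi i) j)`_0.
have aE : 1 - bi i = al%:C%C by rewrite biE rmorphB rmorph1 subKr.
have ak0 : a k != 0 by rewrite /a aE; apply: rising_poly_coef0.
have key y : off y -> (f y ^+ k.+1)^-1 =
    \sum_(j < k.+1) a j * (h j y * (f y ^+ j.+1)^-1).
  move=> hy; rewrite -hv0 //.
  have -> : v0 = \sum_(j < k.+1) Ti (iter j (dc i) (gmono i (h j))).
    have -> : v0 = Ti w0 by apply/esym; exact: (@tm_tK R GM).
    rewrite ew; exact: (linear_sum (@tm_ti R GM : {linear GM -> GM})).
  rewrite gval_sum.
  have evs (F : 'I_k.+1 -> W) : (\sum_j F j) 0%N i y = \sum_j F j 0%N i y.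
    by elim/big_rec2: _ => // j u1 u2 _ <-.
  by rewrite evs; apply: eq_bigr => j _; rewrite gval_ti_dc0.
(* For k = 0 the sum is empty, so [k.-1] does no harm and H = 0. *)
pose H : X -> K := \sum_(j < k) a j *: (h j * f ^+ (k.-1 - j)).
have rH : regular_on U H.
  move=> x Ux; apply: regular_sum => j; apply: regularZ; apply: regularM.
    exact: rh.
  by apply: regularX; apply: rf.
have hk : gmono i (a k *: h k) = gmono i ((-1) *: (f * H) + 1).
  apply: gmono_ext => y hy; have [_ fy] := hy.
  rewrite -[LHS]/(a k * h k y) -[RHS]/(-1 * (f y * H y) + 1).
  have HE : H y = \sum_(j < k) a j * (h j y * f y ^+ (k.-1 - j)).
    have fX n : (f ^+ n) y = f y ^+ n.
      by elim: n => [|n IHn]; rewrite ?expr0 // !exprS mulrfctE IHn.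
    rewrite /H; elim/big_rec2: _ => // j u1 u2 _ <-.
    by rewrite -fX.
  have := congr1 (fun z => z * f y ^+ k.+1) (key y hy).
  rewrite mulVf ?expf_neq0 // big_ord_recr /= mulrDl => e.
  have {}e : 1 = f y * H y + a k * h k y.
    rewrite e; congr (_ + _); last by rewrite -!mulrA mulVf ?mulr1 ?expf_neq0.
    rewrite HE mulr_suml mulr_sumr; apply: eq_bigr => j _.
    have -> : f y ^+ k.+1 = f y ^+ j.+1 * (f y * f y ^+ (k.-1 - j)).
      by rewrite -exprS -exprD; congr (_ ^+ _); have := ltn_ord j; lia.
    by field; rewrite expf_neq0.
  by apply/eqP; rewrite mulN1r addrC eq_sym subr_eq [_ + f y * _]addrC -e.
have hmono j (g : X -> K) : regular_on U g ->
    v_can (gspan [set i]) 1 (iter j (dc i) (gmono i 1)) ->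
    v_can (gspan [set i]) 1 (iter j (dc i) (gmono i g)).
  move=> rg hj; rewrite gmono_fun1 //.
  have -> : iter j (dc i) (gfun g (gmono i 1)) = gfun g (iter j (dc i) (gmono i 1)).
    have [F hF FE] := gfun_ops l beta oU rf rg.
    by rewrite -!FE; apply/esym; exact: iter_tm_dc_ops.
  exact: (es_fun v0V).
have Ha : v_can (gspan [set i]) 1 (iter k (dc i) (gmono i (h k))).
  have -> : iter k (dc i) (gmono i (h k)) = -1 *: dc_sum i k h + w0.
    rewrite ew /dc_sum big_ord_recr /= scaleN1r addKr //.
  apply: (esP v0V) => //; apply: (es_sum v0V) => j _.
  by apply: hmono; [exact: rh|exact: IH].
have Hb : v_can (gspan [set i]) 1 (iter k (dc i) (gmono i (f * H))).
  have H0 : k = 0%N -> H = 0.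
    move=> k0; rewrite /H; apply: big1 => -[j jk] _; exfalso.
    by move: jk; rewrite k0.
  move: (H) rH H0 => {hk H} H rH H0.
  case: (k) IH H0 => [|k'] IH H0.
    by rewrite H0 // mulr0 gmono0; exact: (es0 v0V).
  have -> : gmono i (f * H) = T (gmono i H).
    by rewrite gmono_t //; apply: on_off_regular.
  rewrite iterSr dc_t.
  have esk := e_submodule_dc (- bi i) k' (vs_es v0V).
  have := gs_submodule i esk (hmono k' H rH (IH k' (ltnSn k'))).
  by rewrite -scaleN1r; apply: (esZ esk).
have -> : gmono i 1 = a k *: gmono i (h k) + gmono i (f * H).
  have rfH : off_regular_fun U f (f * H) by apply: off_regularM; apply: on_off_regular.
  have rhk : off_regular_fun U f (h k) by apply: on_off_regular; apply: rh.
  rewrite -gmonoZ // hk gmonoP //; last exact: off_regular1.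
  by rewrite scaleN1r addrAC addNr add0r.
have -> : iter k (dc i) (a k *: gmono i (h k) + gmono i (f * H)) =
    a k *: iter k (dc i) (gmono i (h k)) + iter k (dc i) (gmono i (f * H)).
  exact: iter_dc_lin.
exact: (esP v0V).
Qed.

(** * From the V-filtration back to functional equations *)

Lemma gbounded_gs i m u : gbounded m u -> gbounded m.+1 (gs i u).
Proof.
move=> hu; rewrite /gs -[_ - _]addrC -scaleN1r; apply: gboundedP.
  by apply: gbounded_d; apply: gbounded_t.
by apply: gboundedZ; apply: gbounded_le hu.
Qed.

Lemma gval_gs_top i m u y : gbounded m.+1 u ->
  gval (gs i u) m.+1 i y = - f y * gval u m i y.
Proof.
move=> hu; have e0 : gval u m.+1 i y = 0 by rewrite hu.
rewrite /gs gvalB gvalZ.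
rewrite -[LHS]/(bi i * gval u m.+1 i y - gval (E u) m.+1 i y).
rewrite gval_e -[dt_act _ _ _ _]/(f y * gval u m i y - m.+1%:R * gval u m.+1 i y).
by rewrite e0; ring.
Qed.

Lemma gbounded_iter_gs i k m u : gbounded m u -> gbounded (m + k) (iter k (gs i) u).
Proof. by move=> hu; elim: k => [|k IHk]; rewrite ?addn0 //= addnS; apply: gbounded_gs. Qed.

Lemma gval_iter_gs_top i k g y : off_regular_fun U f g -> off y ->
  gval (iter k (gs i) (gmono i g)) k i y = (- f y) ^+ k * g y.
Proof.
move=> rg hy; elim: k => [|k IHk].
  by rewrite mul1r gval_mono // /mono !eqxx /= extend0_in.
rewrite iterS gval_gs_top ?IHk ?exprS ?mulrA //.
by rewrite -add1n; apply: gbounded_iter_gs; apply: gbounded_mono.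
Qed.

Lemma gbounded_gPhi i m (v : nat -> X -> K) : (forall j, off_regular_fun U f (v j)) ->
  gbounded m (gPhi m i v).
Proof.
move=> rv; rewrite /gPhi; elim/big_rec: _ => [|j u _ hu]; first exact: gbounded0.
apply: gboundedD => //; apply: (@gbounded_le (1 + j)).
  by rewrite add1n.
by apply: gbounded_iter_gs; apply: gbounded_mono.
Qed.

(** s^j multiplies the leading coefficient by (- f)^j, so [gPhi] is injective off the zeros of f. *)
Lemma gPhi_eq0 i m (v : nat -> X -> K) : (forall j, off_regular_fun U f (v j)) ->
  gPhi m i v = 0 -> forall j y, (j < m)%N -> off y -> v j y = 0.
Proof.
move=> rv; elim: m => [|m IHm] // Pv0.
have top y : off y -> v m y = 0.
  move=> hy; have [_ fy] := hy; have := congr1 (fun u => gval u m i y) Pv0.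
  rewrite /gPhi big_ord_recr /= gvalD gval0.
  rewrite -[(_ + _) m i y]/(gval (gPhi m i v) m i y + gval (iter m (gs i) (gmono i (v m))) m i y).
  rewrite (gbounded_gPhi i rv) // add0r gval_iter_gs_top //.
  by move/eqP; rewrite mulf_eq0 expf_eq0 oppr_eq0 (negPf fy) andbF => /eqP.
have {}/IHm IHm : gPhi m i v = 0.
  move: Pv0; rewrite /gPhi big_ord_recr /=.
  by rewrite (gmono_ext beta oU rf i (h := 0)) // gmono0 iter_gs0 addr0.
by move=> j y; rewrite ltnS leq_eqVlt => /orP[/eqP ->|/IHm]; [exact: top|exact].
Qed.

(** O delta + dc S. Iterated p times from S, it gives the sum of the O dc^j delta for j < p and of
    dc^p S. *)
Definition dc_ext i S : set GM := [set u | exists h v,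
  [/\ regular_on U h, S v & u = gmono i h + dc i v]].

(** Applying theta and E to h delta produces dc of h theta(f) delta and of h f delta; both arguments
    lie in J, whence the inclusion that is assumed. *)
Lemma dc_ext_submodule i S : e_submodule S -> gjac i `<=` S ->
  e_submodule (dc_ext i S) /\ forall h, regular_on U h -> dc_ext i S (gmono i h).
Proof.
move=> hS JS.
have r h : regular_on U h -> off_regular_fun U f h by exact: on_off_regular.
have mono h : regular_on U h -> dc_ext i S (gmono i h).
  by move=> rh; exists h, 0; split=> //; [exact: (es0 hS)|rewrite dc0 addr0].
split=> //; apply: graph_e_submodule.
- by rewrite -(gmono0 beta oU rf i); apply: mono; apply: regular_on0.
- move=> a _ _ [h [v [rh Sv ->]]] [h' [v' [rh' Sv' ->]]].
  exists (a *: h + h'), (a *: v + v'); split.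
  + by apply: regular_onD => //; apply: regular_onZ.
  + exact: (esP hS).
  + by rewrite gmonoP ?dcD ?dcZ; [rewrite scalerDr addrACA|exact: r|exact: r].
- move=> g _ rg [h [v [rh Sv ->]]]; exists (g * h), (gfun g v); split.
  + exact: regular_onM.
  + exact: (es_fun hS).
  + by rewrite gfunD // gfun_dc // gfun_mono //; apply: r.
- move=> theta _ dt [h [v [rh Sv ->]]].
  exists (theta h), (- 1 *: gmono i (h * theta f) + gder theta v); split.
  + exact: regular_on_der.
  + apply: (esP hS); last exact: (es_der hS dt Sv).
    by apply: JS; apply: gjac_theta.
  + rewrite gderD // gder_dc // gder_mono_dc //; last exact: r.
    by rewrite dcD dcZ scaleN1r -[LHS]addrA [h * _]mulrC.
- move=> _ [h [v [rh Sv ->]]].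
  exists (bi i *: h), (gmono i (h * f) + (-1 *: v + E v)); split.
  + exact: regular_onZ.
  + apply: (esD hS); first by apply: JS; apply: gjac_f.
    by apply: (esP hS) => //; apply: (es_e hS).
  + rewrite geD ge_dc ge_mono; last exact: r.
    rewrite gmonoZ; last exact: r.
    rewrite !dcD dcZ [h * f]mulrC scaleN1r -[LHS]addrA [RHS]addrCA.
    by rewrite [dc i (E v) - _]addrC.
Qed.

Lemma iter_dc_ext i S p : e_submodule S -> gjac i `<=` S ->
  e_submodule (iter p (dc_ext i) S) /\ gjac i `<=` iter p (dc_ext i) S.
Proof.
move=> hS JS; elim: p => //= p [hp Jp].
have [he mono] := dc_ext_submodule hp Jp; split=> //.
apply: (e_span_sub he) => u [->|[theta dt ->]]; apply: mono => //.
exact: regular_on_der.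
Qed.

Lemma dc_ext_trunc i S p u : iter p (dc_ext i) S u ->
  exists2 y : GM, S y & gbounded p (u - iter p (dc i) y).
Proof.
elim: p u => [|p IHp] u; first by exists u => //; rewrite subrr; apply: gbounded0.
move=> [h [v [rh /IHp[y Sy hy] ->]]]; exists y => //.
rewrite -addrA iterS; apply: gboundedD.
  apply: (gbounded_le (ltn0Sn p)); apply: gbounded_mono; exact: on_off_regular.
have -> : dc i v - dc i (iter p (dc i) y) = dc i (v - iter p (dc i) y).
  by rewrite -scaleN1r -dcZ -dcD scaleN1r.
exact: gbounded_dc.
Qed.

Lemma iter_dcB i p u v : iter p (dc i) (u - v) = iter p (dc i) u - iter p (dc i) v.
Proof. by rewrite addrC -scaleN1r iter_dc_lin scaleN1r addrC. Qed.

(** The given element is q(E) dc^p delta = dc^p w. For p > 0, dc^p w is in N, hence equals dc^p y up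
    to order below p for some y in S, and this forces w = y. *)
Lemma jac_of_gspan i S p q : e_submodule S -> gjac i `<=` S ->
  gspan [set i] (Ti (pe q (iter p (dc i) (gmono i 1)))) ->
  S (pe (q \Po ('X - (p%:R)%:P)) (gmono i 1)).
Proof.
move=> hS JS; have r1 : regular_on U 1 by move=> y _; apply: regular1.
have -> : pe q (iter p (dc i) (gmono i 1)) =
    iter p (dc i) (pe (q \Po ('X - (p%:R)%:P)) (gmono i 1)).
  have -> : iter p (dc i) (pe (q \Po ('X - (p%:R)%:P)) (gmono i 1)) =
    pe ((q \Po ('X - (p%:R)%:P)) \Po ('X + (p%:R)%:P)) (iter p (dc i) (gmono i 1)).
    exact: iter_tm_dc_poly.
  rewrite -comp_polyA comp_polyB comp_polyX comp_polyC addrK.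
  by rewrite comp_polyXr.
set w := pe _ (gmono i 1) => hw.
case: p w hw => [|p] w hw.
  (* For p = 0 membership in N would not be enough; instead w lies in t N, and t delta = f delta is
     in J. *)
  have : [set u | S (iter 1 T u)] (Ti w).
    apply: gspan_sub hw; first exact: (e_submodule_t hS 1).
    move=> _ ->; change (S (T (gmono i 1))).
    rewrite gmono_t; last exact: off_regular1.
    by apply: JS; rewrite mulrC; apply: gjac_f.
  change (S (T (Ti w)) -> S w).
  by have -> : T (Ti w) = w by exact: (@tm_tiK R GM).
have [hp Jp] := iter_dc_ext p hS JS.
have [he mono] := dc_ext_submodule hp Jp.
have {}hw : gspan [set i] (iter p.+1 (dc i) w).
  have := vs_t (gspan_v0 beta oU rf [set i]) hw.
  by have -> : T (Ti (iter p.+1 (dc i) w)) = iter p.+1 (dc i) w by exact: (@tm_tiK R GM).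
have {}hw : iter p.+1 (dc_ext i) S (iter p.+1 (dc i) w).
  by apply: (gspan_sub he _ hw) => _ ->; apply: mono.
have [y Sy] := dc_ext_trunc hw.
rewrite -iter_dcB => /iter_dc_order_eq0/eqP; rewrite subr_eq0 => /eqP ->.
exact: Sy.
Qed.

(** The image of S under [gPhi] contains (s + 1) J, because (s + 1) theta(f) delta = theta(f delta).
    So it contains (s + 1) q(s) delta, and injectivity of [gPhi] brings this back to S. *)
Lemma functional_of_jac q i :
  (forall S, e_submodule S -> gjac i `<=` S -> S (op_poly (gs i) q (gmono i 1))) ->
  functional_equation U f (q * ('X + 1)).
Proof.
move=> hq S [[S0 Slin] Sfun Sder Sshift] Sf.
(* [gPhi] sees only values off the zeros of f; the sequences are required to vanish elsewhere so
   that injectivity yields equality of functions. *)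
pose Phi_S : set GM := [set u : GM | exists m (v : nat -> X -> K),
  [/\ fin_seq U f m v, forall j y, ~ off y -> v j y = 0, S v & u = gPhi m i v]].
have hPhi : e_submodule Phi_S.
  have gsPhi (u : GM) : Phi_S u -> Phi_S (gs i u).
    move=> [m [v [fv v0 Sv ->]]]; exists m.+1, (shift_seq v); split.
    + exact: fin_seq_shift.
    + by case=> // j y hy; apply: v0.
    + exact: Sshift.
    + by rewrite gPhi_shift.
  have linPhi (a : K) (u u' : GM) : Phi_S u -> Phi_S u' -> Phi_S (a *: u + u').
    move=> [m [v [fv v0 Sv ->]]] [m' [v' [fv' v0' Sv' ->]]].
    exists (maxn m m'), (a *: v + v').
    have fu := fin_seq_le (leq_maxl m m') fv.
    have fu' := fin_seq_le (leq_maxr m m') fv'; split.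
    + exact: fin_seqP.
    + by move=> j y hy; rewrite -[LHS]/(a * v j y + v' j y) v0 // v0' // mulr0 addr0.
    + exact: Slin.
    + rewrite gPhiP // (gPhi_widen beta oU rf i (leq_maxl m m') fv).
      by rewrite (gPhi_widen beta oU rf i (leq_maxr m m') fv').
  have Phi0 : Phi_S 0.
    exists 0%N, 0; split=> //; last by rewrite /gPhi big_ord0.
    by split=> // j; apply: off_regular0.
  apply: graph_e_submodule => //.
  - move=> g _ rg [m [v [fv v0 Sv ->]]]; exists m, (fun j => g * v j); split.
    + exact: fin_seq_fun.
    + by move=> j y hy; rewrite mulrfctE v0 // mulr0.
    + exact: Sfun.
    + by rewrite gPhi_fun.
  - move=> theta _ dt [m [v [fv v0 Sv ->]]].
    have [fth hth] := gPhi_theta beta oU rf i dt fv.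
    exists m.+1, (theta_seq U f theta v); split=> //; last exact: Sder.
    move=> j y hy; rewrite -[LHS]/(extend0 off (theta (v j)) y +
      (if j is j'.+1 then (fun x => theta f x / f x * v j' x) else 0) y).
    rewrite extend0_out // add0r; case: j => // j.
    by rewrite v0 // mulr0.
  - move=> u Pu; have -> : E u = bi i *: u - gs i u by rewrite /gs opprB addrC subrK.
    rewrite addrC -scaleN1r; apply: (linPhi); first exact: gsPhi.
    by rewrite -[_ *: _]addr0; apply: (linPhi).
pose p1 : {poly K} := (bi i + 1)%:P - 'X.
have rf' : off_regular_fun U f f by apply: on_off_regular.
have Pf : Phi_S (gmono i f).
  pose v (j : nat) : X -> K := if j is 0%N then extend0 off f else 0.
  exists 1%N, v; split=> //.
  + split=> -[|j] //; last exact: off_regular0.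
    move=> y hy; apply: (regular_near_eq (g := f)); first exact: off_regular hy.
    by apply: filterS (off_nbhs oU rf hy) => z hz; rewrite /v extend0_in.
  + by case=> // y hy; rewrite /v extend0_out.
  + rewrite /gPhi big_ord1 /=.
    by apply: gmono_ext => y hy; rewrite extend0_in.
have hJ : gjac i `<=` [set u | Phi_S (pe p1 u)].
  apply: (e_span_sub (e_submodule_poly hPhi p1)).
  move=> u [->|[theta dt ->]]; first exact: (es_poly hPhi).
  rewrite /mkset gs1E.
  have -> : gs i (gmono i (theta f)) + gmono i (theta f) = gder theta (gmono i f).
    rewrite gder_mono // addrC; congr (_ + gs i _).
    by apply: gmono_ext => y [_ fy]; rewrite divfK.
  exact: (es_der hPhi dt Pf).
have : Phi_S (pe p1 (op_poly (gs i) q (gmono i 1))).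
  exact: (hq _ (e_submodule_poly hPhi p1) hJ).
have -> : pe p1 (op_poly (gs i) q (gmono i 1)) =
    op_poly (gs i) (q * ('X + 1)) (gmono i 1).
  rewrite !gs_poly -(op_polyM E); congr (pe _ _).
  rewrite comp_polyM comp_polyD comp_polyX comp_polyC mulrC; congr (_ * _).
  by rewrite /p1 polyCD; ring.
rewrite -gPhi_coef; set b := q * _ => -[m [v [fv v0 Sv e]]].
rewrite -/(coef_seq U f b).
suff -> : coef_seq U f b = v by [].
have fc := fin_seq_coef oU rf b.
pose M := maxn (size b) m.
have fc' := fin_seq_le (leq_maxl (size b) m) fc.
have fv' := fin_seq_le (leq_maxr (size b) m) fv.
have fs := fin_seqP (-1) fc' fv'.
have hs : gPhi M i (-1 *: coef_seq U f b + v) = 0.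
  rewrite gPhiP // scaleN1r (gPhi_widen beta oU rf i (leq_maxl (size b) m) fc) e.
  by rewrite (gPhi_widen beta oU rf i (leq_maxr (size b) m) fv) addNr.
apply/funext => j; apply/funext => y.
have [hy|hy] := pselect (off y); last by rewrite v0 // /coef_seq extend0_out.
have [jM|Mj] := ltnP j M; last by rewrite (fc'.2 _ Mj) (fv'.2 _ Mj).
have := gPhi_eq0 fs.1 hs jM hy.
rewrite -[_ y]/(-1 * coef_seq U f b j y + v j y) mulN1r addrC => /eqP.
by rewrite subr_eq0 => /eqP ->.
Qed.

(** The condition m = 1 of [v_can] provides Q with roots at least 1 and Q(E) dc^p delta in t N.
    Moving Q past dc^p and putting E = i beta - s gives q(s) = Q(i beta - s - p), whose roots are at
    most i beta - p - 1 = - (p + al). *)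
Lemma functional_of_v_can (al : R) i p : bi i = (1 - al)%:C%C ->
  v_can (gspan [set i]) 1 (iter p (dc i) (gmono i 1)) ->
  exists2 q : {poly K}, roots_in (fun z => z <= (- (p%:R + al))%:C%C) q &
    functional_equation U f (q * ('X + 1)).
Proof.
move=> biE hv; have [Q hQ NQ] := hv 1%N.
pose q := (Q \Po ('X - (p%:R)%:P)) \Po ((bi i)%:P - 'X).
exists q.
  move=> z; rewrite root_comp_sub -polyCN root_comp_shift => /hQ.
  rewrite /ge_re biE -(rmorph_nat (real_complex R)) => h.
  have -> : z = (1 - al)%:C%C - p%:R%:C%C - ((1 - al)%:C%C - z - p%:R%:C%C) by ring.
  rewrite lerBlDr -lerBlDl -!rmorphB.
  by apply: le_trans h; rewrite lecR; lra.
apply: (@functional_of_jac _ i) => S hS JS.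
rewrite gs_poly -comp_polyA.
have -> : ((bi i)%:P - 'X) \Po ((bi i)%:P - 'X) = 'X :> {poly K}.
  by rewrite comp_polyB comp_polyX comp_polyC; ring.
by rewrite comp_polyXr; apply: jac_of_gspan.
Qed.

Lemma gproj_iter_t i k u : gproj i (iter k T u) = iter k T (gproj i u).
Proof. by elim: k => //= k <-; rewrite gproj_t. Qed.

(** The V-filtration supplied by the definition is identified with [v_can] by uniqueness. In the sum
    of the d_t^j v_j only v_0 contributes to order 0, and projection keeps the component of
    f^beta. *)
Lemma hodge_filtration_v0 k i g : affine U -> val i = 1%N ->
  hodge_filtration_M l U f beta k g ->
  exists v0, [/\ v_can (gspan [set i]) 0 v0, exists m, glat i (iter m T (T v0)),
    gbounded k.+1 v0 & gval v0 0 i = g].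
Proof.
move=> affU i1 [V hV [v [hv hw]]].
have [V0 vb] := hv 0%N (leq0n k).
have Bv : B (v 0%N) by rewrite -(V_exhaustive hV); exists 0.
pose u := gmk (v 0%N); exists (gproj i u); split.
- apply: v_can_proj.
  apply/(v_filtration_unique (v_filtration_of oU rf hV) (e := fun i' : 'I_l => gmono i' 1)
    (gspan_v0 beta oU rf setT)).
  + by move=> S hS Se; apply: (gspan_sub hS) => i' _; apply: Se.
  + exact: gspan_exhaust.
  + by rewrite /mkset gmkK.
- have [m Nm] : exists m, gspan setT (iter m T (T u)) by exact: gspan_exhaust.
  exists m; apply: gspan_glat.
  by rewrite -gproj_t -gproj_iter_t; apply: gspan_proj.
- move=> j kj; rewrite gval_proj gmkK // vb ?subn0 //.
  by apply/funext => i'; case: ifP.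
- rewrite gval_proj eqxx gmkK //.
  have := congr1 (fun w : W => w 0%N i) hw; rewrite /= i1 eqxx => ->.
  have evs (F : 'I_k.+1 -> W) : (\sum_j F j) 0%N i = \sum_j F j 0%N i.
    by elim/big_rec2: _ => // j u1 u2 _ <-.
  by rewrite evs big_ord_recl /= big1 ?addr0.
Qed.

Lemma v_can_of_hodge (al : R) p i : affine U -> val i = 1%N -> 0 < al ->
  beta = (1 - al)%:C%C ->
  (forall k, (k <= p)%N ->
    hodge_filtration_M l U f beta k (extend0 off (fun x => 1 / f x ^+ k.+1))) ->
  v_can (gspan [set i]) 1 (iter p (dc i) (gmono i 1)).
Proof.
move=> affU i1 al0 betaE hp.
have biE : bi i = (1 - al)%:C%C by rewrite -[i%:R]/((val i)%:R) i1 mul1r.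
suff h k : (k <= p)%N -> v_can (gspan [set i]) 1 (iter k (dc i) (gmono i 1)).
  exact: h.
elim/ltn_ind: k => k IH kp.
have [v0 [V0 hm hb hv0]] := hodge_filtration_v0 affU i1 (hp k kp).
apply: (v_can_dc_step al0 biE V0 hm hb).
- by move=> y hy; rewrite hv0 extend0_in // mul1r.
- by move=> j jk; apply: IH => //; apply: leq_trans (ltnW jk) kp.
Qed.

Lemma functional_of_hodge (al : R) p i : affine U -> val i = 1%N -> 0 < al ->
  beta = (1 - al)%:C%C ->
  (forall k, (k <= p)%N ->
    hodge_filtration_M l U f beta k (extend0 off (fun x => 1 / f x ^+ k.+1))) ->
  exists2 q : {poly K}, roots_in (fun z => z <= (- (p%:R + al))%:C%C) q &
    functional_equation U f (q * ('X + 1)).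
Proof.
move=> affU i1 al0 betaE /(v_can_of_hodge affU i1 al0 betaE).
apply: functional_of_v_can.
by rewrite -[i%:R]/((val i)%:R) i1 mul1r.
Qed.

End HodgeComputation.

(** * Bernstein-Sato polynomials, minimal exponents and log canonicity *)

Section Global.
Variables (R : realType) (X : variety R).
Local Notation K := R[i].
Implicit Types (Z U V Y W : set X) (f : X -> K) (b c q : {poly K}).

Section FunctionalIdeal.
Variables (U : set X) (f : X -> K).

Lemma functional_equationP (a : K) b c : functional_equation U f b ->
  functional_equation U f c -> functional_equation U f (a *: b + c).
Proof.
move=> hb hc S hS Sf; have [[_ Slin] _ _ _] := hS.
have := Slin a _ _ (hb S hS Sf) (hc S hS Sf); congr (S _).
apply/funext => j; apply/funext => y; rewrite coefD coefZ.
rewrite -[LHS]/(a * extend0 (off_zeros U f) (fun=> b`_j) y +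
  extend0 (off_zeros U f) (fun=> c`_j) y).
have [hy|hy] := pselect (off_zeros U f y); first by rewrite !extend0_in.
by rewrite !extend0_out // mulr0 addr0.
Qed.

Lemma functional_equation0 : functional_equation U f 0.
Proof.
move=> S [[S0 _] _ _ _] _; move: S0; congr (S _).
apply/funext => j; apply/funext => y; rewrite coef0.
have [hy|hy] := pselect (off_zeros U f y); first by rewrite extend0_in.
by rewrite extend0_out.
Qed.

Lemma functional_equation_mulX b : functional_equation U f b ->
  functional_equation U f (b * 'X).
Proof.
move=> hb S hS Sf; have [_ _ _ Ssh] := hS.
have := Ssh _ (hb S hS Sf); congr (S _).
apply/funext => -[|j]; rewrite coefMX //=; apply/funext => y.
have [hy|hy] := pselect (off_zeros U f y); first by rewrite extend0_in.
by rewrite extend0_out.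
Qed.

Lemma functional_equation_dvd b c : b %| c -> functional_equation U f b ->
  functional_equation U f c.
Proof.
move=> /dvdpP[q ->] hb; elim/poly_ind: q => [|q a IHq].
  by rewrite mul0r; apply: functional_equation0.
rewrite mulrDl addrC mul_polyC -mulrA ['X * b]mulrC mulrA.
by apply: functional_equationP => //; apply: functional_equation_mulX.
Qed.

Lemma functional_equationD b c : functional_equation U f b ->
  functional_equation U f c -> functional_equation U f (b + c).
Proof. by move=> hb hc; rewrite -[b]scale1r; apply: functional_equationP. Qed.

End FunctionalIdeal.

Lemma beta_ratr (alpha : rat) :
  ratr (1 - alpha) = (1 - ratr alpha)%:C%C :> K.
Proof. by rewrite rmorphB rmorph1 rmorphB rmorph1 fmorph_rat. Qed.

Definition jump_bound (alpha : rat) p : pred K :=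
  fun z => z <= (- (p%:R + ratr alpha))%:C%C.

Lemma jump_bound_neq0 alpha p q : roots_in (jump_bound alpha p) q -> q != 0.
Proof.
apply: (@roots_in_neq0 _ _ _ (1 - (p%:R + ratr alpha))%:C%C).
by rewrite /jump_bound lecR -ltNge ltrDr.
Qed.

Section Pair.
Variables (Z : set X) (alpha : rat) (l p : nat).
Hypotheses (hZ : nonzero_reduced_divisor Z) (halpha : 0 < alpha <= 1).
Hypothesis hl : (2 <= l)%N.

Lemma hodge_ideal_full q U f k : affine U -> equation Z U f ->
  roots_in (jump_bound alpha p) q -> functional_equation U f (q * ('X + 1)) ->
  (k <= p)%N -> hodge_ideal l alpha U f k = [set g | regular_on U g].
Proof.
move=> affU eqf hq fq kp; apply/seteqP; split=> g; first by case.
move=> rg; split=> //.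
have [rf _ _] := eqf; have oU := affine_is_open affU.
have /andP[al0 al1] : 0 < (ratr alpha : R) <= 1 by rewrite ltr0q -(rmorph1 (@ratr R)) ler_rat.
pose i1 : 'I_l := Ordinal hl.
have biE : i1%:R * ratr (1 - alpha) = (1 - ratr alpha)%:C%C :> K.
  by rewrite -[i1%:R]/(1%:R) mul1r beta_ratr.
have nz : q * ('X + 1) != 0.
  by rewrite mulf_neq0 ?(jump_bound_neq0 hq) // -size_poly_eq0 size_XaddC.
have rr : real_roots (q * ('X + 1)).
  move=> z; rewrite rootM => /orP[/hq|].
    case: z => x y; rewrite /jump_bound lecE /= => /andP[/eqP y0 _].
    by exists x; rewrite -y0.
  rewrite rootE !hornerE addr_eq0 => /eqP ->; exists (-1).
  by rewrite rmorphN rmorph1.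
have hvf := @graph_v_can_filtration R X l U f _ oU rf _ _ affU (beta_ratr alpha) nz rr fq.
apply: (hodge_filtration_of_v_can (oU := oU) (rf := rf) (i1 := i1) _ al0 (beta_ratr alpha) hvf rg) => // k' kk.
have al01 : 0 < (ratr alpha : R) <= 1 by rewrite al0.
apply: v_can_mono (v_can_iter_dc oU rf al01 biE fq hq (leq_trans kk kp)).
exact: gspan_subset.
Qed.

Lemma log_canonical_functional U f Y : log_canonical l Z alpha p Y ->
  affine U -> U `<=` Y -> equation Z U f ->
  exists2 q, roots_in (jump_bound alpha p) q & functional_equation U f (q * ('X + 1)).
Proof.
move=> hlc affU UY eqf; have [rf _ _] := eqf; have oU := affine_is_open affU.
have al0 : 0 < ratr alpha :> R by rewrite ltr0q; case/andP: halpha.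
apply: (functional_of_hodge (i := Ordinal hl) oU rf affU _ al0 (beta_ratr alpha)) => // k kp.
have : hodge_ideal l alpha U f k 1.
  rewrite (hlc _ _ affU UY eqf k kp) => y _; exact: regular1.
by case.
Qed.

Lemma bernstein_sato_dvd Y b : bernstein_sato Z Y b -> forall x, Y x ->
  exists W f, [/\ affine W, W x, equation Z W f & functional_equation W f b].
Proof.
move=> [n [U [f [bs [hU hY hbs _ hb]]]]] x /hY[i Uix].
have [_ /(_ x Uix)[W [affW Wx WU hW]] _] := hbs i.
exists W, (f i); split=> //; first by apply: equation_sub WU _; case: (hU i).
apply: functional_equation_dvd hW.
by have := hb b; rewrite dvdpp => /esym/forallP.
Qed.

Lemma log_canonical_of_bernstein_sato Y q : bernstein_sato Z Y (q * ('X + 1)) ->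
  roots_in (jump_bound alpha p) q -> log_canonical l Z alpha p Y.
Proof.
move=> hb hq U f affU UY eqf k kp; apply: (hodge_ideal_full (q := q)) => //.
apply: (functional_equation_local hZ) => // x /UY; exact: bernstein_sato_dvd hb x.
Qed.

(* The Bernstein-Sato polynomial comes from functional equations on small
   affine sets only; combining each of them with the functional equation on the
   same set given by the Hodge ideals bounds its roots. *)
Lemma bernstein_sato_function_bound Y V f b : log_canonical l Z alpha p Y ->
  V `<=` Y -> equation Z V f -> bernstein_sato_function V f b ->
  exists2 q, roots_in (jump_bound alpha p) q & b %| q * ('X + 1).
Proof.
move=> hlc VY eqf [mb hb bmin].
have b0 := monic_neq0 mb.
have [P1 [P2 [bE hP1 hP2]]] := roots_split (jump_bound alpha p) b0.
(* P1 collects the roots of b within the bound. A nonzero remainder of P1 (s + 1) modulo b would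
   satisfy a functional equation and have smaller degree than b. *)
exists P1 => //; rewrite /dvdp; apply: contraT => r0.
suff /(bmin _ r0) : bernstein_sato_equation V f ((P1 * ('X + 1)) %% b).
  by rewrite leqNgt ltn_modp b0.
move=> x Vx; have [W [affW Wx WV hW]] := hb x Vx.
exists W; split=> //.
have [Q hQ fQ] := log_canonical_functional hlc affW (subset_trans WV VY)
  (equation_sub WV eqf).
have P20 : P2 != 0 by apply: contraNneq b0 => P20; rewrite bE P20 mulr0.
have Q0 := jump_bound_neq0 hQ.
have : coprimep Q P2 by apply: roots_in_coprime hQ hP2.
move=> /Bezout_eq1_coprimepP[[A B] /= AB].
(* P1 = P1 (A Q + B P2) = A P1 Q + B b, so the remainder is a combination of Q (s + 1) and b. *)
have -> : (P1 * ('X + 1)) %% b =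
    (A * P1) * (Q * ('X + 1)) + (B * ('X + 1) - (P1 * ('X + 1)) %/ b) * b.
  have := divp_eq (P1 * ('X + 1)) b; set r := _ %% b; set d := _ %/ b => e.
  have -> : r = P1 * ('X + 1) * (A * Q + B * P2) - d * b.
    by rewrite AB mulr1 e addrC addKr.
  by rewrite bE; ring.
by apply: functional_equationD; [apply: functional_equation_dvd fQ|
  apply: functional_equation_dvd hW]; apply: dvdp_mull.
Qed.

(** The least common multiple of the local polynomials divides s + 1 times the product of their
    bounded parts, and s + 1 cancels. *)
Lemma roots_of_log_canonical Y q : bernstein_sato Z Y (q * ('X + 1)) ->
  log_canonical l Z alpha p Y -> roots_in (jump_bound alpha p) q.
Proof.
move=> [n [U [f [bs [hU hY hbs _ hb]]]]] hlc.
have /choice[P hP] : forall i, exists P, roots_in (jump_bound alpha p) P /\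
    bs i %| P * ('X + 1).
  move=> i; have [|P hP bP] := bernstein_sato_function_bound hlc _ (hU i).2 (hbs i).
    by move=> x Ux; apply/hY; exists i.
  by exists P.
have : q * ('X + 1) %| (\prod_i P i) * ('X + 1).
  rewrite hb; apply/forallP => i; apply: dvdp_trans (hP i).2 _.
  by rewrite dvdp_mul // (bigD1 i) //= dvdp_mulIl.
rewrite dvdp_mul2r; last by rewrite -size_poly_eq0 size_XaddC.
move=> /roots_in_dvd; apply; apply: roots_in_prod => i; exact: (hP i).1.
Qed.

Lemma bernstein_sato_function_ex W f c : c != 0 -> bernstein_sato_equation W f c ->
  exists b, bernstein_sato_function W f b.
Proof.
have [n] := ubnP (size c); elim: n c => // n IHn c cn c0 hc.
have [[c' [c'0 hc' cc']]|] := pselect (exists c', [/\ c' != 0,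
  bernstein_sato_equation W f c' & (size c' < size c)%N]).
  by apply: (IHn c') => //; apply: leq_trans cc' _.
move=> hmin; exists ((lead_coef c)^-1 *: c); split.
- by rewrite monicE lead_coefZ mulVf // lead_coef_eq0.
- move=> x Wx; have [W' [affW' W'x W'W hW']] := hc x Wx; exists W'; split=> //.
  by apply: functional_equation_dvd hW'; rewrite dvdpZr // invr_eq0 lead_coef_eq0.
- move=> c' c'0 hc'; rewrite size_scale ?invr_eq0 ?lead_coef_eq0 // leqNgt.
  by apply/negP => lt; apply: hmin; exists c'.
Qed.

(** The minimality of the local polynomial is tested on a small affine W inside both neighbourhoods.
    That W has a Bernstein-Sato polynomial at all follows from the functional equation given by the
    Hodge ideals. *)
Lemma roots_of_log_canonical_at x q : bernstein_sato_at Z x (q * ('X + 1)) ->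
  (exists Y, [/\ open Y, Y x & log_canonical l Z alpha p Y]) ->
  roots_in (jump_bound alpha p) q.
Proof.
move=> [U [oU Ux [n [V [f [bs [hV hU hbs _ _]]]]] Umin]] [Y [oY Yx hlc]].
have [i Vix] : exists i, V i x by apply/hU.
have [W [affW Wx WVY]] := small_affine (openI (hV i).1 oY) (conj Vix Yx).
have WY : W `<=` Y by move=> y /WVY[].
have eqW : equation Z W (f i).
  by apply: equation_sub (hV i).2 => y /WVY[].
have [Q hQ fQ] := log_canonical_functional hlc affW WY eqW.
have [||b hb] := bernstein_sato_function_ex (W := W) (f := f i) (c := Q * ('X + 1)).
- by rewrite mulf_neq0 ?(jump_bound_neq0 hQ) // -size_poly_eq0 size_XaddC.
- by move=> y Wy; exists W; split.
have [P hP bP] := bernstein_sato_function_bound hlc WY eqW hb.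
have /dvdp_trans/(_ bP) : q * ('X + 1) %| b.
  apply: (Umin W) => //; first exact: affine_is_open.
  exists 1%N, (fun=> W), (fun=> f i), (fun=> b); split=> //.
  - by move=> _; split=> //; apply: affine_is_open.
  - by move=> y; split=> [Wy|[]//]; exists ord0.
  - by case: hb.
  - by move=> c; apply/idP/forallP => [bc _|/(_ ord0)].
rewrite dvdp_mul2r; last by rewrite -size_poly_eq0 size_XaddC.
by move=> /roots_in_dvd; apply.
Qed.

Lemma negated_largest_root_ge q a : q != 0 -> negated_largest_root q a ->
  roots_in (jump_bound alpha p) q <-> (p%:R%:E <= a - (ratr alpha)%:E)%E.
Proof.
move=> q0 [[sq ->]|[r [rq hr ->]]].
  split=> _; first by rewrite leey.
  move=> z /root_size_gt1 => /(_ q0); by rewrite ltnNge sq.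
rewrite -EFinB lee_fin; split=> [/(_ _ rq)|h z /hr hz].
  by rewrite /jump_bound lecR; lra.
by apply: le_trans hz _; rewrite lecR; lra.
Qed.

Lemma bernstein_sato_factor_neq0 Y q : bernstein_sato Z Y (q * ('X + 1)) -> q != 0.
Proof.
move=> [n [U [f [bs [_ _ _ /monic_neq0 + _]]]]].
by apply: contraNneq => ->; rewrite mul0r.
Qed.

End Pair.
End Global.
Theorem corollary6p1 (R : realType) (X : variety R) (Z : set X) (alpha : rat)
    (l p : nat) (hX : smooth X) (hZ : nonzero_reduced_divisor Z)
    (halpha : 0 < alpha <= 1)
    (hl : (2 <= l)%N) (hlbeta : l%:R * (1 - alpha) \is a Num.int) :
  (forall a : \bar R, minimal_exponent Z a ->
     (log_canonical l Z alpha p [set: X] <->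
      (p%:R%:E <= a - (ratr alpha)%:E)%E)) /\
  (forall x : X, Z x -> forall a : \bar R, minimal_exponent_at Z x a ->
     ((exists Y : set X, [/\ open Y, Y x & log_canonical l Z alpha p Y]) <->
      (p%:R%:E <= a - (ratr alpha)%:E)%E)).

Proof.
split=> [a [q hq ha]|x Zx a [q hq ha]].
  have q0 := bernstein_sato_factor_neq0 hq.
  rewrite -(negated_largest_root_ge alpha p q0 ha); split.
    exact: roots_of_log_canonical hq.
  exact: log_canonical_of_bernstein_sato hq.
have [U [oU Ux hU _]] := hq; have q0 := bernstein_sato_factor_neq0 hU.
rewrite -(negated_largest_root_ge alpha p q0 ha); split.
  exact: roots_of_log_canonical_at hq.
(* The neighbourhood on which the local Bernstein-Sato polynomial is attained. *)
move=> hroots; exists U; split=> //.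
exact: log_canonical_of_bernstein_sato hU hroots.
Qed.
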